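(* Let $T$ be the Jacobi operator associated to an indeterminate Hamburger moment sequence, with orthonormal polynomials $P_n$, and let $P(\lambda)=\big(\sum_{n=0}^\infty|P_n(\lambda)|^2\big)^{1/2}$. Then the first Chern form of the characteristic line bundle $F$ of $T$ is $c_1(F)=2dd^c\ln P(\lambda)$. In particular, $$\mathrm{T}_F(r)=\frac1\pi\int_0^\pi\ln P(re^{\mathrm{i}\phi})\,d\phi-\ln P(0).$$
   Context: Moment problem. Let $s=\{s_i\}_{i=0}^\infty$ be a real sequence with $s_0=1$ that is positive-definite: $\sum_{i,j=0}^n s_{i+j}\xi_i\overline{\xi_j}>0$ for all $n$ and all nonzero $(\xi_0,\dots,\xi_n)\in\mathbb{C}^{n+1}$. It is indeterminate if there is more than one positive Borel measure $\mu$ on $\mathbb{R}$ with $s_i=\int x^i d\mu$ for all $i\ge0$. On polynomials use the inner product determined by $(\lambda^i,\lambda^j)=s_{i+j}$; Gram–Schmidt applied to $1,\lambda,\lambda^2,\dots$ gives the orthonormal polynomials $P_n$ (real coefficients, positive leading coefficient, $P_0\equiv1$), which satisfy $\lambda P_n=a_nP_{n+1}+b_nP_n+a_{n-1}P_{n-1}$ with $a_n>0$, $b_n\in\mathbb{R}$, $P_{-1}\equiv0$. The Jacobi operator $T$ is the closure in $l^2(\mathbb{N}_0)$ of the operator on finite sequences given by $Te_n=a_ne_{n+1}+b_ne_n+a_{n-1}e_{n-1}$, $e_{-1}:=0$, where $\{e_n\}$ is the standard basis. In the indeterminate case $T$ is a densely defined, closed, simple symmetric operator with deficiency indices $(1,1)$,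 and for every $\lambda\in\mathbb{C}$ the space $\ker(T^*-\lambda)$ is one-dimensional. Characteristic line bundle. Let $E_\lambda=\ker(T^*-\lambda)\subset l^2(\mathbb{N}_0)$, a holomorphic line bundle $E$ over $\mathbb{C}$. Let $F^\dag_\lambda=E_{\bar\lambda}$ with the $l^2$ norm and $F_\lambda$ the space of conjugate-linear functionals on $F^\dag_\lambda$ with the dual norm $|\cdot|$. $F$ is a holomorphic Hermitian line bundle over $\mathbb{C}$: a section $\sigma$ is holomorphic iff $\lambda\mapsto\langle\sigma(\lambda),v(\bar\lambda)\rangle$ is holomorphic for every local holomorphic section $v$ of $E$. With $R=\bar\partial\partial\ln|\sigma|^2$ ($\sigma$ any local holomorphic frame) the Chern curvature, $c_1(F)=\frac{\mathrm{i}}{2\pi}R$ and $\mathrm{T}_F(r)=\int_0^r\frac{dt}{t}\int_{\mathbb{D}_t}c_1(F)$, $\mathbb{D}_t=\{|\lambda|<t\}$. Here $d^c=\frac{\mathrm{i}}{4\pi}(\bar\partial-\partial)$. *)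

(* Defs.v *)
From HB Require Import structures.
From mathcomp Require Import all_boot all_order all_algebra.
From mathcomp Require Import complex.
From mathcomp Require Import all_classical all_reals all_analysis.

Set Implicit Arguments.
Unset Strict Implicit.
Unset Printing Implicit Defensive.

Import Order.TTheory GRing.Theory Num.Theory.
Import numFieldNormedType.Exports.

Local Open Scope classical_set_scope.
Local Open Scope ring_scope.

(** The topology of the complex numbers is the one carried by [R[i]^o]; the
    ascriptions to [R[i]^o] below serve only to select it. *)

Definition cmod (R : realType) (z : R[i]) : R := ComplexField.Normc.normc z.

Definition cconj (R : realType) (z : R[i]) : R[i] := conjc z.

Definition ofR (R : realType) (x : R) : R[i] := x%:C%C.

Definition positive_definite (R : realType) (s : nat -> R) : Prop :=
  forall (n : nat) (xi : 'rV[R[i]]_n.+1), xi != 0 ->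
    0 < \sum_(i < n.+1) \sum_(j < n.+1)
          ofR (s (i + j)%N) * xi 0 i * cconj (xi 0 j).

Definition moment_solution (R : realType) (s : nat -> R)
    (mu : {measure set (measurableTypeR R) -> \bar R}) : Prop :=
  forall i : nat,
    mu.-integrable setT (fun x : measurableTypeR R => ((x : R) ^+ i)%:E) /\
    (\int[mu]_x ((x : R) ^+ i)%:E = (s i)%:E)%E.

Definition indeterminate (R : realType) (s : nat -> R) : Prop :=
  exists mu nu : {measure set (measurableTypeR R) -> \bar R},
    [/\ moment_solution s mu, moment_solution s nu &
        exists A : set (measurableTypeR R), measurable A /\ mu A <> nu A].

Definition moment_form (R : realType) (s : nat -> R) (p q : {poly R}) : R :=
  \sum_(i < size p) \sum_(j < size q) p`_i * q`_j * s (i + j)%N.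

(** The first [n] polynomials that Gram-Schmidt extracts from
    [1, 'X, 'X^2, ...]. *)
Fixpoint gram_schmidt (R : realType) (s : nat -> R) (n : nat) : seq {poly R} :=
  if n is m.+1 then
    let ps := gram_schmidt s m in
    let q := 'X^m - \sum_(p <- ps) moment_form s 'X^m p *: p in
    rcons ps ((Num.sqrt (moment_form s q q))^-1 *: q)
  else [::].

Definition orthopoly (R : realType) (s : nat -> R) (n : nat) : {poly R} :=
  last 0 (gram_schmidt s n.+1).

(** By orthonormality these are the coefficients of the recurrence
    ['X * P_n = a_n P_(n+1) + b_n P_n + a_(n-1) P_(n-1)]. *)
Definition jacobi_a (R : realType) (s : nat -> R) (n : nat) : R :=
  moment_form s ('X * orthopoly s n) (orthopoly s n.+1).

Definition jacobi_b (R : realType) (s : nat -> R) (n : nat) : R :=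
  moment_form s ('X * orthopoly s n) (orthopoly s n).

Definition orthopoly_vec (R : realType) (s : nat -> R) (lam : R[i])
    : nat -> R[i] :=
  fun n => (map_poly (@ofR R) (orthopoly s n)).[lam].

Definition l2 (R : realType) (x : nat -> R[i]) : Prop :=
  cvgn (series (fun n => cmod (x n) ^+ 2)).

Definition l2inner (R : realType) (x y : nat -> R[i]) : R[i] :=
  limn (series (fun n => x n * cconj (y n)) : nat -> R[i]^o).

Definition l2norm (R : realType) (x : nat -> R[i]) : R :=
  Num.sqrt (limn (series (fun n => cmod (x n) ^+ 2))).

Definition l2basis (R : realType) (n : nat) : nat -> R[i] :=
  fun m => (m == n)%:R.

(** Unbounded operators are given by their graphs. *)
Definition op_closure (R : realType)
    (A : (nat -> R[i]) -> (nat -> R[i]) -> Prop) (x y : nat -> R[i]) : Prop :=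
  [/\ l2 x, l2 y &
      exists xk yk : nat -> nat -> R[i],
        [/\ forall k, A (xk k) (yk k),
            (fun k => l2norm (xk k - x)) @ \oo --> (0 : R) &
            (fun k => l2norm (yk k - y)) @ \oo --> (0 : R)]].

Definition op_adjoint (R : realType)
    (A : (nat -> R[i]) -> (nat -> R[i]) -> Prop) (v w : nat -> R[i]) : Prop :=
  [/\ l2 v, l2 w & forall x y, A x y -> l2inner y v = l2inner x w].

Definition jacobi_basis (R : realType) (s : nat -> R) (n : nat)
    : nat -> R[i] :=
  ofR (jacobi_a s n) *: l2basis R n.+1 + ofR (jacobi_b s n) *: l2basis R n
  + (if n is m.+1 then ofR (jacobi_a s m) *: l2basis R m else 0).

Definition jacobi_finite (R : realType) (s : nat -> R) (x y : nat -> R[i])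
    : Prop :=
  exists N : nat, (forall n, (N <= n)%N -> x n = 0) /\
    y = \sum_(n < N) x n *: jacobi_basis s n.

Definition jacobi_operator (R : realType) (s : nat -> R)
    : (nat -> R[i]) -> (nat -> R[i]) -> Prop :=
  op_closure (jacobi_finite s).

Definition holomorphic_at (R : realType) (f : R[i] -> R[i]) (z : R[i]) : Prop :=
  derivable (f : R[i]^o -> R[i]^o) z 1.

Definition fiberE (R : realType) (s : nat -> R) (lam : R[i])
    (v : nat -> R[i]) : Prop :=
  op_adjoint (jacobi_operator s) v (lam *: v).

(** [E] is a subbundle of the trivial bundle with fiber l^2, so holomorphy of a
    section is complex differentiability in the l^2 norm. *)
Definition holomorphic_sectionE (R : realType) (s : nat -> R)
    (W : set R[i]) (v : R[i] -> nat -> R[i]) : Prop :=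
  forall z, W z -> fiberE s z (v z) /\
    exists v' : nat -> R[i], l2 v' /\
      l2norm (h^-1 *: (v (z + h) - v z) - v') @[h --> (0 : R[i]^o)^']
        --> (0 : R).

(** An element of [F_lam] is the restriction to [E_(conj lam)] of a map
    [phi : (nat -> R[i]) -> R[i]]; only values on [E_(conj lam)] matter. *)
Definition fiberF (R : realType) (s : nat -> R) (lam : R[i])
    (phi : (nat -> R[i]) -> R[i]) : Prop :=
  forall (c : R[i]) (v w : nat -> R[i]),
    fiberE s (cconj lam) v -> fiberE s (cconj lam) w ->
    phi (c *: v + w) = cconj c * phi v + phi w.

Definition dual_norm (R : realType) (s : nat -> R) (lam : R[i])
    (phi : (nat -> R[i]) -> R[i]) : R :=
  sup [set x : R | exists v : nat -> R[i],
    [/\ fiberE s (cconj lam) v, l2norm v <= 1 & x = cmod (phi v)]].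

Definition holomorphic_sectionF (R : realType) (s : nat -> R)
    (U : set R[i]) (sigma : R[i] -> (nat -> R[i]) -> R[i]) : Prop :=
  (forall z, U z -> fiberF s z (sigma z)) /\
  (forall (W : set R[i]) (v : R[i] -> nat -> R[i]),
     open (W : set R[i]^o) -> holomorphic_sectionE s W v ->
     forall z, U z -> W (cconj z) ->
       holomorphic_at (fun lam => sigma lam (v (cconj lam))) z).

Definition holomorphic_frameF (R : realType) (s : nat -> R)
    (U : set R[i]) (sigma : R[i] -> (nat -> R[i]) -> R[i]) : Prop :=
  [/\ open (U : set R[i]^o), holomorphic_sectionF s U sigma &
      forall z, U z -> exists v, fiberE s (cconj z) v /\ sigma z v != 0].

(** Complex differential forms on the plane: a 0-form is a function,
    a pair [(f, g)] is the 1-form [f dz + g dzbar], and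
    a 2-form is given by its coefficient with respect to [dz /\ dzbar]. *)

Definition form0 (R : realType) : Type := R[i] -> R[i].
Definition form1 (R : realType) : Type :=
  ((R[i] -> R[i]) * (R[i] -> R[i]))%type.
Definition form2 (R : realType) : Type := R[i] -> R[i].

Definition partial_x (R : realType) (f : R[i] -> R[i]) (z : R[i]) : R[i] :=
  Complex
    (derive1 (fun t : R => complex.Re (f (Complex t (complex.Im z))))
       (complex.Re z))
    (derive1 (fun t : R => complex.Im (f (Complex t (complex.Im z))))
       (complex.Re z)).

Definition partial_y (R : realType) (f : R[i] -> R[i]) (z : R[i]) : R[i] :=
  Complex
    (derive1 (fun t : R => complex.Re (f (Complex (complex.Re z) t)))
       (complex.Im z))
    (derive1 (fun t : R => complex.Im (f (Complex (complex.Re z) t)))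
       (complex.Im z)).

Definition wirtinger (R : realType) (f : R[i] -> R[i]) (z : R[i]) : R[i] :=
  (partial_x f z - 'i%C * partial_y f z) / 2.

Definition wirtinger_bar (R : realType) (f : R[i] -> R[i]) (z : R[i]) : R[i] :=
  (partial_x f z + 'i%C * partial_y f z) / 2.

Definition del0 (R : realType) (f : form0 R) : form1 R :=
  (wirtinger f, fun=> 0).

Definition delbar0 (R : realType) (f : form0 R) : form1 R :=
  (fun=> 0, wirtinger_bar f).

Definition del1 (R : realType) (w : form1 R) : form2 R := wirtinger w.2.

(** The sign is that of [dzbar /\ dz = - dz /\ dzbar]. *)
Definition delbar1 (R : realType) (w : form1 R) : form2 R :=
  fun z => - wirtinger_bar w.1 z.

Definition ext_d1 (R : realType) (w : form1 R) : form2 R :=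
  fun z => del1 w z + delbar1 w z.

Definition dc0 (R : realType) (f : form0 R) : form1 R :=
  let c := 'i%C / ofR (4 * pi) in
  (fun z => c * ((delbar0 f).1 z - (del0 f).1 z),
   fun z => c * ((delbar0 f).2 z - (del0 f).2 z)).

Definition ddc (R : realType) (f : form0 R) : form2 R := ext_d1 (dc0 f).

Definition Cintegral (R : realType) (d : measure_display)
    (X : measurableType d) (mu : {measure set X -> \bar R}) (D : set X)
    (f : X -> R[i]) : R[i] :=
  Complex (\int[mu]_(x in D) complex.Re (f x))
          (\int[mu]_(x in D) complex.Im (f x)).

(** [dz /\ dzbar = - 2 i dx /\ dy]. *)
Definition disk_integral (R : realType) (t : R) (w : form2 R) : R[i] :=
  Cintegral (@lebesgue_measure R \x @lebesgue_measure R)%E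
    [set p : measurableTypeR R * measurableTypeR R |
       (p.1 : R) ^+ 2 + (p.2 : R) ^+ 2 < t ^+ 2]
    (fun p => (- 2 * 'i%C) * w (Complex (p.1 : R) (p.2 : R))).

Definition log_norm2 (R : realType) (s : nat -> R)
    (sigma : R[i] -> (nat -> R[i]) -> R[i]) : form0 R :=
  fun z => ofR (ln (dual_norm s z (sigma z) ^+ 2)).

Definition chern_curvature (R : realType) (s : nat -> R)
    (sigma : R[i] -> (nat -> R[i]) -> R[i]) : form2 R :=
  delbar1 (del0 (log_norm2 s sigma)).

(** [w] is the first Chern form of [F]: local holomorphic frames exist, and
    every one of them yields [w] on its domain. *)
Definition is_first_chern_form (R : realType) (s : nat -> R) (w : form2 R)
    : Prop :=
  (forall z, exists U sigma, U z /\ holomorphic_frameF s U sigma) /\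
  (forall U sigma, holomorphic_frameF s U sigma ->
     forall z, U z ->
       w z = 'i%C / ofR (2 * pi) * chern_curvature s sigma z).

Definition first_chern_form (R : realType) (s : nat -> R) : form2 R :=
  xget (fun=> 0) [set w : R[i] -> R[i] | is_first_chern_form s w].

Definition charT (R : realType) (s : nat -> R) (r : R) : R[i] :=
  Cintegral (@lebesgue_measure R) `]0, r[
    (fun t : measurableTypeR R =>
       ofR (t : R)^-1 * disk_integral t (first_chern_form s)).

Definition orthopoly_norm (R : realType) (s : nat -> R) (lam : R[i]) : R :=
  l2norm (orthopoly_vec s lam).

(* Main.v *)
Require Import Defs.
From HB Require Import structures.
From mathcomp Require Import all_boot all_order all_algebra.
From mathcomp Require Import complex.
From mathcomp Require Import all_classical all_reals all_analysis.
From mathcomp Require Import measurable_realfun.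
From mathcomp Require Import ring lra.

Set Implicit Arguments.
Unset Strict Implicit.
Unset Printing Implicit Defensive.

Import Order.TTheory GRing.Theory Num.Theory.
Import numFieldNormedType.Exports.

Local Open Scope classical_set_scope.
Local Open Scope ring_scope.

(** Write [p(z)] for the sequence [(P_n(z))_n] and [c_n] for the integral of [P_n(x) / (x - l)]
    against a solution [mu]. Bessel's inequality makes [c] square summable for non-real [l]. If
    [p(l)] were square summable for no such [l], any two solutions would have the same Stieltjes
    transform, hence be equal. Choose [l] with [p(l)] in l^2. Then
    [P_n(z) = P_n(l) + (z - l) \sum_(k < n) a_(n,k) P_k(z)] with
    [a_(n,k) = P_k(l) c_n - P_n(l) c_k] a Hilbert-Schmidt kernel, and a Gronwall argument for this
    Volterra equation shows that [p] is an entire l^2-valued function.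

    The fiber of [E] over [z] is spanned by [p(z)], so that a holomorphic frame [sigma] of [F] has
    norm [|f(z)| / |p(z)|], where [f(z) = sigma(z)(p(conj z))] is holomorphic without zeros. As
    [ln |f|^2] is harmonic, the curvature is that of [1 / |p|^2]; harmonicity needs [f'] to be
    differentiable again, which is Cauchy's formula (by Goursat's argument).

    For [u = ln |p|], Green's formula on the disk of radius [t] is obtained from Fubini's theorem
    and the fundamental theorem of calculus in each variable, and the symmetry
    [u(conj z) = u(z)] reduces the flux to twice that through the upper half circle. Dividing by
    [t] and integrating over [0 < t < r] gives the formula for [T_F]. *)

(** * Orthonormal polynomials *)

(** One good point l suffices because the Volterra identity is algebra: it follows from
    orthogonality and the relation [m' i.+1 - l * m' i = m i], and a measure enters only through
    these numbers and Bessel's inequality. A point is good as soon as the Poisson integrals of two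
    solutions differ there; that they cannot agree everywhere is Stieltjes-Perron inversion. The l^2
    estimates are made on truncated sums with constants independent of the length, since convergence
    is what has to be proved. The increment of p and its remainder after removal of the derivative
    solve Volterra equations with the same kernel, so one Gronwall bound yields both size and
    differentiability. Three derivatives of p are controlled: the curvature contains p', the second
    derivative of [ln |p|] along dz contains p'', and the continuity of the latter, an input of
    Green's formula, is drawn from p'''. The fibers of F live over the conjugate point; real
    coefficients give [|p (conj z)| = |p z|], which removes the conjugation from the norm. The Chern
    form is defined by a choice operator; the global frame that sends v to the conjugate of [v 0]
    pins it down at every point. *)

Definition moment_functional (K : nzRingType) (m : nat -> K) (p : {poly K}) : K :=
  \sum_(i < size p) p`_i * m i.

Lemma moment_functionalE (K : nzRingType) (m : nat -> K) (p : {poly K}) (n : nat) :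
  (size p <= n)%N -> moment_functional m p = \sum_(i < n) p`_i * m i.
Proof.
move=> pn; rewrite /moment_functional (big_ord_widen _ (fun i => p`_i * m i) pn).
rewrite [RHS](bigID (fun i : 'I_n => (i < size p)%N)) /= [X in _ + X]big1 ?addr0 //.
by move=> i; rewrite -leqNgt => h; rewrite nth_default ?mul0r.
Qed.

Lemma moment_functionalD (K : nzRingType) (m : nat -> K) (p q : {poly K}) :
  moment_functional m (p + q) = moment_functional m p + moment_functional m q.
Proof.
pose n := maxn (size p) (size q).
rewrite (@moment_functionalE _ _ _ n) ?size_polyD //.
rewrite (@moment_functionalE _ _ p n) ?leq_maxl //.
rewrite (@moment_functionalE _ _ q n) ?leq_maxr // -big_split /=.
by apply: eq_bigr => i _; rewrite coefD mulrDl.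
Qed.

Lemma moment_functionalZ (K : nzRingType) (m : nat -> K) (c : K) (p : {poly K}) :
  moment_functional m (c *: p) = c * moment_functional m p.
Proof.
rewrite (@moment_functionalE _ _ _ (size p)) ?size_scale_leq // mulr_sumr.
by apply: eq_bigr => i _; rewrite coefZ mulrA.
Qed.

Lemma moment_functional0 (K : nzRingType) (m : nat -> K) : moment_functional m 0 = 0.
Proof. by rewrite /moment_functional size_poly0 big_ord0. Qed.

Lemma moment_functionalB (K : nzRingType) (m : nat -> K) (p q : {poly K}) :
  moment_functional m (p - q) = moment_functional m p - moment_functional m q.
Proof. by rewrite moment_functionalD -scaleN1r moment_functionalZ mulN1r. Qed.

Lemma moment_functional_sum (K : nzRingType) (m : nat -> K) (I : Type) (r : seq I)
    (P : pred I) (F : I -> {poly K}) :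
  moment_functional m (\sum_(i <- r | P i) F i)
  = \sum_(i <- r | P i) moment_functional m (F i).
Proof.
by apply: (big_morph (moment_functional m)) => [p q|];
  rewrite ?moment_functionalD ?moment_functional0.
Qed.

Lemma moment_functional1 (K : nzRingType) (m : nat -> K) : moment_functional m 1 = m 0%N.
Proof. by rewrite (@moment_functionalE _ _ _ 1) ?size_poly1 // big_ord1 coef1 mul1r. Qed.

Lemma moment_functional_map (K L : nzRingType) (f : {rmorphism K -> L}) (m : nat -> K)
    (p : {poly K}) :
  moment_functional (f \o m) (map_poly f p) = f (moment_functional m p).
Proof.
rewrite (@moment_functionalE _ _ _ (size p)) ?size_poly // rmorph_sum.
by apply: eq_bigr => i _; rewrite coef_map rmorphM.
Qed.

Definition orthonormal_polys (K : fieldType) (m : nat -> K) (P : nat -> {poly K}) : Prop :=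
  (forall n, size (P n) = n.+1) /\
  (forall j k, moment_functional m (P j * P k) = (j == k)%:R).

(** Subtract the multiple of [P n] that cancels the top coefficient and induct on the degree bound;
    what remains is orthogonal to [P n], so that the multiple is the Fourier coefficient at [n]. *)
Lemma ortho_expand (K : fieldType) (m : nat -> K) (P : nat -> {poly K}) (n : nat)
    (p : {poly K}) : orthonormal_polys m P -> (size p <= n)%N ->
  p = \sum_(k < n) moment_functional m (p * P k) *: P k.
Proof.
move=> [sP oP]; elim: n p => [|n IH] p.
  by rewrite leqn0 size_poly_eq0 => /eqP ->; rewrite big_ord0.
move=> sp; pose c := p`_n / lead_coef (P n).
have lc0 : lead_coef (P n) != 0 by rewrite lead_coef_eq0 -size_poly_eq0 sP.
have sq : (size (p - c *: P n)%R <= n)%N.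
  apply/leq_sizeP => j; rewrite leq_eqVlt => /predU1P[<-|nj].
    rewrite coefB coefZ; have -> : (P n)`_n = lead_coef (P n) by rewrite lead_coefE sP.
    by rewrite /c mulfVK // subrr.
  by rewrite coefB coefZ !nth_default ?mulr0 ?subr0 ?sP // (leq_trans sp).
have E : p = (p - c *: P n) + c *: P n by rewrite subrK.
have IE k : (k <= n)%N -> moment_functional m (p * P k) =
    moment_functional m ((p - c *: P n) * P k) + (if k == n then c else 0).
  move=> kn; rewrite {1}E mulrDl moment_functionalD -scalerAl moment_functionalZ oP.
  by rewrite eq_sym; case: eqP; rewrite ?mulr1 ?mulr0.
have Z : moment_functional m ((p - c *: P n) * P n) = 0.
  rewrite (IH _ sq) mulr_suml moment_functional_sum big1 // => i _.
  by rewrite -scalerAl moment_functionalZ oP ltn_eqF ?mulr0.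
rewrite big_ord_recr /= IE // eqxx Z add0r {1}E; congr (_ + _); rewrite {1}(IH _ sq).
by apply: eq_bigr => i _; rewrite IE ?(ltnW (ltn_ord i)) // ltn_eqF // addr0.
Qed.

Lemma ortho_low (K : fieldType) (m : nat -> K) (P : nat -> {poly K}) (n : nat)
    (p : {poly K}) : orthonormal_polys m P -> (size p <= n)%N ->
  moment_functional m (P n * p) = 0.
Proof.
move=> oP sp; rewrite (ortho_expand oP sp) mulr_sumr moment_functional_sum big1 // => i _.
by rewrite -scalerAr moment_functionalZ oP.2 gtn_eqF ?mulr0.
Qed.

(** ['X] moves across the product inside the functional, so the coefficient of [P k] in ['X * P n]
    vanishes by [ortho_low] once ['X * P k] has degree below [n]. The same symmetry lets the last
    coefficient be written as the off-diagonal entry of the preceding index. *)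
Lemma ortho_recurrence (K : fieldType) (m : nat -> K) (P : nat -> {poly K}) (n : nat) :
  orthonormal_polys m P ->
  'X * P n = moment_functional m ('X * P n * P n.+1) *: P n.+1
    + moment_functional m ('X * P n * P n) *: P n
    + (if n is k.+1 then moment_functional m ('X * P k * P k.+1) *: P k else 0).
Proof.
move=> oP; have sX : (size ('X * P n)%R <= n.+2)%N.
  by rewrite (leq_trans (size_polyMleq _ _)) // size_polyX oP.1.
rewrite {1}(ortho_expand oP sX) !big_ord_recr /= addrC [X in _ + X]addrC addrA; congr (_ + _ + _).
case: n sX => [|n] sX; first by rewrite big_ord0.
rewrite big_ord_recr /= big1 ?add0r => [|i _].
  by congr (moment_functional m _ *: _); ring.
have -> : 'X * P n.+1 * P i = P n.+1 * ('X * P i) by ring.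
rewrite (ortho_low oP) ?scale0r // (leq_trans (size_polyMleq _ _)) //.
by rewrite size_polyX oP.1 /= ltnS ltn_ord.
Qed.

(** Otherwise ['X * P n], of degree [n.+1], would be a combination of [P 0], ..., [P n]. *)
Lemma ortho_recurrence_neq0 (K : fieldType) (m : nat -> K) (P : nat -> {poly K}) (n : nat) :
  orthonormal_polys m P -> moment_functional m ('X * P n * P n.+1) != 0.
Proof.
move=> oP; apply/eqP => a0.
have sX : size ('X * P n) = n.+2.
  by rewrite mulrC size_mulX ?oP.1 // -size_poly_eq0 oP.1.
have sX' : (size ('X * P n)%R <= n.+2)%N by rewrite sX.
have : (size ('X * P n)%R <= n.+1)%N.
  rewrite (ortho_expand oP sX') big_ord_recr /= a0 scale0r addr0.
  rewrite (leq_trans (size_sum _ _ _)) //; apply/bigmax_leqP => i _.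
  by rewrite (leq_trans (size_scale_leq _ _)) // oP.1 ltn_ord.
by rewrite sX ltnn.
Qed.

(* [m'] plays the role of the moments of [dmu / (x - l)]. *)
Definition resolvent_moments (K : nzRingType) (l : K) (m m' : nat -> K) : Prop :=
  forall i, m' i.+1 - l * m' i = m i.

Lemma resolvent_functional (K : fieldType) (l : K) (m m' : nat -> K) (p : {poly K}) :
  resolvent_moments l m m' ->
  moment_functional m' (('X - l%:P) * p) = moment_functional m p.
Proof.
move=> mm'; rewrite (@moment_functionalE _ _ _ (size p).+1); last first.
  by rewrite (leq_trans (size_polyMleq _ _)) // size_XsubC.
under eq_bigr do rewrite mulrBl coefB coefCM coefXM mulrBl.
rewrite sumrB big_ord_recl /= mul0r add0r [X in _ - X]big_ord_recr /=.
rewrite [in X in _ - X]nth_default // mulr0 mul0r addr0 -sumrB.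
by apply: eq_bigr => i _; rewrite -mm' mulrBr mulrA (mulrC l).
Qed.

Lemma factor_horner (K : fieldType) (l : K) (p : {poly K}) :
  exists2 q, p - (p.[l])%:P = ('X - l%:P) * q & size q = (size p).-1.
Proof.
have /factor_theorem [q E] : root (p - (p.[l])%:P) l by rewrite /root !hornerE subrr.
rewrite mulrC in E.
have [sp|sp] := leqP (size p) 1.
  exists 0; last by rewrite size_poly0; case: (size p) sp => [|[]].
  by rewrite (size1_polyC sp) hornerC subrr mulr0.
exists q => //.
have : size (p - (p.[l])%:P) = size p.
  by rewrite size_polyDl // size_polyN (leq_ltn_trans (size_polyC_leq1 _)).
rewrite E mulrC; have [->|q0] := eqVneq q 0.
  by rewrite mul0r size_poly0 => e; rewrite -e in sp.
by rewrite size_Mmonic ?monicXsubC // size_XsubC addn2 /= => <-.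
Qed.

(** The quotient of [P n - (P n).[l]] by ['X - l] has degree below [n], and its Fourier coefficient
    at [k] is [m'(P n * P k) - (P n).[l] * c k]. Replacing [P k] by [(P k).[l] + ('X - l) * r] turns
    the first term into [(P k).[l] * c n], because [P n] is orthogonal to [r]. *)
Lemma ortho_volterra (K : fieldType) (l : K) (m m' : nat -> K) (P : nat -> {poly K})
    (n : nat) : orthonormal_polys m P -> resolvent_moments l m m' ->
  let c k := moment_functional m' (P k) in
  P n = ((P n).[l])%:P
    + ('X - l%:P) * \sum_(k < n) ((P k).[l] * c n - (P n).[l] * c k) *: P k.
Proof.
move=> oP mm' c.
have [q E sq] := factor_horner l (P n).
rewrite oP.1 /= in sq.
have Eq : q = \sum_(k < n) ((P k).[l] * c n - (P n).[l] * c k) *: P k.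
  rewrite {1}(ortho_expand oP (eq_leq sq)); apply: eq_bigr => k _; congr (_ *: _).
  rewrite -(resolvent_functional _ mm') mulrA -E mulrBl moment_functionalB.
  rewrite mul_polyC moment_functionalZ; congr (_ - _).
  have [r Er sr] := factor_horner l (P k).
  rewrite (_ : P k = (P k).[l]%:P + ('X - l%:P) * r); last by rewrite -Er addrC subrK.
  rewrite mulrDr moment_functionalD mulrCA (resolvent_functional _ mm').
  rewrite (ortho_low oP) ?addr0; last by rewrite sr oP.1 /= ltnW.
  by rewrite mulrC mul_polyC moment_functionalZ !hornerE subrr mul0r addr0.
by rewrite -Eq -E addrC subrK.
Qed.

Lemma moment_functionalXn (K : nzRingType) (m : nat -> K) (n : nat) :
  moment_functional m 'X^n = m n.
Proof.
rewrite (@moment_functionalE _ _ _ n.+1) ?size_polyXn // big_ord_recr /= coefXn eqxx mul1r.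
by rewrite big1 ?add0r // => i _; rewrite coefXn ltn_eqF ?mul0r.
Qed.

Lemma moment_formE (R : realType) (s : nat -> R) (p q : {poly R}) :
  moment_form s p q = moment_functional s (p * q).
Proof.
rewrite -{2}[p]coefK -{2}[q]coefK !poly_def mulr_suml moment_functional_sum.
apply: eq_bigr => i _; rewrite mulr_sumr moment_functional_sum; apply: eq_bigr => j _.
have -> : p`_i *: 'X^i * (q`_j *: 'X^j) = (p`_i * q`_j) *: 'X^(i + j) :> {poly R}.
  by rewrite exprD -scalerAl -scalerAr scalerA.
by rewrite moment_functionalZ moment_functionalXn.
Qed.

(** The quadratic form is evaluated on the coefficients of [p]; they are real, so the conjugation is
    invisible, and the leading one makes the vector nonzero. *)
Lemma moment_form_gt0 (R : realType) (s : nat -> R) (p : {poly R}) :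
  positive_definite s -> p != 0 -> 0 < moment_functional s (p * p).
Proof.
move=> pd p0; rewrite -moment_formE.
have [n sp] : exists n, size p = n.+1.
  by exists (size p).-1; rewrite prednK // size_poly_gt0.
have := pd n (\row_(i < n.+1) ofR p`_i).
have -> : \sum_(i < n.+1) \sum_(j < n.+1) ofR (s (i + j)%N) *
      (\row_(i0 < n.+1) ofR p`_i0) 0 i * cconj ((\row_(i0 < n.+1) ofR p`_i0) 0 j)
    = ofR (moment_form s p p).
  rewrite /moment_form sp /ofR rmorph_sum; apply: eq_bigr => i _.
  rewrite rmorph_sum; apply: eq_bigr => j _.
  by rewrite !mxE /cconj conjc_real !rmorphM /=; ring.
rewrite /ofR ltcR; apply; apply/eqP => /rowP /(_ ord_max).
rewrite !mxE => -[] /eqP; apply/negP.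
by rewrite -[X in p`_X]/(n.+1.-1) -sp -lead_coefE lead_coef_eq0.
Qed.

Lemma gram_schmidtE (R : realType) (s : nat -> R) (n : nat) :
  gram_schmidt s n = mkseq (orthopoly s) n.
Proof.
elim: n => [//|n IH]; rewrite /mkseq -addn1 iotaD map_cat -/(mkseq _ _) -IH /=.
by rewrite addn1 /= /orthopoly /= last_rcons cats1.
Qed.

(** The Gram-Schmidt vector before normalization. *)
Definition gs_residue (R : realType) (s : nat -> R) (n : nat) : {poly R} :=
  'X^n - \sum_(k < n) moment_functional s ('X^n * orthopoly s k) *: orthopoly s k.

Lemma orthopolyE (R : realType) (s : nat -> R) (n : nat) :
  orthopoly s n = (Num.sqrt (moment_functional s (gs_residue s n * gs_residue s n)))^-1
    *: gs_residue s n.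
Proof.
have E : 'X^n - \sum_(p <- gram_schmidt s n) moment_form s 'X^n p *: p = gs_residue s n.
  rewrite gram_schmidtE big_map -[X in iota 0 X]subn0 -/(index_iota 0 n) big_mkord.
  by congr (_ - _); apply: eq_bigr => k _; rewrite moment_formE.
by rewrite {1}/orthopoly /= last_rcons E moment_formE.
Qed.

Lemma orthopoly_orthonormal (R : realType) (s : nat -> R) :
  positive_definite s -> orthonormal_polys s (orthopoly s).
Proof.
move=> pd.
(* Sizes and products are treated together for all indices below [n]: the next residue gets its
   degree from the earlier sizes and its orthogonality from the earlier products. *)
suff H n : (forall j, (j < n)%N -> size (orthopoly s j) = j.+1) /\
    (forall j k, (j < n)%N -> (k < n)%N ->
      moment_functional s (orthopoly s j * orthopoly s k) = (j == k)%:R).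
  split=> [n|j k]; first by apply: (H n.+1).1.
  by apply: (H (maxn j k).+1).2; rewrite ltnS ?leq_maxl ?leq_maxr.
elim: n => [//|n [sP oP]].
set q := gs_residue s n.
have sq : size q = n.+1.
  rewrite /q /gs_residue size_polyDl ?size_polyXn // size_polyN ltnS.
  rewrite (leq_trans (size_sum _ _ _)) //; apply/bigmax_leqP => i _.
  by rewrite (leq_trans (size_scale_leq _ _)) // sP.
have q0 : 0 < moment_functional s (q * q).
  by apply: moment_form_gt0 => //; rewrite -size_poly_eq0 sq.
have r0 : (Num.sqrt (moment_functional s (q * q)))^-1 != 0 by rewrite invr_neq0 // sqrtr_eq0 -ltNge.
have En : orthopoly s n = (Num.sqrt (moment_functional s (q * q)))^-1 *: q by exact: orthopolyE.
have qk k : (k < n)%N -> moment_functional s (q * orthopoly s k) = 0.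
  move=> kn; rewrite /q /gs_residue mulrBl moment_functionalB mulr_suml moment_functional_sum.
  rewrite (bigD1 (Ordinal kn)) //= big1 ?addr0 => [|i ik].
    by rewrite -scalerAl moment_functionalZ oP // eqxx mulr1 subrr.
  rewrite -scalerAl moment_functionalZ oP // (_ : _ == _ = false) ?mulr0 //.
  by apply/negbTE.
split=> [j|j k]; rewrite !ltnS.
  by rewrite leq_eqVlt => /predU1P[->|/sP //]; rewrite En size_scale.
rewrite (leq_eqVlt j) (leq_eqVlt k) => /predU1P[->|jn] /predU1P[->|kn].
- rewrite eqxx En -scalerAl -scalerAr !moment_functionalZ mulrA -expr2 exprVn.
  by rewrite sqr_sqrtr ?ltW // mulVf // gt_eqF.
- by rewrite En -scalerAl moment_functionalZ qk // mulr0 gtn_eqF.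
- by rewrite mulrC En -scalerAl moment_functionalZ qk // mulr0 ltn_eqF.
- exact: oP.
Qed.

Lemma orthopoly0 (R : realType) (s : nat -> R) : s 0%N = 1 -> orthopoly s 0 = 1.
Proof.
move=> s0; rewrite orthopolyE /gs_residue big_ord0 subr0 expr0 mulr1.
by rewrite moment_functional1 s0 sqrtr1 invr1 scale1r.
Qed.

(** As a ring morphism, [ofR] can be used with [map_poly] and the [rmorph] lemmas. *)
HB.instance Definition _ (R : realType) := GRing.RMorphism.copy (@ofR R) (real_complex R).

Definition orthopolyC (R : realType) (s : nat -> R) (n : nat) : {poly R[i]} :=
  map_poly (@ofR R) (orthopoly s n).

Lemma orthopolyC_orthonormal (R : realType) (s : nat -> R) :
  positive_definite s -> orthonormal_polys (@ofR R \o s) (orthopolyC s).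
Proof.
move=> pd; have [sP oP] := orthopoly_orthonormal pd; split=> [n|j k].
  by rewrite /orthopolyC size_map_poly sP.
by rewrite /orthopolyC -rmorphM moment_functional_map oP rmorph_nat.
Qed.

Lemma orthopolyC0 (R : realType) (s : nat -> R) : s 0%N = 1 -> orthopolyC s 0 = 1.
Proof. by move=> s0; rewrite /orthopolyC orthopoly0 // rmorph1. Qed.

Lemma jacobi_aE (R : realType) (s : nat -> R) (n : nat) :
  ofR (jacobi_a s n) =
  moment_functional (@ofR R \o s) ('X * orthopolyC s n * orthopolyC s n.+1).
Proof.
by rewrite /jacobi_a moment_formE -moment_functional_map !rmorphM /= map_polyX.
Qed.

Lemma jacobi_bE (R : realType) (s : nat -> R) (n : nat) :
  ofR (jacobi_b s n) =
  moment_functional (@ofR R \o s) ('X * orthopolyC s n * orthopolyC s n).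
Proof.
by rewrite /jacobi_b moment_formE -moment_functional_map !rmorphM /= map_polyX.
Qed.

Lemma orthopolyC_recurrence (R : realType) (s : nat -> R) (n : nat) :
  positive_definite s ->
  'X * orthopolyC s n = ofR (jacobi_a s n) *: orthopolyC s n.+1
    + ofR (jacobi_b s n) *: orthopolyC s n
    + (if n is k.+1 then ofR (jacobi_a s k) *: orthopolyC s k else 0).
Proof.
move=> pd; rewrite [LHS](ortho_recurrence n (orthopolyC_orthonormal pd)).
by rewrite -jacobi_aE -jacobi_bE; case: n => // n; rewrite -jacobi_aE.
Qed.

Lemma jacobi_a_neq0 (R : realType) (s : nat -> R) (n : nat) :
  positive_definite s -> ofR (jacobi_a s n) != 0.
Proof.
by move=> pd; rewrite jacobi_aE; apply: ortho_recurrence_neq0 (orthopolyC_orthonormal pd).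
Qed.

(** * Complex numbers and square summable sequences *)

Lemma normr_cmod (R : realType) (z : R[i]) : `|z| = ofR (cmod z).
Proof. by []. Qed.

Lemma ofR_inj (R : realType) : injective (@ofR R).
Proof. by move=> x y []. Qed.

Lemma cmod_ge0 (R : realType) (z : R[i]) : 0 <= cmod z.
Proof. by rewrite -lecR -[X in _ <= X]/(`|z|) normr_ge0. Qed.

Lemma cmodM (R : realType) (x y : R[i]) : cmod (x * y) = cmod x * cmod y.
Proof. exact: ComplexField.Normc.normcM. Qed.

Lemma cmodD (R : realType) (x y : R[i]) : cmod (x + y) <= cmod x + cmod y.
Proof. exact: le_normcD. Qed.

Lemma cmodN (R : realType) (x : R[i]) : cmod (- x) = cmod x.
Proof. exact: normcN. Qed.

Lemma cmodC (R : realType) (x y : R[i]) : cmod (x - y) = cmod (y - x).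
Proof. by rewrite -cmodN opprB. Qed.

Lemma cmod0 (R : realType) : cmod (0 : R[i]) = 0.
Proof. exact: ComplexField.Normc.normc0. Qed.

Lemma cmod1 (R : realType) : cmod (1 : R[i]) = 1.
Proof. exact: ComplexField.Normc.normc1. Qed.

Lemma cmodV (R : realType) (x : R[i]) : cmod x^-1 = (cmod x)^-1.
Proof. exact: ComplexField.Normc.normcV. Qed.

Lemma cmodX (R : realType) (x : R[i]) n : cmod (x ^+ n) = cmod x ^+ n.
Proof. by elim: n => [|n IH]; rewrite ?cmod1 // !exprS cmodM IH. Qed.

Lemma cmod_eq0 (R : realType) (x : R[i]) : (cmod x == 0) = (x == 0).
Proof.
apply/eqP/eqP => [|->]; last exact: cmod0.
exact: ComplexField.Normc.eq0_normc.
Qed.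

Lemma cmod_gt0 (R : realType) (x : R[i]) : (0 < cmod x) = (x != 0).
Proof. by rewrite lt_neqAle cmod_ge0 andbT eq_sym cmod_eq0. Qed.

Lemma cmod_ofR (R : realType) (x : R) : cmod (ofR x) = `|x|.
Proof. by rewrite /cmod /= expr0n addr0 sqrtr_sqr. Qed.

Lemma cmodJ (R : realType) (x : R[i]) : cmod (cconj x) = cmod x.
Proof. by case: x => a b; rewrite /cmod /= sqrrN. Qed.

Lemma cmod2E (R : realType) (x : R[i]) :
  cmod x ^+ 2 = complex.Re x ^+ 2 + complex.Im x ^+ 2.
Proof. by case: x => a b; rewrite /cmod /= sqr_sqrtr // addr_ge0 ?sqr_ge0. Qed.

Lemma mul_cconj (R : realType) (x : R[i]) : x * cconj x = ofR (cmod x ^+ 2).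
Proof. by rewrite cmod2E; case: x => a b; simpc; rewrite /ofR -!expr2 [b * a]mulrC addNr. Qed.

Lemma cmod_Re (R : realType) (x : R[i]) : `|complex.Re x| <= cmod x.
Proof.
rewrite -(ler_pXn2r (_ : 0 < 2)%N) ?nnegrE ?cmod_ge0 // cmod2E real_normK ?num_real //.
by rewrite lerDl sqr_ge0.
Qed.

Lemma cmod_Im (R : realType) (x : R[i]) : `|complex.Im x| <= cmod x.
Proof.
rewrite -(ler_pXn2r (_ : 0 < 2)%N) ?nnegrE ?cmod_ge0 // cmod2E real_normK ?num_real //.
by rewrite lerDr sqr_ge0.
Qed.

Lemma cmod_ReIm (R : realType) (x : R[i]) : cmod x <= `|complex.Re x| + `|complex.Im x|.
Proof.
rewrite -(ler_pXn2r (_ : 0 < 2)%N) ?nnegrE ?cmod_ge0 ?addr_ge0 // cmod2E.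
rewrite sqrrD !real_normK ?num_real // lerD2r lerDl mulrn_wge0 //.
Qed.

Lemma cmod_sum (R : realType) (I : Type) (r : seq I) (P : pred I) (F : I -> R[i]) :
  cmod (\sum_(i <- r | P i) F i) <= \sum_(i <- r | P i) cmod (F i).
Proof.
elim/big_ind2 : _ => [|x a y b xa yb|//]; first by rewrite cmod0.
by rewrite (le_trans (cmodD _ _)) // lerD.
Qed.

Lemma cmodB_le (R : realType) (x y : R[i]) : cmod x - cmod y <= cmod (x - y).
Proof. by rewrite lerBlDr -{1}(subrK y x) cmodD. Qed.

Lemma cauchy_schwarz_sum (R : realDomainType) (n : nat) (a b : nat -> R) :
  (\sum_(i < n) a i * b i) ^+ 2 <= (\sum_(i < n) a i ^+ 2) * (\sum_(i < n) b i ^+ 2).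
Proof.
elim: n => [|n IH]; first by rewrite !big_ord0 expr0n mul0r.
rewrite !big_ord_recr /=.
set A := \sum_(_ < _) _ in IH *; set B := \sum_(i < n) a i ^+ 2 in IH *.
set C := \sum_(i < n) b i ^+ 2 in IH *.
have B0 : 0 <= B by apply: sumr_ge0 => i _; rewrite sqr_ge0.
have C0 : 0 <= C by apply: sumr_ge0 => i _; rewrite sqr_ge0.
suff : 2 * A * (a n * b n) <= B * b n ^+ 2 + C * a n ^+ 2 by nra.
(* [2 A x y <= B y^2 + C x^2] since [A^2 <= B C] *)
have [/eqP B00|Bn] := boolP (B == 0).
  have : A ^+ 2 <= 0 by rewrite (le_trans IH) // B00 mul0r.
  rewrite le_eqVlt ltNge sqr_ge0 orbF sqrf_eq0 => /eqP ->.
  by rewrite mulr0 mul0r B00 mul0r add0r mulr_ge0 // sqr_ge0.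
have Bp : 0 < B by rewrite lt_neqAle eq_sym Bn.
rewrite -(ler_pM2l Bp).
(* With [x = a n] and [y = b n], [B (B y^2 + C x^2 - 2 A x y) = (B y - A x)^2 + (B C - A^2) x^2]. *)
have : 0 <= (B * b n - A * a n) ^+ 2 by rewrite sqr_ge0.
have : A ^+ 2 * a n ^+ 2 <= B * C * a n ^+ 2 by rewrite ler_wpM2r // sqr_ge0.
nra.
Qed.

Definition sqsum (R : realType) (n : nat) (x : nat -> R[i]) : R :=
  \sum_(i < n) cmod (x i) ^+ 2.

Lemma sqsum_ge0 (R : realType) (n : nat) (x : nat -> R[i]) : 0 <= sqsum n x.
Proof. by apply: sumr_ge0 => i _; rewrite sqr_ge0. Qed.

Lemma sqsumS (R : realType) (n : nat) (x : nat -> R[i]) :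
  sqsum n.+1 x = sqsum n x + cmod (x n) ^+ 2.
Proof. by rewrite /sqsum big_ord_recr. Qed.

Lemma le_sqsum (R : realType) (x : nat -> R[i]) : {homo (fun n => sqsum n x) : m n / (m <= n)%N >-> m <= n}.
Proof.
by apply/nondecreasing_seqP => n; rewrite sqsumS lerDl sqr_ge0.
Qed.

Lemma sqsum_cauchy_schwarz (R : realType) (n : nat) (x y : nat -> R[i]) :
  cmod (\sum_(i < n) x i * y i) ^+ 2 <= sqsum n x * sqsum n y.
Proof.
apply: (le_trans _ (cauchy_schwarz_sum n (fun i => cmod (x i)) (fun i => cmod (y i)))).
rewrite ler_pXn2r ?nnegrE ?cmod_ge0 //; last first.
  by apply: sumr_ge0 => i _; rewrite mulr_ge0 ?cmod_ge0.
by rewrite (le_trans (cmod_sum _ _ _)) //; apply: ler_sum => i _; rewrite cmodM.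
Qed.

Lemma cmodD_sq (R : realType) (x y : R[i]) :
  cmod (x + y) ^+ 2 <= 2 * cmod x ^+ 2 + 2 * cmod y ^+ 2.
Proof.
have h : cmod (x + y) ^+ 2 <= (cmod x + cmod y) ^+ 2.
  by rewrite ler_pXn2r ?nnegrE ?addr_ge0 ?cmod_ge0 // cmodD.
have : 0 <= (cmod x - cmod y) ^+ 2 by rewrite sqr_ge0.
nra.
Qed.

Lemma sqsumD (R : realType) (n : nat) (x y : nat -> R[i]) :
  sqsum n (x + y) <= 2 * sqsum n x + 2 * sqsum n y.
Proof.
rewrite /sqsum !mulr_sumr -big_split /=; apply: ler_sum => i _; exact: cmodD_sq.
Qed.

Lemma sqsumZ (R : realType) (n : nat) (c : R[i]) (x : nat -> R[i]) :
  sqsum n (c *: x) = cmod c ^+ 2 * sqsum n x.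
Proof. by rewrite /sqsum mulr_sumr; apply: eq_bigr => i _; rewrite cmodM exprMn. Qed.

(** * Volterra equations with a Hilbert-Schmidt kernel *)

Definition volterra (R : realType) (a : nat -> nat -> R[i]) (x : nat -> R[i])
  : nat -> R[i] := fun n => \sum_(k < n) a n k * x k.

Definition hilbert_schmidt_le (R : realType) (a : nat -> nat -> R[i]) (B : R) : Prop :=
  forall N, \sum_(n < N) sqsum n (a n) <= B.

Lemma volterra_le (R : realType) (a : nat -> nat -> R[i]) (B : R) (x : nat -> R[i])
    (N : nat) : hilbert_schmidt_le a B -> sqsum N (volterra a x) <= B * sqsum N x.
Proof.
move=> aB; apply: (@le_trans _ _ ((\sum_(n < N) sqsum n (a n)) * sqsum N x)).
  rewrite {1}/sqsum mulr_suml; apply: ler_sum => n _.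
  rewrite (le_trans (sqsum_cauchy_schwarz _ _ _)) // ler_wpM2l ?sqsum_ge0 //.
  by apply: le_sqsum; exact: ltnW.
by rewrite ler_wpM2r ?sqsum_ge0.
Qed.

(** Discrete Gronwall inequality. Cauchy-Schwarz bounds the entry at [n] by the earlier ones, the
    factor [1 + c t] of one step is absorbed into [expR (c t)], and the exponents add up to at most
    the Hilbert-Schmidt bound. The constant does not depend on [N], so the estimate passes to
    l^2. *)
Lemma volterra_solution_le (R : realType) (a : nat -> nat -> R[i]) (B : R) (k : R[i])
    (x f : nat -> R[i]) (N : nat) : hilbert_schmidt_le a B ->
  x = f + k *: volterra a x ->
  sqsum N x <= 2 * expR (2 * cmod k ^+ 2 * B) * sqsum N f.
Proof.
move=> aB E.
pose c := 2 * cmod k ^+ 2.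
have c0 : 0 <= c by rewrite mulr_ge0 // sqr_ge0.
have H n : sqsum n x <= 2 * sqsum n f * expR (c * \sum_(j < n) sqsum j (a j)).
  elim: n => [|n IH]; first by rewrite /sqsum !big_ord0 mulr0 mul0r.
  have xn : cmod (x n) ^+ 2 <= 2 * cmod (f n) ^+ 2 + c * sqsum n (a n) * sqsum n x.
    rewrite {1}E (le_trans (cmodD_sq _ _)) // lerD2l cmodM exprMn mulrA -/c -(mulrA c).
    by rewrite ler_wpM2l // sqsum_cauchy_schwarz.
  rewrite !sqsumS big_ord_recr /=; set S := \sum_(_ < _) _ in IH *.
  set t := sqsum n (a n) in xn *.
  have t0 : 0 <= t by exact: sqsum_ge0.
  have S0 : 0 <= S by apply: sumr_ge0 => i _; exact: sqsum_ge0.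
  have e1 : 1 + c * t <= expR (c * t) by exact: expR_ge1Dx.
  have e2 : 1 <= expR (c * (S + t)) by rewrite -expR0 ler_expR mulr_ge0 // addr_ge0.
  rewrite mulrDr mulrDl.
  have h1 : 2 * cmod (f n) ^+ 2 <= 2 * cmod (f n) ^+ 2 * expR (c * (S + t)).
    by rewrite ler_peMr // mulr_ge0 // sqr_ge0.
  have h2 : sqsum n x * (1 + c * t) <= 2 * sqsum n f * expR (c * (S + t)).
    rewrite (mulrDr c) expRD mulrA; apply: ler_pM => //; first exact: sqsum_ge0.
    by rewrite addr_ge0 // mulr_ge0.
  lra.
apply: (le_trans (H N)); rewrite mulrAC ler_wpM2r ?sqsum_ge0 // ler_wpM2l //.
by rewrite ler_expR ler_wpM2l.
Qed.

(** The norm of [R[i]] takes values in [R[i]], whose order makes positive elements real; this brings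
    every radius and every tolerance back to [R]. *)
Lemma gt0_ofR (R : realType) (e : R[i]) : 0 < e -> e = ofR (complex.Re e) /\ 0 < complex.Re e.
Proof. by case: e => a b; rewrite ltcE /= => /andP[/eqP -> ->]. Qed.

Lemma cvg_cmodP (R : realType) (T : Type) (F : set_system T) (FF : Filter F)
    (f : T -> R[i]) (l : R[i]) :
  ((f : T -> R[i]^o) @ F --> (l : R[i]^o)) <-> ((fun x => cmod (f x - l)) @ F --> (0 : R)).
Proof.
split.
  move=> /cvgrPdist_lt H; apply/cvgrPdist_lt => e e0.
  have := H (ofR e); rewrite /ofR ltcR => /(_ e0); apply: filterS => x.
  by rewrite normr_cmod ltcR sub0r normrN ger0_norm ?cmod_ge0 // cmodC.
move=> /cvgrPdist_lt H; apply/cvgrPdist_lt => e e0.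
have [Ee /H] := gt0_ofR e0; apply: filterS => x; rewrite Ee normr_cmod /ofR ltcR.
by rewrite sub0r normrN ger0_norm ?cmod_ge0 // cmodC.
Qed.

Lemma near0_cmodP (R : realType) (P : R[i] -> Prop) :
  (\forall h \near (0 : R[i]^o)^', P h) <->
  (exists2 d : R, 0 < d & forall h, h != 0 -> cmod h < d -> P h).
Proof.
split.
  move=> /nbhs_ballP [e /= e0 H].
  have [Ee re0] := gt0_ofR e0; exists (complex.Re e) => //.
  move=> h h0 hd; apply: H => //; rewrite /ball /= sub0r normrN Ee normr_cmod.
  by rewrite /ofR ltcR.
move=> [d d0 H]; apply/nbhs_ballP; exists (ofR d); first by rewrite /= /ofR ltcR.
move=> h; rewrite /ball /= sub0r normrN normr_cmod /ofR ltcR => hd h0.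
exact: H.
Qed.

Lemma open_cmodP (R : realType) (U : set R[i]) :
  open (U : set R[i]^o) <->
  (forall z, U z -> exists2 d : R, 0 < d & forall h, cmod h < d -> U (z + h)).
Proof.
rewrite openE; split => H z Uz.
  have /nbhs_ballP [e /= e0 He] := H z Uz.
  have [Ee re0] := gt0_ofR e0; exists (complex.Re e) => //.
  move=> h hd; apply: He => //; rewrite /ball /= opprD addrA subrr sub0r normrN Ee.
  by rewrite normr_cmod /ofR ltcR.
have [d d0 Hd] := H z Uz.
apply/nbhs_ballP; exists (ofR d); first by rewrite /= /ofR ltcR.
move=> w; rewrite /ball /= normr_cmod /ofR ltcR cmodC => wd.
by have := Hd _ wd; rewrite addrC subrK.
Qed.

(** Division-free form, in which [h = 0] is allowed and remainders can be added and composed. *)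
Definition cderiv (R : realType) (f : R[i] -> R[i]) (z d : R[i]) : Prop :=
  forall e : R, 0 < e -> exists2 del : R, 0 < del &
    forall h, cmod h < del -> cmod (f (z + h) - f z - h * d) <= e * cmod h.

Lemma holomorphic_atP (R : realType) (f : R[i] -> R[i]) (z : R[i]) :
  holomorphic_at f z <-> exists d, cderiv f z d.
Proof.
have dq (d h : R[i]) : h != 0 ->
    cmod (h^-1 * (f (h * 1 + z) - f z) - d) = cmod (f (z + h) - f z - h * d) / cmod h.
  move=> h0; rewrite -cmodV -cmodM mulr1 (addrC h).
  by congr cmod; field.
split.
  move=> /cvg_ex [d /= /cvg_cmodP /cvgrPdist_le H]; exists d => e e0.
  have /near0_cmodP [del del0 Hd] := H e e0.
  exists del => // h hd; have [->|h0] := eqVneq h 0.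
    by rewrite addr0 subrr mul0r subrr cmod0 mulr0.
  have := Hd h h0 hd; rewrite sub0r normrN ger0_norm ?cmod_ge0 //.
  by rewrite [X in cmod X](_ : _ = h^-1 * (f (h * 1 + z) - f z) - d) // dq // ler_pdivrMr ?cmod_gt0.
move=> [d H]; apply/cvg_ex; exists (d : R[i]^o); apply/cvg_cmodP/cvgrPdist_le => e e0.
have [del del0 Hd] := H e e0.
apply/near0_cmodP; exists del => // h h0 hd.
rewrite sub0r normrN ger0_norm ?cmod_ge0 //.
rewrite [X in cmod X](_ : _ = h^-1 * (f (h * 1 + z) - f z) - d) // dq // ler_pdivrMr ?cmod_gt0 //.
exact: Hd.
Qed.

(** * The Hilbert space of square summable sequences *)

Lemma sqsum_series (R : realType) (x : nat -> R[i]) :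
  series (fun n => cmod (x n) ^+ 2) = (fun n => sqsum n x).
Proof. by apply/funext => n; rewrite /series /= big_mkord. Qed.

Lemma l2P (R : realType) (x : nat -> R[i]) :
  l2 x <-> exists M, forall N, sqsum N x <= M.
Proof.
rewrite /l2 sqsum_series; split.
  move=> c; exists (limn (fun n => sqsum n x)) => N.
  apply: nondecreasing_cvgn_le => //; exact: le_sqsum.
move=> [M HM]; apply: nondecreasing_is_cvgn; first exact: le_sqsum.
by exists M => _ [n _ <-].
Qed.

Lemma l2norm_ge0 (R : realType) (x : nat -> R[i]) : 0 <= l2norm x.
Proof. exact: sqrtr_ge0. Qed.

Lemma l2norm_le (R : realType) (x : nat -> R[i]) (M : R) :
  (forall N, sqsum N x <= M) -> l2norm x ^+ 2 <= M.
Proof.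
move=> HM; have lx : l2 x by apply/l2P; exists M.
have l0 : limn (fun n => sqsum n x) <= M.
  by apply: limr_le; [rewrite -sqsum_series|apply: nearW].
have : 0 <= limn (fun n => sqsum n x).
  apply: limr_ge; first by rewrite -sqsum_series.
  by apply: nearW => n; exact: sqsum_ge0.
by move=> h; rewrite /l2norm sqsum_series sqr_sqrtr.
Qed.

Lemma sqsum_l2norm (R : realType) (x : nat -> R[i]) (N : nat) :
  l2 x -> sqsum N x <= l2norm x ^+ 2.
Proof.
move=> lx; have h : sqsum N x <= limn (fun n => sqsum n x).
  apply: nondecreasing_cvgn_le; first exact: le_sqsum.
  by rewrite -sqsum_series.
by rewrite /l2norm sqsum_series sqr_sqrtr // (le_trans (sqsum_ge0 N x)).
Qed.

Lemma sqsum_cvg (R : realType) (x : nat -> R[i]) : l2 x ->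
  (fun n => sqsum n x) @ \oo --> l2norm x ^+ 2.
Proof.
move=> lx; have c : cvgn (fun n => sqsum n x) by rewrite -sqsum_series.
rewrite /l2norm sqsum_series sqr_sqrtr //.
by apply: limr_ge => //; apply: nearW => n; exact: sqsum_ge0.
Qed.

Lemma cmod_le_l2norm (R : realType) (x : nat -> R[i]) (n : nat) :
  l2 x -> cmod (x n) <= l2norm x.
Proof.
move=> lx; rewrite -(ler_pXn2r (_ : 0 < 2)%N) ?nnegrE ?cmod_ge0 ?l2norm_ge0 //.
by apply: le_trans (sqsum_l2norm n.+1 lx); rewrite sqsumS lerDr sqsum_ge0.
Qed.

Lemma l2D (R : realType) (x y : nat -> R[i]) : l2 x -> l2 y -> l2 (x + y).
Proof.
move=> /l2P [M HM] /l2P [N HN]; apply/l2P; exists (2 * M + 2 * N) => n.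
by rewrite (le_trans (sqsumD _ _ _)) // lerD // ler_wpM2l.
Qed.

Lemma l2Z (R : realType) (c : R[i]) (x : nat -> R[i]) : l2 x -> l2 (c *: x).
Proof.
move=> /l2P [M HM]; apply/l2P; exists (cmod c ^+ 2 * M) => n.
by rewrite sqsumZ ler_wpM2l // sqr_ge0.
Qed.

Lemma l2N (R : realType) (x : nat -> R[i]) : l2 x -> l2 (- x).
Proof. by move=> lx; rewrite -scaleN1r; exact: l2Z. Qed.

Lemma l2B (R : realType) (x y : nat -> R[i]) : l2 x -> l2 y -> l2 (x - y).
Proof. by move=> lx ly; apply: l2D => //; exact: l2N. Qed.

Lemma l20 (R : realType) : l2 (0 : nat -> R[i]).
Proof.
by apply/l2P; exists 0 => n; rewrite /sqsum big1 // => i _; rewrite cmod0 expr0n.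
Qed.

Lemma l2norm0 (R : realType) : l2norm (0 : nat -> R[i]) = 0.
Proof.
apply/eqP; rewrite -sqrf_eq0 eq_le sqr_ge0 andbT; apply: l2norm_le => n.
by rewrite /sqsum big1 // => i _; rewrite cmod0 expr0n.
Qed.

Lemma l2normZ (R : realType) (c : R[i]) (x : nat -> R[i]) :
  l2 x -> l2norm (c *: x) = cmod c * l2norm x.
Proof.
move=> lx; apply/eqP.
rewrite -(eqrXn2 (_ : 0 < 2)%N) ?mulr_ge0 ?cmod_ge0 ?l2norm_ge0 // exprMn; apply/eqP.
have H : (fun n => sqsum n (c *: x)) @ \oo --> cmod c ^+ 2 * l2norm x ^+ 2.
  by under eq_fun do rewrite sqsumZ; apply: cvgM; [exact: cvg_cst|exact: sqsum_cvg].
by rewrite -(cvg_lim _ H) // (cvg_lim _ (sqsum_cvg (l2Z lx))).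
Qed.

Definition prodsum (R : realType) (n : nat) (x y : nat -> R[i]) : R[i] :=
  \sum_(i < n) x i * cconj (y i).

Lemma prodsum_series (R : realType) (x y : nat -> R[i]) :
  (series (fun n => x n * cconj (y n)) : nat -> R[i]) = (fun n => prodsum n x y).
Proof. by apply/funext => n; rewrite /series /= big_mkord. Qed.

Lemma sqsumJ (R : realType) (n : nat) (x : nat -> R[i]) :
  sqsum n (fun k => cconj (x k)) = sqsum n x.
Proof. by apply: eq_bigr => i _; rewrite cmodJ. Qed.

Lemma prodsum_le (R : realType) (n : nat) (x y : nat -> R[i]) :
  cmod (prodsum n x y) ^+ 2 <= sqsum n x * sqsum n y.
Proof. by rewrite -(sqsumJ n y) sqsum_cauchy_schwarz. Qed.

Lemma prodsum_abs_le (R : realType) (n : nat) (x y : nat -> R[i]) :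
  \sum_(i < n) cmod (x i * cconj (y i)) <= (sqsum n x + sqsum n y) / 2.
Proof.
rewrite ler_pdivlMr // mulr_suml -big_split /=; apply: ler_sum => i _.
rewrite cmodM cmodJ; have : 0 <= (cmod (x i) - cmod (y i)) ^+ 2 by rewrite sqr_ge0.
nra.
Qed.

Lemma Re_sum (R : realType) (n : nat) (F : nat -> R[i]) :
  complex.Re (\sum_(i < n) F i) = \sum_(i < n) complex.Re (F i).
Proof. by elim: n => [|n IH]; rewrite ?big_ord0 // !big_ord_recr /= -IH raddfD. Qed.

Lemma Im_sum (R : realType) (n : nat) (F : nat -> R[i]) :
  complex.Im (\sum_(i < n) F i) = \sum_(i < n) complex.Im (F i).
Proof. by elim: n => [|n IH]; rewrite ?big_ord0 // !big_ord_recr /= -IH raddfD. Qed.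

Lemma cvg_ReIm (R : realType) (T : Type) (F : set_system T) (FF : Filter F)
    (f : T -> R[i]) (a b : R) :
  (fun x => complex.Re (f x)) @ F --> a -> (fun x => complex.Im (f x)) @ F --> b ->
  (f : T -> R[i]^o) @ F --> (Complex a b : R[i]^o).
Proof.
move=> fa fb; apply/cvg_cmodP; apply: (@squeeze_cvgr _ _ _ _ (fun=> 0)
   (fun x => `|complex.Re (f x) - a| + `|complex.Im (f x) - b|)).
- apply: nearW => x; rewrite cmod_ge0 /= (le_trans (cmod_ReIm _)) //.
  by case: (f x).
- exact: cvg_cst.
- rewrite -[X in _ --> X]addr0; apply: cvgD.
    by apply/norm_cvg0P/subr_cvg0.
  by apply/norm_cvg0P/subr_cvg0.
Qed.

(** The real and the imaginary parts converge absolutely, being dominated by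
    [(|x n|^2 + |y n|^2) / 2]. *)
Lemma l2_prodsum_cvg (R : realType) (x y : nat -> R[i]) : l2 x -> l2 y ->
  ((fun n => prodsum n x y) : nat -> R[i]^o) @ \oo --> (l2inner x y : R[i]^o).
Proof.
move=> /l2P [M HM] /l2P [N HN].
have bnd (g : R[i] -> R) : (forall z, `|g z| <= cmod z) ->
    cvgn (series (fun n => g (x n * cconj (y n)))).
  move=> Hg; apply: normed_cvg; apply: nondecreasing_is_cvgn.
    by apply: nondecreasing_series => n _ _ /=.
  exists ((M + N) / 2) => _ [n _ <-].
  have -> : [normed series (fun n => g (x n * cconj (y n)))] n
    = \sum_(i < n) `|g (x i * cconj (y i))| by rewrite /= /series /= big_mkord.
  apply: le_trans (_ : (sqsum n x + sqsum n y) / 2 <= _); last first.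
    by rewrite ler_pM2r ?invr_gt0 // lerD.
  by rewrite (le_trans _ (prodsum_abs_le n x y)) //; apply: ler_sum => i _; exact: Hg.
have c1 := bnd _ (@cmod_Re R); have c2 := bnd _ (@cmod_Im R).
suff H : cvgn ((fun n => prodsum n x y) : nat -> R[i]^o).
  by rewrite /l2inner prodsum_series.
apply/cvg_ex; exists (Complex (limn (series (fun n => complex.Re (x n * cconj (y n)))))
   (limn (series (fun n => complex.Im (x n * cconj (y n))))) : R[i]^o).
apply: cvg_ReIm.
  rewrite (_ : (fun _ => _) = series (fun n => complex.Re (x n * cconj (y n)))) //.
  by apply/funext => n; rewrite /series /= big_mkord /prodsum (Re_sum n (fun i => x i * cconj (y i))).
rewrite (_ : (fun _ => _) = series (fun n => complex.Im (x n * cconj (y n)))) //.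
by apply/funext => n; rewrite /series /= big_mkord /prodsum (Im_sum n (fun i => x i * cconj (y i))).
Qed.

(** [limn] is meaningful only for convergent sequences; through this lemma identities between inner
    products reduce to identities between partial sums. *)
Lemma l2inner_unique (R : realType) (x y : nat -> R[i]) (l : R[i]) : l2 x -> l2 y ->
  ((fun n => prodsum n x y) : nat -> R[i]^o) @ \oo --> (l : R[i]^o) -> l2inner x y = l.
Proof.
move=> lx ly H; exact: (cvg_unique (@norm_hausdorff _ R[i]^o) (l2_prodsum_cvg lx ly) H).
Qed.

Lemma l2innerDl (R : realType) (x x' y : nat -> R[i]) : l2 x -> l2 x' -> l2 y ->
  l2inner (x + x') y = l2inner x y + l2inner x' y.
Proof.
move=> lx lx' ly; apply: l2inner_unique => //; first exact: l2D.
rewrite (_ : (fun _ => _) = (fun n => prodsum n x y) + (fun n => prodsum n x' y) :> (nat -> R[i]^o)).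
  exact: (cvgD (l2_prodsum_cvg lx ly) (l2_prodsum_cvg lx' ly)).
apply/funext => n; rewrite /prodsum -[RHS]/(_ + _) -big_split /=.
by apply: eq_bigr => i _; rewrite -mulrDl.
Qed.

Lemma l2innerZl (R : realType) (c : R[i]) (x y : nat -> R[i]) : l2 x -> l2 y ->
  l2inner (c *: x) y = c * l2inner x y.
Proof.
move=> lx ly; apply: l2inner_unique => //; first exact: l2Z.
rewrite (_ : (fun _ => _) = c \*: ((fun n => prodsum n x y) : nat -> R[i]^o)).
  exact: (cvgZl_tmp (l2_prodsum_cvg lx ly)).
apply/funext => n; rewrite /prodsum -[RHS]/(c * _) mulr_sumr.
by apply: eq_bigr => i _; rewrite mulrA.
Qed.

Lemma cconjD (R : realType) (x y : R[i]) : cconj (x + y) = cconj x + cconj y.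
Proof. exact: rmorphD. Qed.

Lemma cconjB (R : realType) (x y : R[i]) : cconj (x - y) = cconj x - cconj y.
Proof. exact: rmorphB. Qed.

Lemma cconjM (R : realType) (x y : R[i]) : cconj (x * y) = cconj x * cconj y.
Proof. exact: rmorphM. Qed.

Lemma cconjK (R : realType) (x : R[i]) : cconj (cconj x) = x.
Proof. exact: conjcK. Qed.

Lemma cconj_ofR (R : realType) (x : R) : cconj (ofR x) = ofR x.
Proof. exact: conjc_real. Qed.

Lemma cconj_sum (R : realType) (I : Type) (r : seq I) (P : pred I) (F : I -> R[i]) :
  cconj (\sum_(i <- r | P i) F i) = \sum_(i <- r | P i) cconj (F i).
Proof. by apply: (big_morph (@cconj R) (@cconjD R)); exact: conjc0. Qed.

Lemma l2innerC (R : realType) (x y : nat -> R[i]) : l2 x -> l2 y ->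
  l2inner y x = cconj (l2inner x y).
Proof.
move=> lx ly; apply: l2inner_unique => //; apply/cvg_cmodP.
have /cvg_cmodP H := l2_prodsum_cvg lx ly.
rewrite (_ : (fun _ => _) = (fun n => cmod (prodsum n x y - l2inner x y))) //.
apply/funext => n; rewrite -[LHS]cmodJ cconjB cconjK cconj_sum; congr (cmod (_ - _)); apply: eq_bigr => i _.
by rewrite cconjM cconjK mulrC.
Qed.

Lemma l2innerDr (R : realType) (x y y' : nat -> R[i]) : l2 x -> l2 y -> l2 y' ->
  l2inner x (y + y') = l2inner x y + l2inner x y'.
Proof.
move=> lx ly ly'; rewrite (l2innerC _ lx) ?l2innerDl ?cconjD -?l2innerC //; exact: l2D.
Qed.

Lemma l2innerZr (R : realType) (c : R[i]) (x y : nat -> R[i]) : l2 x -> l2 y ->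
  l2inner x (c *: y) = cconj c * l2inner x y.
Proof. move=> lx ly; rewrite (l2innerC _ lx) ?l2innerZl ?cconjM -?l2innerC //; exact: l2Z. Qed.

Lemma l2innerBl (R : realType) (x x' y : nat -> R[i]) : l2 x -> l2 x' -> l2 y ->
  l2inner (x - x') y = l2inner x y - l2inner x' y.
Proof.
move=> lx lx' ly; rewrite l2innerDl //; last exact: l2N.
by rewrite -scaleN1r l2innerZl // mulN1r.
Qed.

Lemma l2innerBr (R : realType) (x y y' : nat -> R[i]) : l2 x -> l2 y -> l2 y' ->
  l2inner x (y - y') = l2inner x y - l2inner x y'.
Proof.
move=> lx ly ly'; rewrite (l2innerC _ lx) ?l2innerBl ?cconjB -?l2innerC //; exact: l2B.
Qed.

Lemma prodsum_diag (R : realType) (n : nat) (x : nat -> R[i]) :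
  prodsum n x x = ofR (sqsum n x).
Proof.
by rewrite /sqsum /ofR rmorph_sum; apply: eq_bigr => i _; rewrite mul_cconj.
Qed.

Lemma l2innerxx (R : realType) (x : nat -> R[i]) : l2 x ->
  l2inner x x = ofR (l2norm x ^+ 2).
Proof.
move=> lx; apply: l2inner_unique => //; apply/cvg_cmodP.
have /subr_cvg0 H := sqsum_cvg lx.
rewrite (_ : (fun _ => _) = (fun n => `|sqsum n x - l2norm x ^+ 2|)); first exact/norm_cvg0P.
apply/funext => n; rewrite -cmod_ofR prodsum_diag.
by rewrite (_ : ofR (_ - _) = ofR (sqsum n x) - ofR (l2norm x ^+ 2)) // rmorphB.
Qed.

Lemma l2inner_le (R : realType) (x y : nat -> R[i]) : l2 x -> l2 y ->
  cmod (l2inner x y) <= l2norm x * l2norm y.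
Proof.
(* One truncation within [e] of the limit is enough, since the finite Cauchy-Schwarz inequality
   applies to it. *)
move=> lx ly; apply/ler_addgt0Pr => e e0.
have /cvg_cmodP /cvgrPdist_lt /(_ e e0) [n _ /(_ n (leqnn n)) /=] := l2_prodsum_cvg lx ly.
rewrite sub0r normrN ger0_norm ?cmod_ge0 // cmodC => h.
have h2 : cmod (prodsum n x y) <= l2norm x * l2norm y.
  rewrite -(ler_pXn2r (_ : 0 < 2)%N) ?nnegrE ?cmod_ge0 ?mulr_ge0 ?l2norm_ge0 // exprMn.
  by rewrite (le_trans (prodsum_le _ _ _)) // ler_pM ?sqsum_ge0 // sqsum_l2norm.
rewrite -(subrK (prodsum n x y) (l2inner x y)) (le_trans (cmodD _ _)) // addrC.
by rewrite lerD // ltW.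
Qed.

Lemma l2normD (R : realType) (x y : nat -> R[i]) : l2 x -> l2 y ->
  l2norm (x + y) <= l2norm x + l2norm y.
Proof.
move=> lx ly; rewrite -(ler_pXn2r (_ : 0 < 2)%N) ?nnegrE ?addr_ge0 ?l2norm_ge0 //.
have := l2innerxx (l2D lx ly); rewrite l2innerDl ?l2innerDr ?l2innerxx //; try exact: l2D.
move=> /(congr1 (@cmod R)); rewrite [RHS]cmod_ofR ger0_norm ?sqr_ge0 // => <-.
rewrite (le_trans (cmodD _ _)) // (le_trans (lerD (cmodD _ _) (cmodD _ _))) //.
rewrite !cmod_ofR !ger0_norm ?sqr_ge0 //.
have := l2inner_le lx ly; have := l2inner_le ly lx.
nra.
Qed.

(** * Holomorphy of the vector of orthonormal polynomials *)

(** Differentiability in l^2 with a remainder of order [|h|^2], here squared. Stated on truncations,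
    it presupposes no membership in l^2 and fits the Gronwall bound. *)
Definition l2quad (R : realType) (F : R[i] -> nat -> R[i]) (D : nat -> R[i]) (z : R[i]) : Prop :=
  exists C : R, forall h, cmod h <= 1 -> forall N,
    sqsum N (F (z + h) - F z - h *: D) <= C * cmod h ^+ 4.

Lemma volterraD (R : realType) (a : nat -> nat -> R[i]) (x y : nat -> R[i]) :
  volterra a (x + y) = volterra a x + volterra a y.
Proof.
apply/funext => n; rewrite /volterra -[RHS]/(_ + _) -big_split /=.
by apply: eq_bigr => k _; rewrite mulrDr.
Qed.

Lemma volterraZ (R : realType) (a : nat -> nat -> R[i]) (c : R[i]) (x : nat -> R[i]) :
  volterra a (c *: x) = c *: volterra a x.
Proof.
apply/funext => n; rewrite /volterra -[RHS]/(c * _) mulr_sumr.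
by apply: eq_bigr => k _; rewrite mulrCA.
Qed.

Lemma volterraB (R : realType) (a : nat -> nat -> R[i]) (x y : nat -> R[i]) :
  volterra a (x - y) = volterra a x - volterra a y.
Proof. by rewrite volterraD -scaleN1r volterraZ scaleN1r. Qed.

Lemma l2_volterra (R : realType) (a : nat -> nat -> R[i]) (B : R) (x : nat -> R[i]) :
  0 <= B -> hilbert_schmidt_le a B -> l2 x -> l2 (volterra a x).
Proof.
move=> B0 aB /l2P [M HM]; apply/l2P; exists (B * M) => N.
by rewrite (le_trans (volterra_le _ _ aB)) // ler_wpM2l.
Qed.

Lemma l2quad_volterra (R : realType) (a : nat -> nat -> R[i]) (B : R)
    (F : R[i] -> nat -> R[i]) (D : nat -> R[i]) (z : R[i]) :
  0 <= B -> hilbert_schmidt_le a B -> l2quad F D z ->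
  l2quad (fun w => volterra a (F w)) (volterra a D) z.
Proof.
move=> B0 aB [C HC]; exists (B * C) => h h1 N.
rewrite -volterraZ -!volterraB (le_trans (volterra_le _ _ aB)) //.
by rewrite -mulrA ler_wpM2l // HC.
Qed.

Lemma l2quadD (R : realType) (F G : R[i] -> nat -> R[i]) (D E : nat -> R[i]) (z : R[i]) :
  l2quad F D z -> l2quad G E z -> l2quad (fun w => F w + G w) (D + E) z.
Proof.
move=> [C HC] [C' HC']; exists (2 * C + 2 * C') => h h1 N.
have -> : F (z + h) + G (z + h) - (F z + G z) - h *: (D + E)
    = (F (z + h) - F z - h *: D) + (G (z + h) - G z - h *: E).
  by rewrite scalerDr; apply/funext => n; rewrite /GRing.add /GRing.opp /=; ring.
apply: (le_trans (sqsumD _ _ _)); rewrite [leRHS]mulrDl -!mulrA.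
by apply: lerD; rewrite ler_wpM2l // ?HC ?HC'.
Qed.

Lemma l2quad_lip (R : realType) (F : R[i] -> nat -> R[i]) (D : nat -> R[i]) (z : R[i]) :
  l2quad F D z -> l2 D -> exists2 C : R, 0 <= C & forall h, cmod h <= 1 -> forall N,
    sqsum N (F (z + h) - F z) <= C * cmod h ^+ 2.
Proof.
move=> [C HC] /l2P [M HM]; exists (2 * `|C| + 2 * `|M|); first by rewrite addr_ge0 ?mulr_ge0.
move=> h h1 N; rewrite -[F (z + h) - F z](subrK (h *: D)) (le_trans (sqsumD _ _ _)) //.
have h0 := cmod_ge0 h; rewrite [leRHS]mulrDl; apply: lerD; rewrite -mulrA ler_wpM2l //.
  apply: (le_trans (HC h h1 N)); apply: (@le_trans _ _ (`|C| * cmod h ^+ 4)).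
    by rewrite ler_wpM2r ?ler_norm ?exprn_ge0.
  by rewrite ler_wpM2l // ler_wiXn2l.
by rewrite sqsumZ mulrC ler_wpM2r ?exprn_ge0 // (le_trans (HM N)) // ler_norm.
Qed.

Lemma volterra_solution_l2 (R : realType) (a : nat -> nat -> R[i]) (B : R) (k : R[i])
    (x f : nat -> R[i]) : hilbert_schmidt_le a B ->
  x = f + k *: volterra a x -> l2 f -> l2 x.
Proof.
move=> aB E /l2P [M HM]; apply/l2P; exists (2 * expR (2 * cmod k ^+ 2 * B) * M) => N.
by rewrite (le_trans (volterra_solution_le N aB E)) // ler_wpM2l // mulr_ge0 ?expR_ge0.
Qed.

(** [D] solves the equation differentiated formally in [w]. The Gronwall bound shows in turn that
    [F (z + h)] is bounded, that [F (z + h) - F z] is of order [h], and that the remainder is of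
    order [h^2]; each solves an equation with kernel [a] whose free term is controlled by the step
    before. *)
Lemma volterra_quad (R : realType) (a : nat -> nat -> R[i]) (B : R) (l z : R[i])
    (F f : R[i] -> nat -> R[i]) (D f' : nat -> R[i]) :
  0 <= B -> hilbert_schmidt_le a B ->
  (forall w, F w = f w + (w - l) *: volterra a (F w)) ->
  D = (f' + volterra a (F z)) + (z - l) *: volterra a D ->
  l2 (f z) -> l2 f' -> l2quad f f' z ->
  [/\ l2 (F z), l2 D & l2quad F D z].
Proof.
move=> B0 aB EF ED lf lf' qf.
have lF : l2 (F z) := volterra_solution_l2 aB (EF z) lf.
have lD : l2 D.
  by apply: (volterra_solution_l2 aB ED); apply: l2D => //; exact: l2_volterra B0 aB lF.
split=> //.
have [C1 C10 H1] := l2quad_lip qf lf'.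
have [C0 HC0] := (l2P _).1 lf.
(* The [1] accounts for [|h| <= 1], so that one constant serves all the points [z + h]. *)
pose K := 2 * expR (2 * (cmod (z - l) + 1) ^+ 2 * B).
have K0 : 0 <= K by rewrite mulr_ge0 // expR_ge0.
have Kle h N x y : cmod h <= 1 -> x = y + (z - l + h) *: volterra a x ->
    sqsum N x <= K * sqsum N y.
  move=> h1 E; apply: (le_trans (volterra_solution_le N aB E)).
  rewrite ler_wpM2r ?sqsum_ge0 // ler_wpM2l // ler_expR ler_wpM2r // ler_wpM2l //.
  rewrite ler_pXn2r ?nnegrE ?addr_ge0 ?cmod_ge0 //.
  by rewrite (le_trans (cmodD _ _)) // lerD2l.
pose C2 := K * (2 * C1 + 2 * C0).
have HF h N : cmod h <= 1 -> sqsum N (F (z + h)) <= C2.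
  move=> h1; have E : F (z + h) = f (z + h) + (z - l + h) *: volterra a (F (z + h)).
    by rewrite {1}EF addrAC.
  apply: (le_trans (Kle _ N _ _ h1 E)); rewrite ler_wpM2l //.
  rewrite -[f (z + h)](subrK (f z)) (le_trans (sqsumD _ _ _)) // lerD // ler_wpM2l //.
  by rewrite (le_trans (H1 h h1 N)) // ler_piMr // exprn_ile1 // cmod_ge0.
pose C3 := K * (2 * C1 + 2 * (B * C2)).
have He h N : cmod h <= 1 -> sqsum N (F (z + h) - F z) <= C3 * cmod h ^+ 2.
  move=> h1; pose e := F (z + h) - F z.
  (* Difference of the equations at [z + h] and [z]: the change of the factor [w - l] adds
     [h *: volterra a (F (z + h))] to the free term. The summand [0] stands for the [h] of [Kle]. *)
  have E : e = (f (z + h) - f z + h *: volterra a (F (z + h))) + (z - l + 0) *: volterra a e.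
    rewrite /e volterraB {1}(EF (z + h)) {1}(EF z) addr0.
    have -> : z + h - l = (z - l) + h by ring.
    rewrite scalerDl scalerBr opprD.
    by apply/funext => n; rewrite /GRing.add /GRing.opp /=; ring.
  apply: (le_trans (Kle 0 N _ _ _ E)); first by rewrite cmod0.
  rewrite /C3 -mulrA ler_wpM2l // (le_trans (sqsumD _ _ _)) // [leRHS]mulrDl.
  apply: lerD; rewrite -mulrA ler_wpM2l ?H1 //.
  rewrite sqsumZ mulrC ler_wpM2r ?exprn_ge0 ?cmod_ge0 //.
  by rewrite (le_trans (volterra_le _ _ aB)) // ler_wpM2l // HF.
have [C HC] := qf.
exists (K * (2 * C + 2 * (B * C3))) => h h1 N.
pose e := F (z + h) - F z; pose d := e - h *: D.
(* Subtracting [h] times the equation of [D] leaves [h *: volterra a e], which is of second order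
   because [e] is of first order. *)
have E : d = (f (z + h) - f z - h *: f' + h *: volterra a e) + (z - l + 0) *: volterra a d.
  rewrite /d /e !volterraB volterraZ {1}(EF (z + h)) {1}(EF z) {1}ED addr0.
  have -> : z + h - l = (z - l) + h by ring.
  rewrite scalerDl !scalerBr !scalerDr !scalerA (mulrC h).
  by apply/funext => n; rewrite /GRing.add /GRing.opp /GRing.scale /=; ring.
apply: (le_trans (Kle 0 N _ _ _ E)); first by rewrite cmod0.
rewrite -mulrA ler_wpM2l // (le_trans (sqsumD _ _ _)) // [leRHS]mulrDl.
apply: lerD; rewrite -mulrA ler_wpM2l ?HC //.
rewrite sqsumZ (_ : B * C3 * cmod h ^+ 4 = cmod h ^+ 2 * (B * (C3 * cmod h ^+ 2))); last by ring.
rewrite ler_wpM2l ?exprn_ge0 ?cmod_ge0 //.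
by rewrite (le_trans (volterra_le _ _ aB)) // ler_wpM2l // He.
Qed.

Definition orthopoly_dvec (R : realType) (s : nat -> R) (z : R[i]) : nat -> R[i] :=
  fun n => ((orthopolyC s n)^`()).[z].

Definition orthopoly_ddvec (R : realType) (s : nat -> R) (z : R[i]) : nat -> R[i] :=
  fun n => ((orthopolyC s n)^`()^`()).[z].

Definition orthopoly_dddvec (R : realType) (s : nat -> R) (z : R[i]) : nat -> R[i] :=
  fun n => ((orthopolyC s n)^`()^`()^`()).[z].

Definition volterra_kernel (R : realType) (s : nat -> R) (l : R[i]) (c : nat -> R[i])
    (n k : nat) : R[i] :=
  orthopoly_vec s l k * c n - orthopoly_vec s l n * c k.

(** The square of an entry is at most [2 |p_k|^2 |c_n|^2 + 2 |p_n|^2 |c_k|^2], and each of the two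
    double sums is at most [A * C] before the factor 2. *)
Lemma volterra_kernel_HS (R : realType) (s : nat -> R) (l : R[i]) (c : nat -> R[i]) :
  l2 (orthopoly_vec s l) -> l2 c ->
  exists2 B, 0 <= B & hilbert_schmidt_le (volterra_kernel s l c) B.
Proof.
move=> lp lc; have [A HA] := (l2P _).1 lp; have [C HC] := (l2P _).1 lc.
have A0 : 0 <= A := le_trans (sqsum_ge0 0 _) (HA 0%N).
have C0 : 0 <= C := le_trans (sqsum_ge0 0 _) (HC 0%N).
exists (4 * A * C); first by rewrite !mulr_ge0.
move=> N; set p := orthopoly_vec s l in HA *.
apply: (@le_trans _ _ (\sum_(n < N) (2 * A * cmod (c n) ^+ 2 + 2 * C * cmod (p n) ^+ 2))).
  apply: ler_sum => n _.
  rewrite (_ : volterra_kernel s l c n = c n *: p + (- p n) *: c); last first.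
    by apply/funext => k; rewrite -[RHS]/(c n * p k + - p n * c k) mulNr mulrC.
  rewrite (le_trans (sqsumD _ _ _)) // !sqsumZ cmodN lerD // -mulrA ler_wpM2l // mulrC.
    by rewrite ler_wpM2r ?sqr_ge0.
  by rewrite ler_wpM2r ?sqr_ge0.
rewrite big_split /= -!mulr_sumr.
have h1 : 2 * A * sqsum N c <= 2 * A * C by rewrite ler_wpM2l // mulr_ge0.
have h2 : 2 * C * sqsum N p <= 2 * C * A by rewrite ler_wpM2l // mulr_ge0.
rewrite /sqsum in h1 h2; lra.
Qed.

Definition resolvent_coef (R : realType) (s : nat -> R) (m : nat -> R[i]) (n : nat) : R[i] :=
  moment_functional m (orthopolyC s n).

Section orthopoly_sections.
Context (R : realType) (s : nat -> R) (l : R[i]) (m : nat -> R[i]).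
Hypothesis s_pd : positive_definite s.
Hypothesis lm : resolvent_moments l (@ofR R \o s) m.
Hypothesis lp : l2 (orthopoly_vec s l).
Hypothesis lc : l2 (resolvent_coef s m).

Let a := volterra_kernel s l (resolvent_coef s m).

Let polyE n : orthopolyC s n = (orthopoly_vec s l n)%:P
  + ('X - l%:P) * \sum_(k < n) a n k *: orthopolyC s k.
Proof.
have := ortho_volterra n (orthopolyC_orthonormal s_pd) lm.
by rewrite /= {1}/orthopoly_vec -/(orthopolyC s n) => {1}->.
Qed.

Let vecE z : orthopoly_vec s z = orthopoly_vec s l + (z - l) *: volterra a (orthopoly_vec s z).
Proof.
apply/funext => n; rewrite {1}/orthopoly_vec -/(orthopolyC s n) polyE !hornerE.
rewrite -[RHS]/(_ + (z - l) * _) horner_sum; congr (_ + _ * _).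
by apply: eq_bigr => k _; rewrite !hornerE.
Qed.

(** The summand [0] is the derivative of the constant free term [orthopoly_vec s l], in the shape
    that [volterra_quad] expects. In the higher equations the terms without the factor [z - l] come
    from differentiating that factor, by Leibniz's rule. *)
Let dvecE z : orthopoly_dvec s z
  = (0 + volterra a (orthopoly_vec s z)) + (z - l) *: volterra a (orthopoly_dvec s z).
Proof.
rewrite [0 + _]add0r; apply/funext => n; rewrite {1}/orthopoly_dvec polyE derivD derivC add0r derivM derivB derivX derivC subr0 mul1r.
rewrite !hornerE -[RHS]/(_ + (z - l) * _) raddf_sum /= !horner_sum.
congr (_ + _ * _); apply: eq_bigr => k _; by rewrite ?derivZ !hornerE.
Qed.

Let ddvecE z : orthopoly_ddvec s z
  = (volterra a (orthopoly_dvec s z) + volterra a (orthopoly_dvec s z))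
    + (z - l) *: volterra a (orthopoly_ddvec s z).
Proof.
apply/funext => n; rewrite {1}/orthopoly_ddvec polyE derivD derivC add0r derivM derivB derivX derivC subr0 mul1r.
rewrite derivD derivM derivB derivX derivC subr0 mul1r addrA !hornerE.
rewrite -[RHS]/((_ + _) + (z - l) * _) !raddf_sum /= !horner_sum.
congr (_ + _ + _ * _); apply: eq_bigr => k _; by rewrite ?derivZ !hornerE.
Qed.

Let dddvecE z : orthopoly_dddvec s z
  = (volterra a (orthopoly_ddvec s z) + volterra a (orthopoly_ddvec s z)
     + volterra a (orthopoly_ddvec s z))
    + (z - l) *: volterra a (orthopoly_dddvec s z).
Proof.
apply/funext => n; rewrite {1}/orthopoly_dddvec polyE derivD derivC add0r derivM derivB derivX derivC subr0 mul1r.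
rewrite derivD derivM derivB derivX derivC subr0 mul1r.
rewrite !derivD derivM derivB derivX derivC subr0 mul1r !addrA !hornerE.
rewrite -[RHS]/((_ + _ + _) + (z - l) * _) !raddf_sum /= !horner_sum.
congr (_ + _ + _ + _ * _); apply: eq_bigr => k _; by rewrite ?derivZ !hornerE.
Qed.

Lemma orthopoly_vec_regular z :
  [/\ l2 (orthopoly_vec s z), l2 (orthopoly_dvec s z), l2 (orthopoly_ddvec s z),
      l2quad (orthopoly_vec s) (orthopoly_dvec s z) z &
      l2quad (orthopoly_dvec s) (orthopoly_ddvec s z) z].
Proof.
have [B B0 aB] := volterra_kernel_HS lp lc.
have q0 : l2quad (fun=> orthopoly_vec s l) 0 z.
  exists 0 => h _ N; rewrite scaler0 subr0 subrr mul0r /sqsum big1 // => i _.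
  by rewrite cmod0 expr0n.
have [l1 l1' q1] := volterra_quad B0 aB vecE (dvecE z) lp (@l20 R) q0.
have dE w : orthopoly_dvec s w
    = volterra a (orthopoly_vec s w) + (w - l) *: volterra a (orthopoly_dvec s w).
  by rewrite {1}dvecE add0r.
have [_ l3 q2] := volterra_quad B0 aB dE (ddvecE z) (l2_volterra B0 aB l1)
  (l2_volterra B0 aB l1') (l2quad_volterra B0 aB q1).
by [].
Qed.

(** One order beyond the holomorphy of [p']: it provides the continuity of the second derivatives of
    [ln |p|]. *)
Lemma orthopoly_ddvec_regular z :
  l2 (orthopoly_dddvec s z) /\ l2quad (orthopoly_ddvec s) (orthopoly_dddvec s z) z.
Proof.
have [B B0 aB] := volterra_kernel_HS lp lc.
have [l1 l1' l2' _ q2] := orthopoly_vec_regular z.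
have lv1 := l2_volterra B0 aB l1'; have lv2 := l2_volterra B0 aB l2'.
have qv := l2quad_volterra B0 aB q2.
by have [] := volterra_quad B0 aB ddvecE (dddvecE z) (l2D lv1 lv1) (l2D lv2 lv2) (l2quadD qv qv).
Qed.
End orthopoly_sections.

(** * Indeterminacy *)

Lemma Rintegral_lincomb (d : measure_display) (T : measurableType d) (R : realType)
    (mu : {measure set T -> \bar R}) (n : nat) (c : nat -> R) (F : nat -> T -> R) :
  (forall i, mu.-integrable setT (EFin \o F i)) ->
  mu.-integrable setT (EFin \o (fun x => \sum_(i < n) c i * F i x)) /\
  \int[mu]_x (\sum_(i < n) c i * F i x) = \sum_(i < n) c i * \int[mu]_x F i x.
Proof.
move=> iF; elim: n => [|n [IH1 IH2]].
  split; last first.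
    rewrite big_ord0; under eq_Rintegral do rewrite big_ord0.
    by rewrite /Rintegral integral0.
  by apply: eq_integrable (integrable0 mu setT) => // x _ /=; rewrite big_ord0.
have iZ : mu.-integrable setT (EFin \o (fun x => c n * F n x)).
  by apply: eq_integrable (integrableZl measurableT (c n) (iF n)) => // x _ /=; rewrite EFinM.
split.
  apply: eq_integrable (integrableD measurableT IH1 iZ) => // x _ /=.
  by rewrite big_ord_recr.
rewrite big_ord_recr /= -IH2 -RintegralZl // -RintegralD //.
by apply: eq_Rintegral => x _; rewrite big_ord_recr.
Qed.

(** * Moments against a bounded weight, and Bessel's inequality *)

Definition weighted_moment (R : realType) (mu : {measure set (measurableTypeR R) -> \bar R})
    (g : R -> R) (i : nat) : R := \int[mu]_x ((x : R) ^+ i * g x).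

Lemma integrable_Xn_weight (R : realType) (s : nat -> R)
    (mu : {measure set (measurableTypeR R) -> \bar R}) (g : R -> R) (K : R) (i : nat) :
  moment_solution s mu -> measurable_fun setT (g : measurableTypeR R -> R) ->
  (forall x, `|g x| <= K) ->
  mu.-integrable setT (EFin \o (fun x : measurableTypeR R => x ^+ i * g x)).
Proof.
move=> mus mg gK; have [ix _] := mus i.
have K0 : 0 <= K by rewrite (le_trans _ (gK 0)).
have mx : measurable_fun setT ((fun x => (x : R) ^+ i) : measurableTypeR R -> R).
  by move/(measurable_int mu) : ix => /measurable_EFinP.
apply: (@le_integrable _ _ _ mu setT measurableT _ (fun x => K%:E * ((x : R) ^+ i)%:E)%E).
- apply/measurable_EFinP; exact: measurable_funM.
- move=> x _; change (`|(x : R) ^+ i * g x|%:E <= `|K * (x : R) ^+ i|%:E)%E.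
  rewrite lee_fin !normrM mulrC ler_wpM2r //.
  by rewrite (le_trans (gK x)) // ler_norm.
- exact: integrableZl.
Qed.

Lemma weighted_poly (R : realType) (s : nat -> R)
    (mu : {measure set (measurableTypeR R) -> \bar R}) (g : R -> R) (K : R) (p : {poly R}) :
  moment_solution s mu -> measurable_fun setT (g : measurableTypeR R -> R) ->
  (forall x, `|g x| <= K) ->
  mu.-integrable setT (EFin \o (fun x : measurableTypeR R => p.[x] * g x)) /\
  \int[mu]_x (p.[x] * g x) = moment_functional (weighted_moment mu g) p.
Proof.
move=> mus mg gK.
have [h1 h2] := Rintegral_lincomb (size p) (fun i => p`_i)
  (fun i => integrable_Xn_weight i mus mg gK).
have E x : p.[x] * g x = \sum_(i < size p) p`_i * (x ^+ i * g x).
  by rewrite horner_coef mulr_suml; apply: eq_bigr => i _; rewrite mulrA.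
split; first by apply: eq_integrable h1 => // x _ /=; rewrite E.
by rewrite -[RHS]h2; apply: eq_Rintegral => x _; rewrite E.
Qed.

Lemma weighted_moment1 (R : realType) (s : nat -> R)
    (mu : {measure set (measurableTypeR R) -> \bar R}) :
  moment_solution s mu -> weighted_moment mu (fun=> 1) = s.
Proof.
move=> mus; apply/funext => i; rewrite /weighted_moment.
under eq_Rintegral do rewrite mulr1.
by rewrite /Rintegral (mus i).2.
Qed.

(** The integral of [(g - p)^2] is nonnegative for [p = \sum_(n < N) c n *: P n]. Both the integral
    of [p g] and that of [p^2] equal the sum of the [c n ^+ 2], and that of [g^2] is at most
    [K ^+ 2] as the total mass is 1. *)
Lemma weighted_bessel (R : realType) (s : nat -> R)
    (mu : {measure set (measurableTypeR R) -> \bar R}) (g : R -> R) (K : R)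
    (P : nat -> {poly R}) (N : nat) :
  s 0%N = 1 ->
  moment_solution s mu -> measurable_fun setT (g : measurableTypeR R -> R) ->
  (forall x, `|g x| <= K) -> orthonormal_polys s P ->
  \sum_(n < N) moment_functional (weighted_moment mu g) (P n) ^+ 2 <= K ^+ 2.
Proof.
(* The square is split as [(g^2 - p g) + (p^2 - p g)] to match the four integrals computed below;
   [fin] is the scalar inequality that results. *)
have hq (a b : R) : 0 <= b ^+ 2 - a * b + (a * a - a * b).
  by rewrite (_ : _ + _ = (b - a) ^+ 2) ?sqr_ge0 //; ring.
have fin (a b c : R) : 0 <= a - b + (b - b) -> a <= c -> b <= c.
  by rewrite subrr addr0 subr_ge0 => h; exact: le_trans h.
move=> s0 mus mg gK oP; set c := fun n => moment_functional (weighted_moment mu g) (P n).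
pose p := \sum_(n < N) c n *: P n.
have [m1 b1] : measurable_fun setT ((fun=> 1) : measurableTypeR R -> R) /\
    (forall x : R, `|(fun=> 1 : R) x| <= 1) by split=> [//|x]; rewrite normr1.
have mg2 : measurable_fun setT ((fun x => g x ^+ 2) : measurableTypeR R -> R).
  exact: measurable_funX.
have b2 x : `|g x ^+ 2| <= K ^+ 2.
  by rewrite normrX ler_pXn2r ?nnegrE // (le_trans _ (gK x)).
(* Weight [g^2] with the polynomial 1, or weight 1 with [p * p] or a constant: every integral
   becomes an instance of [weighted_poly]. *)
have [i1 e1] := weighted_poly 1 mus mg2 b2.
have [i2 e2] := weighted_poly p mus mg gK.
have [i3 e3] := weighted_poly (p * p) mus m1 b1.
have [i4 e4] := weighted_poly (K ^+ 2)%:P mus m1 b1.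
rewrite (weighted_moment1 mus) in e3 e4.
have E3 : moment_functional s (p * p) = \sum_(n < N) c n ^+ 2.
  have EP (i : 'I_N) : moment_functional s (P i * p) = c i.
    rewrite /p mulr_sumr moment_functional_sum (bigD1 i) //= big1 ?addr0 => [|j ji].
      by rewrite -scalerAr moment_functionalZ oP.2 eqxx mulr1.
    by rewrite -scalerAr moment_functionalZ oP.2 eq_sym (negbTE (ji : (j : nat) != i)) mulr0.
  rewrite {1}/p mulr_suml moment_functional_sum; apply: eq_bigr => i _.
  by rewrite -scalerAl moment_functionalZ EP expr2.
have E2 : moment_functional (weighted_moment mu g) p = \sum_(n < N) c n ^+ 2.
  rewrite /p moment_functional_sum; apply: eq_bigr => i _.
  by rewrite moment_functionalZ expr2.
have E4 : moment_functional s (K ^+ 2)%:P = K ^+ 2.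
  by rewrite -[_%:P]mulr1 mul_polyC moment_functionalZ moment_functional1 s0 mulr1.
have h : 0 <= \int[mu]_x ((1.[x] * g x ^+ 2 - p.[x] * g x) + ((p * p).[x] * 1 - p.[x] * g x)).
  apply: Rintegral_ge0 => x _; rewrite hornerM hornerC mul1r mulr1.
  exact: hq.
have iB := integrableB measurableT i1 i2.
have iC := integrableB measurableT i3 i2.
rewrite RintegralD ?RintegralB // in h.
have h4 : \int[mu]_x (1.[x] * g x ^+ 2) <= \int[mu]_x ((K ^+ 2)%:P.[x] * 1).
  apply: le_Rintegral => // x _; rewrite !hornerC mul1r mulr1.
  by rewrite (le_trans _ (b2 x)) // ler_norm.
rewrite e2 e3 E2 E3 in h; rewrite e4 E4 in h4; exact: fin h h4.
Qed.

(** [t * cauchy_kernel (t * (u - x))] is [pi] times the Poisson kernel of the upper half plane at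
    [u + i / t], which is the imaginary part of [1 / (x - (u + i / t))]. *)
Definition cauchy_kernel (R : realType) (w : R) : R := (1 + w ^+ 2)^-1.

Lemma cauchy_kernel_den (R : realType) (w : R) : 0 < 1 + w ^+ 2.
Proof. by rewrite ltr_wpDr // sqr_ge0. Qed.

Lemma cauchy_kernel_ge0 (R : realType) (w : R) : 0 <= cauchy_kernel w.
Proof. by rewrite invr_ge0 ltW // cauchy_kernel_den. Qed.

Lemma continuous_cauchy_kernel (R : realType) : continuous (@cauchy_kernel R).
Proof.
move=> w; apply: cvgV; first by rewrite gt_eqF // cauchy_kernel_den.
apply: cvgD; first exact: cvg_cst.
exact: exprn_continuous.
Qed.

Lemma atan_FTC (R : realType) (x t a b : R) : a < b ->
  (\int[lebesgue_measure]_(u in `[a, b]) (t * cauchy_kernel (t * (u - x)))%:E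
   = (atan (t * (b - x)) - atan (t * (a - x)))%:E)%E.
Proof.
move=> ab.
have dF (u : R) : is_derive u 1 (fun u => atan (t * (u - x))) (t * cauchy_kernel (t * (u - x))).
  have h : is_derive u 1 (fun u => t * (u - x)) t.
    by apply: is_derive_eq; rewrite subr0; exact: mulr1.
  apply: is_derive_eq (is_derive1_comp (is_derive1_atan _) h) _.
  by rewrite mulrC.
rewrite (continuous_FTC2 (F := fun u => atan (t * (u - x))) ab) ?EFinB //.
- apply: continuous_subspaceT => u; apply: cvgM; first exact: cvg_cst.
  apply: (@continuous_comp _ _ _ (fun u => t * (u - x)) (@cauchy_kernel R) u);
    last exact: continuous_cauchy_kernel.
  by apply: cvgM; [exact: cvg_cst|apply: cvgB; [exact: cvg_id|exact: cvg_cst]].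
- split=> [u _|//|].
  + by have [] := dF u.
  + apply: cvg_at_right_filter; apply: differentiable_continuous.
    by apply/derivable1_diffP; have [] := dF a.
  + apply: cvg_at_left_filter; apply: differentiable_continuous.
    by apply/derivable1_diffP; have [] := dF b.
- by move=> u _; rewrite derive1E; have /@derive_val := dF u.
Qed.

(** The kernel is nonnegative, so Tonelli's theorem exchanges the integrals; the inner one is then a
    difference of arctangents. *)
Lemma poisson_fubini (R : realType)
    (mu : {finite_measure set (measurableTypeR R) -> \bar R}) (t a b : R) :
  0 < t -> a < b ->
  (\int[mu]_x (atan (t * (b - x)) - atan (t * (a - x)))%:E
   = \int[lebesgue_measure]_(u in `[a, b])
       \int[mu]_x (t * cauchy_kernel (t * (u - x)))%:E)%E.
Proof.
move=> t0 ab.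
pose f (p : measurableTypeR R * measurableTypeR R) : \bar R :=
  (t * cauchy_kernel (t * (p.2 - p.1)) * \1_(`[a, b]%classic : set (measurableTypeR R)) p.2)%:E.
have f0 p : (0 <= f p)%E.
  by rewrite lee_fin !mulr_ge0 ?cauchy_kernel_ge0 // ltW.
have mf : measurable_fun setT f.
  apply/measurable_EFinP; apply: measurable_funM; last first.
    by apply: measurableT_comp => //; exact: measurable_indic.
  apply: measurable_funM => //.
  apply: (measurableT_comp (f := @cauchy_kernel R)).
    by apply: continuous_measurable_fun; exact: continuous_cauchy_kernel.
  by apply: measurable_funM => //; exact: measurable_funB.
have E (g : R -> R) :
    (\int[lebesgue_measure]_(u in `[a, b]) (g u)%:E
     = \int[lebesgue_measure]_u (g u * \1_(`[a, b]%classic : set (measurableTypeR R)) u)%:E)%E.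
  rewrite integral_mkcond; apply: eq_integral => u _.
  by rewrite patchE indicE; case: ifP => _; rewrite ?mulr1 ?mulr0.
transitivity (\int[mu]_x \int[lebesgue_measure]_u f (x, u))%E.
  by apply: eq_integral => x _; rewrite -atan_FTC // E.
rewrite (@fubini_tonelli _ _ _ _ R mu lebesgue_measure f mf f0) [RHS]integral_mkcond.
apply: eq_integral => u _; rewrite patchE /f /=.
case: ifPn => ui; apply/esym.
  by apply: eq_integral => x _; rewrite indicE ui mulr1.
rewrite -[LHS](integral0 mu setT); apply: eq_integral => x _.
by rewrite indicE (negbTE ui) mulr0.
Qed.

Lemma natSr_cvgy (R : realType) : (fun n : nat => n.+1%:R : R) @ \oo --> +oo.
Proof.
apply/cvgryPge => A; have /cvgryPge := @cvgr_idn R; move=> /(_ A); apply: filterS => n h.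
by rewrite (le_trans h) // ler_nat.
Qed.

(* The shift by [1 / n] makes the limit right for [x = z] too. *)
Lemma atan_shift_lim (R : realType) (z x : R) :
  (fun n => atan (n.+1%:R ^+ 2 * (z + n.+1%:R^-1 - x))) @ \oo -->
    (if x <= z then pi / 2 else - (pi / 2) : R).
Proof.
have ay : (fun n : nat => atan n.+1%:R) @ \oo --> (pi / 2 : R).
  exact: (cvg_comp _ _ (@natSr_cvgy R) (@cvgy_atan R)).
have E n : n.+1%:R ^+ 2 * (z + n.+1%:R^-1 - x) = n.+1%:R + n.+1%:R ^+ 2 * (z - x) :> R.
  have : n.+1%:R != 0 :> R by rewrite pnatr_eq0.
  by set N := n.+1%:R => N0; field.
case: ifPn => [xz|]; last rewrite -ltNge => zx.
  apply: (squeeze_cvgr _ ay (cvg_cst _)); apply: nearW => n.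
  rewrite [X in _ && X]ltW ?atan_ltpi2 // andbT le_atan //.
  by rewrite E lerDl mulr_ge0 ?sqr_ge0 ?subr_ge0.
apply: (squeeze_cvgr _ (cvg_cst _) (cvgN ay)).
(* Once [N >= 2 / (x - z)], [N + N^2 (z - x) <= N - 2 N = - N], which squeezes the arctangent to
   [- (pi / 2)]. *)
have /cvgryPge /(_ (2 / (x - z))) := @natSr_cvgy R; apply: filterS => n.
rewrite ler_pdivrMr ?subr_gt0 // => h.
apply/andP; split; first by rewrite ltW ?atan_gtNpi2.
rewrite -[leRHS]/(- atan n.+1%:R) -atanN le_atan // E.
have n0 : 0 < n.+1%:R :> R by rewrite ltr0Sn.
set N := n.+1%:R in n0 h *.
nra.
Qed.

(** Stieltjes-Perron inversion: integrated over a shifted interval, the Poisson integrals tend to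
    [pi] times the mass of []a, b]], by dominated convergence with bound [pi]. The shift keeps the
    limit exact when the endpoints carry atoms, so that half-open intervals, which generate the
    Borel sets, can be compared directly. *)
Lemma poisson_determines (R : realType)
    (mu nu : {finite_measure set (measurableTypeR R) -> \bar R}) :
  (forall t u : R, (0 < t)%R ->
    \int[mu]_x (t * cauchy_kernel (t * (u - x)))%:E
    = \int[nu]_x (t * cauchy_kernel (t * (u - x)))%:E)%E ->
  forall A, measurable A -> mu A = nu A.
Proof.
move=> H.
suff K a b : a < b -> mu (`]a, b]%classic : set (measurableTypeR R)) = nu `]a, b]%classic.
  have covn : \bigcup_k (fun n : nat => `](- n%:R), n%:R]%classic : set (measurableTypeR R)) k = setT.
    rewrite -subTset => x _; have [n xn] : exists n : nat, `|x : R| < n%:R.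
      by exists (Num.trunc `|x : R|).+1; apply: truncnS_gt.
    exists n => //; rewrite /= in_itv /=; move: xn; rewrite ltr_norml => /andP[-> /ltW ->] //.
  apply: (@measure_unique _ R (measurableTypeR R) (@ocitv R)
    (fun n => `](- n%:R), n%:R]%classic)) => //.
  - exact: ocitvI.
  - by move=> k; exact: is_ocitv.
  - by move=> A /ocitvP [->|[[c d] /= cd ->]]; rewrite ?measure0 ?K.
  - by move=> k; rewrite ltey_eq fin_num_measure.
move=> ab.
(* The width of the kernel is the square of the shift, so the shift dominates it in the limit. *)
pose t n : R := n.+1%:R ^+ 2.
pose c n (z : R) : R := z + n.+1%:R^-1.
pose f n (x : measurableTypeR R) : \bar R :=
  (atan (t n * (c n b - x)) - atan (t n * (c n a - x)))%:E.
pose g (x : measurableTypeR R) : \bar R := (pi * \1_(`]a, b]%classic : set (measurableTypeR R)) x)%:E.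
have t0 n : 0 < t n by rewrite exprn_gt0 // ltr0Sn.
have cab n : c n a < c n b by rewrite ltrD2r.
have fE n : (\int[mu]_x f n x = \int[nu]_x f n x)%E.
  by rewrite !poisson_fubini //; apply: eq_integral => u _; rewrite H.
have mf n : measurable_fun setT (f n).
  apply/measurable_EFinP; apply: measurable_funB;
    (apply: (measurableT_comp (f := @atan R));
     [by apply: continuous_measurable_fun => x; exact: continuous_atan|
      by apply: measurable_funM => //; exact: measurable_funB]).
have mg : measurable_fun setT g.
  by apply/measurable_EFinP; apply: measurable_funM => //; exact: measurable_indic.
have bnd n x : (`|f n x| <= (pi : R)%:E)%E.
  rewrite lee_fin ler_norml; have := atan_gtNpi2 (t n * (c n b - x)).
  have := atan_ltpi2 (t n * (c n b - x)); have := atan_gtNpi2 (t n * (c n a - x)).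
  have := atan_ltpi2 (t n * (c n a - x)); set A := atan _; set B := atan _; set p := pi.
  by move=> h1 h2 h3 h4; apply/andP; split; lra.
have lim1 := @atan_shift_lim R.
have fg x : (fun n => f n x) @ \oo --> g x.
  rewrite /f /g; apply: cvg_EFin; first exact: nearW.
  rewrite (_ : pi * _ = (if (x : R) <= b then pi / 2 else - (pi / 2))
    - (if (x : R) <= a then pi / 2 else - (pi / 2))); first exact: cvgB (lim1 b x) (lim1 a x).
  rewrite indicE mem_setE in_itv /=; have [xa|ax] := leP x a.
    by rewrite (le_trans xa (ltW ab)) subrr mulr0.
  by case: ifP => _; rewrite ?mulr1 ?mulr0 opprK ?addNr // -splitr.
have lim (m : {finite_measure set (measurableTypeR R) -> \bar R}) :
    (fun n => \int[m]_x f n x)%E @ \oo --> ((pi : R)%:E * m `]a, b]%classic)%E.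
  have ipi : m.-integrable setT (fun=> (pi : R)%:E).
    exact: finite_measure_integrable_cst.
  have [_ _] := @dominated_convergence _ _ R m setT measurableT f g (fun=> (pi : R)%:E)
    mf mg (aeW _ (fun x _ => fg x)) ipi (aeW _ (fun x n _ => bnd n x)).
  rewrite (_ : (\int[m]_(x in setT) g x)%E = ((pi : R)%:E * m `]a, b]%classic)%E) //.
  rewrite /g; under eq_integral do rewrite EFinM.
  rewrite ge0_integralZl_EFin // ?pi_ge0 //; last exact/measurable_EFinP/measurable_indic.
  by rewrite integral_indic // setIT.
have limmu := lim mu; rewrite (_ : (fun n => _) = (fun n => \int[nu]_x f n x)%E) in limmu; last first.
  by apply/funext => n.
have E : ((pi : R)%:E * mu `]a, b]%classic = (pi : R)%:E * nu `]a, b]%classic)%E.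
  exact: (cvg_unique (@ereal_hausdorff R) limmu (lim nu)).
have fm := fineK (fin_num_measure mu `]a, b]%classic (measurable_itv _)).
have fn := fineK (fin_num_measure nu `]a, b]%classic (measurable_itv _)).
rewrite -fm -fn -!EFinM in E *; have /mulfI h : pi != 0 :> R by rewrite gt_eqF // pi_gt0.
by rewrite (h _ _ (EFin_inj E)).
Qed.

(* For [f = \sum_(n < N) conj (P_n l) P_n] one has [f(l) = sqsum N (P l)], so that the two
   functionals applied to [f - f(l)], a multiple of ['X - l], agree. *)
Lemma resolvent_gap (R : realType) (s : nat -> R) (l : R[i]) (m m' : nat -> R[i]) (N : nat) :
  resolvent_moments l (@ofR R \o s) m ->
  resolvent_moments l (@ofR R \o s) m' ->
  sqsum N (orthopoly_vec s l) * cmod (m 0%N - m' 0%N) ^+ 2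
  <= sqsum N (resolvent_coef s m - resolvent_coef s m').
Proof.
move=> lm lm'; set S := sqsum N _; set d := m 0%N - m' 0%N.
pose f := \sum_(n < N) cconj (orthopoly_vec s l n) *: orthopolyC s n.
have fl : f.[l] = ofR S.
  rewrite /f horner_sum -prodsum_diag; apply: eq_bigr => n _.
  by rewrite hornerZ mulrC.
have [q Eq _] := factor_horner l f.
have L mm : resolvent_moments l (@ofR R \o s) mm ->
    \sum_(n < N) cconj (orthopoly_vec s l n) * resolvent_coef s mm n - ofR S * mm 0%N
    = moment_functional (@ofR R \o s) q.
  move=> h; rewrite -(resolvent_functional _ h) -Eq moment_functionalB fl.
  congr (_ - _); last first.
    by rewrite -[_%:P]mulr1 mul_polyC moment_functionalZ moment_functional1.
  rewrite moment_functional_sum; apply: eq_bigr => n _.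
  by rewrite moment_functionalZ.
have E : ofR S * d = \sum_(n < N) cconj (orthopoly_vec s l n) *
    (resolvent_coef s m - resolvent_coef s m') n.
  have : ofR S * d = (\sum_(n < N) cconj (orthopoly_vec s l n) * resolvent_coef s m n)
     - (\sum_(n < N) cconj (orthopoly_vec s l n) * resolvent_coef s m' n).
    have := L _ lm; rewrite -(L _ lm') /d mulrBr.
    set a := \sum_(_ < _) _; set b := \sum_(_ < _) _; move=> h.
    by rewrite -[a](subrK (ofR S * m 0%N)) h; ring.
  by move=> ->; rewrite -sumrB; apply: eq_bigr => n _; rewrite -mulrBr.
have S0 : 0 <= S := sqsum_ge0 _ _.
have := sqsum_cauchy_schwarz N (fun n => cconj (orthopoly_vec s l n))
  (resolvent_coef s m - resolvent_coef s m').
rewrite -E cmodM exprMn cmod_ofR (ger0_norm S0) sqsumJ -/S => h.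
(* Cauchy-Schwarz gives the claim multiplied by [S]; that factor is cancelled when it is nonzero. *)
have [->|Sn] := eqVneq S 0; first by rewrite mul0r sqsum_ge0.
have Sp : 0 < S by rewrite lt_neqAle eq_sym Sn.
by rewrite -(ler_pM2l Sp) mulrA -expr2.
Qed.

Lemma moment_functional_complex (R : realType) (a b : nat -> R) (p : {poly R}) :
  moment_functional (fun i => Complex (a i) (b i)) (map_poly (@ofR R) p)
  = Complex (moment_functional a p) (moment_functional b p).
Proof.
rewrite (@moment_functionalE _ _ _ (size p)) ?size_poly // /moment_functional.
apply/eqP; rewrite eq_complex; apply/andP; split; apply/eqP => /=.
  rewrite (Re_sum _ (fun i => (map_poly (@ofR R) p)`_i * Complex (a i) (b i))).
  by apply: eq_bigr => i _; rewrite coef_map /ofR /=; simpc.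
rewrite (Im_sum _ (fun i => (map_poly (@ofR R) p)`_i * Complex (a i) (b i))).
by apply: eq_bigr => i _; rewrite coef_map /ofR /=; simpc.
Qed.

(** * The Stieltjes transform of a solution *)

(* With [w = t (u - x)], the real and imaginary parts of [1 / (x - (u + i / t))]. *)
Definition stieltjes_re (R : realType) (t u : R) (x : R) : R :=
  t * (t * (x - u) * cauchy_kernel (t * (u - x))).
Definition stieltjes_im (R : realType) (t u : R) (x : R) : R :=
  t * cauchy_kernel (t * (u - x)).

Definition stieltjes_moments (R : realType)
    (mu : {measure set (measurableTypeR R) -> \bar R}) (t u : R) (i : nat) : R[i] :=
  Complex (weighted_moment mu (stieltjes_re t u) i) (weighted_moment mu (stieltjes_im t u) i).

Section stieltjes.
Context (R : realType) (s : nat -> R) (mu : {measure set (measurableTypeR R) -> \bar R}).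
Context (t u : R).
Hypothesis mus : moment_solution s mu.
Hypothesis t0 : 0 < t.

Let m_ck : measurable_fun setT
  ((fun x => cauchy_kernel (t * (u - x))) : measurableTypeR R -> R).
Proof.
apply: (measurableT_comp (f := @cauchy_kernel R)).
  by apply: continuous_measurable_fun; exact: continuous_cauchy_kernel.
by apply: measurable_funM => //; exact: measurable_funB.
Qed.

Let m_im : measurable_fun setT (stieltjes_im t u : measurableTypeR R -> R).
Proof. exact: measurable_funM. Qed.

Let m_re : measurable_fun setT (stieltjes_re t u : measurableTypeR R -> R).
Proof.
apply: measurable_funM => //; apply: measurable_funM => //.
by apply: measurable_funM => //; exact: measurable_funB.
Qed.

(** [t] is the reciprocal of the imaginary part of the point; [1] and, in [b_re], [|w|] are at most
    [1 + w^2]. *)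
Let b_im x : `|stieltjes_im t u x| <= t.
Proof.
rewrite normrM (gtr0_norm t0) ger_pMr // ger0_norm ?cauchy_kernel_ge0 //.
by rewrite invf_le1 ?cauchy_kernel_den // lerDl sqr_ge0.
Qed.

Let b_re x : `|stieltjes_re t u x| <= t.
Proof.
rewrite normrM (gtr0_norm t0) ger_pMr // normrM (ger0_norm (cauchy_kernel_ge0 _)).
rewrite ler_pdivrMr ?cauchy_kernel_den // mul1r.
have -> : (t * (u - x)) ^+ 2 = `|t * (x - u)| ^+ 2 by rewrite real_normK ?num_real //; ring.
set a := `|_|; have := sqr_ge0 (a - 1); have : 0 <= a by exact: normr_ge0.
nra.
Qed.

Lemma integrable_stieltjes_im i :
  mu.-integrable setT (EFin \o (fun x : measurableTypeR R => (x : R) ^+ i * stieltjes_im t u x)).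
Proof. exact: integrable_Xn_weight mus m_im b_im. Qed.

(** Integrate [x^(i+1) / (x - l) = x^i + l x^i / (x - l)] for [l = u + i / t], separated into real
    and imaginary parts. *)
Lemma stieltjes_resolvent :
  resolvent_moments (Complex u t^-1) (@ofR R \o s) (stieltjes_moments mu t u).
Proof.
move=> i; pose ck x := cauchy_kernel (t * (u - x)).
(* [(w^2 + 1) * cauchy_kernel w = 1] for [w = t (u - x)]; it produces the summand [x^i] of the real
   part. *)
have ck1 x : t * (x - u) * (t * (x - u)) * ck x + ck x = 1.
  have := cauchy_kernel_den (t * (u - x)); rewrite /ck /cauchy_kernel; set d := 1 + _ => d0.
  have -> : t * (x - u) * (t * (x - u)) = d - 1 by rewrite /d; ring.
  by field; rewrite gt_eqF.
have tn0 : t != 0 by rewrite gt_eqF.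
(* The lists [[:: u; - t^-1; 1]] and [[:: t^-1; u]] below are the rows of multiplication by [l], the
   first one with the power [x^i] added. *)
pose F k := match k with
  | 0%N => fun x : measurableTypeR R => (x : R) ^+ i * stieltjes_re t u x
  | 1%N => fun x : measurableTypeR R => (x : R) ^+ i * stieltjes_im t u x
  | _ => fun x : measurableTypeR R => (x : R) ^+ i
  end.
have iF k : mu.-integrable setT (EFin \o F k).
  case: k => [|[|k]]; last exact: (mus i).1.
    exact: integrable_Xn_weight mus m_re b_re.
  exact: integrable_Xn_weight mus m_im b_im.
have S : \int[mu]_x F 2%N x = s i by rewrite /Rintegral (mus i).2.
apply/eqP; rewrite eq_complex /stieltjes_moments; apply/andP; split; apply/eqP => /=.
  have [_] := Rintegral_lincomb 3 (nth 0 [:: u; - t^-1; 1]) iF.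
  rewrite !big_ord_recr big_ord0 /= S => E.
  have Ex : weighted_moment mu (stieltjes_re t u) i.+1
      = \int[mu]_x \sum_(k < 3) [:: u; - t^-1; 1]`_k * F k x.
    apply: eq_Rintegral => x _.
    rewrite !big_ord_recr big_ord0 /= add0r mul1r exprS.
    rewrite -[X in _ + X](mulr1) -(ck1 (x : R)) /stieltjes_re /stieltjes_im -/(ck x).
    by set X := (x : R) ^+ i; set c := ck x; field.
  rewrite Ex E /weighted_moment; ring.
have [_] := Rintegral_lincomb 2 (nth 0 [:: t^-1; u]) iF.
rewrite !big_ord_recr big_ord0 /= => E.
have Ex : weighted_moment mu (stieltjes_im t u) i.+1
    = \int[mu]_x \sum_(k < 2) [:: t^-1; u]`_k * F k x.
  apply: eq_Rintegral => x _.
  rewrite !big_ord_recr big_ord0 /= add0r exprS /stieltjes_re /stieltjes_im -/(ck x).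
  by set X := (x : R) ^+ i; set c := ck x; field.
rewrite Ex E /weighted_moment; ring.
Qed.

Lemma stieltjes_l2 : s 0%N = 1 -> positive_definite s ->
  forall N, sqsum N (resolvent_coef s (stieltjes_moments mu t u)) <= 2 * t ^+ 2.
Proof.
move=> s0 pd N; have oP := orthopoly_orthonormal pd.
have h1 := weighted_bessel N s0 mus m_re b_re oP.
have h2 := weighted_bessel N s0 mus m_im b_im oP.
rewrite (_ : sqsum _ _ = \sum_(n < N) moment_functional (weighted_moment mu (stieltjes_re t u)) (orthopoly s n) ^+ 2
  + \sum_(n < N) moment_functional (weighted_moment mu (stieltjes_im t u)) (orthopoly s n) ^+ 2).
  by rewrite mulr2n mulrDl mul1r lerD.
rewrite -big_split /=; apply: eq_bigr => n _.
by rewrite cmod2E /resolvent_coef moment_functional_complex.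
Qed.
End stieltjes.

Lemma moment_solution_finite (R : realType) (s : nat -> R)
    (mu : {measure set (measurableTypeR R) -> \bar R}) :
  moment_solution s mu -> fin_num_fun mu.
Proof.
move=> mus A mA; have [_] := mus 0%N.
under eq_integral do rewrite expr0.
rewrite integral_cst // mul1e => muT.
rewrite ge0_fin_numE //; apply: le_lt_trans (_ : mu setT < +oo)%E.
  by apply: le_measure => //; rewrite inE.
by rewrite muT ltry.
Qed.

(** Moment solutions are given as plain measures while the inversion is stated for finite ones; the
    richer structure is rebuilt on the same function. *)
Lemma finite_measure_pack (d : measure_display) (T : measurableType d) (R : realType)
    (mu : {measure set T -> \bar R}) : fin_num_fun mu ->
  exists m : {finite_measure set T -> \bar R}, (m : {measure set T -> \bar R}) = mu.
Proof.
move=> fin.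
have sf : sigma_finite setT mu by apply: fin_num_fun_sigma_finite; rewrite ?measure0.
pose H1 := isFinite.Build _ _ _ _ fin.
pose H2 := isSFinite.Build _ _ _ _ (sfinite_measure_sigma_finite sf).
pose H3 := isSigmaFinite.Build _ _ _ _ sf.
exists (HB.pack_for (FiniteMeasure.type T R) (Measure.sort mu) H1 H2 H3).
exact: eq_measure.
Qed.

Lemma indeterminate_l2 (R : realType) (s : nat -> R) :
  s 0%N = 1 -> positive_definite s -> indeterminate s ->
  exists l m, [/\ resolvent_moments l (@ofR R \o s) m, l2 (orthopoly_vec s l) &
    l2 (resolvent_coef s m)].
Proof.
move=> s0 pd [mu [nu [mus nus [A [mA Amn]]]]].
have [fmu Emu] := finite_measure_pack (moment_solution_finite mus).
have [fnu Enu] := finite_measure_pack (moment_solution_finite nus).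
subst mu nu.
(* If all Poisson integrals agreed, the two solutions would agree on every measurable set. *)
have [t [u [t0 tu]]] : exists t u : R, 0 < t /\
    weighted_moment fmu (stieltjes_im t u) 0 != weighted_moment fnu (stieltjes_im t u) 0.
  apply: contrapT => H; apply: Amn.
  apply: (@poisson_determines R fmu fnu) => // t u t0.
  have E : weighted_moment fmu (stieltjes_im t u) 0 = weighted_moment fnu (stieltjes_im t u) 0.
    by apply/eqP/negPn/negP => h; apply: H; exists t, u.
  have i1 := integrable_stieltjes_im u mus t0 0.
  have i2 := integrable_stieltjes_im u nus t0 0.
  have K (m : {measure set (measurableTypeR R) -> \bar R}) :
    m.-integrable setT (EFin \o (fun x : measurableTypeR R => (x : R) ^+ 0 * stieltjes_im t u x)) ->
    (\int[m]_x (t * cauchy_kernel (t * (u - x)))%:E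
      = (weighted_moment m (stieltjes_im t u) 0)%:E)%E.
    move=> im; rewrite /weighted_moment /Rintegral fineK; last exact: integrable_fin_num im.
    by apply: eq_integral => x _; rewrite expr0 mul1r.
  by rewrite (K _ i1) (K _ i2) E.
exists (Complex u t^-1), (stieltjes_moments fmu t u).
have r1 := stieltjes_resolvent u mus t0; have r2 := stieltjes_resolvent u nus t0.
have b1 := stieltjes_l2 u mus t0 s0 pd; have b2 := stieltjes_l2 u nus t0 s0 pd.
split=> //; last by apply/l2P; exists (2 * t ^+ 2).
set d := stieltjes_moments fmu t u 0%N - stieltjes_moments fnu t u 0%N.
have d0 : 0 < cmod d ^+ 2.
  rewrite exprn_gt0 // cmod_gt0 subr_eq0 eq_complex negb_and /=.
  by rewrite tu orbT.
(* [8 t^2 = 2 (2 t^2) + 2 (2 t^2)]: the Bessel bounds of the two solutions under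
   [|x + y|^2 <= 2 |x|^2 + 2 |y|^2]. *)
apply/l2P; exists (8 * t ^+ 2 / cmod d ^+ 2) => N.
rewrite ler_pdivlMr // (le_trans (resolvent_gap N r1 r2)) // (le_trans (sqsumD _ _ _)) //.
have -> : sqsum N (- resolvent_coef s (stieltjes_moments fnu t u)) =
    sqsum N (resolvent_coef s (stieltjes_moments fnu t u)).
  by apply: eq_bigr => i _; rewrite cmodN.
have := b1 N; have := b2 N; lra.
Qed.

(** * Goursat and Cauchy *)

Definition segint (R : realType) (a b : R) (f : R -> R) : R :=
  \int[lebesgue_measure]_(x in `[a, b]) f x.

(** Continuity is two-sided even at the endpoints, so that it passes to subsegments without
    one-sided limits. *)
Definition seg_cont (R : realType) (a b : R) (f : R -> R) : Prop :=
  forall x, a <= x <= b -> {for x, continuous f}.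

Lemma seg_cont_integrable (R : realType) (a b : R) (f : R -> R) :
  seg_cont a b f -> (@lebesgue_measure R).-integrable `[a, b] (EFin \o f).
Proof.
move=> cf; apply: continuous_compact_integrable; first exact: segment_compact.
apply: continuous_in_subspaceT => x; rewrite inE /= in_itv /= => xab; exact: cf.
Qed.

Lemma seg_contB (R : realType) (a b : R) (f g : R -> R) :
  seg_cont a b f -> seg_cont a b g -> seg_cont a b (fun x => f x - g x).
Proof. by move=> cf cg x xab; apply: cvgB; [exact: cf|exact: cg]. Qed.

Lemma seg_contM (R : realType) (a b : R) (f g : R -> R) :
  seg_cont a b f -> seg_cont a b g -> seg_cont a b (fun x => f x * g x).
Proof. by move=> cf cg x xab; apply: cvgM; [exact: cf|exact: cg]. Qed.

Lemma seg_cont_cst (R : realType) (a b k : R) : seg_cont a b (fun=> k).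
Proof. by move=> x _; exact: cvg_cst. Qed.

Lemma seg_contS (R : realType) (a b a' b' : R) (f : R -> R) :
  a <= a' -> b' <= b -> seg_cont a b f -> seg_cont a' b' f.
Proof.
move=> aa bb cf x /andP[ax xb]; apply: cf.
by rewrite (le_trans aa) //= (le_trans xb).
Qed.

Lemma segintD (R : realType) (a b : R) (f g : R -> R) :
  seg_cont a b f -> seg_cont a b g ->
  segint a b (fun x => f x + g x) = segint a b f + segint a b g.
Proof.
by move=> cf cg; apply: RintegralD => //; exact: seg_cont_integrable.
Qed.

Lemma segintB (R : realType) (a b : R) (f g : R -> R) :
  seg_cont a b f -> seg_cont a b g ->
  segint a b (fun x => f x - g x) = segint a b f - segint a b g.
Proof.
by move=> cf cg; apply: RintegralB => //; exact: seg_cont_integrable.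
Qed.

Lemma segintZ (R : realType) (a b k : R) (f : R -> R) :
  seg_cont a b f -> segint a b (fun x => k * f x) = k * segint a b f.
Proof. by move=> cf; apply: RintegralZl => //; exact: seg_cont_integrable. Qed.

Lemma eq_segint (R : realType) (a b : R) (f g : R -> R) :
  (forall x, a <= x <= b -> f x = g x) -> segint a b f = segint a b g.
Proof.
by move=> fg; apply: eq_Rintegral => x; rewrite inE /= in_itv /=; exact: fg.
Qed.

Lemma segint_cst (R : realType) (a b k : R) : a <= b -> segint a b (fun=> k) = k * (b - a).
Proof.
move=> ab; rewrite /segint Rintegral_cst //; congr (_ * _).
have E : lebesgue_measure `[a, b]%classic = (b - a)%:E; last exact: (congr1 fine E).
by rewrite lebesgue_measure_itv /= lte_fin; case: ltgtP ab => // -> _; rewrite subrr.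
Qed.

Lemma segint_norm_le (R : realType) (a b M : R) (f : R -> R) : a <= b ->
  seg_cont a b f -> (forall x, a <= x <= b -> `|f x| <= M) ->
  `|segint a b f| <= M * (b - a).
Proof.
move=> ab cf fM; have iF := seg_cont_integrable cf.
rewrite -segint_cst //; apply: le_trans (le_normr_Rintegral _ iF) _ => //.
apply: le_Rintegral => //.
- exact: integrable_norm.
- by apply: seg_cont_integrable; exact: seg_cont_cst.
Qed.

Lemma segint_split (R : realType) (a m b : R) (f : R -> R) : a <= m -> m <= b ->
  seg_cont a b f -> segint a b f = segint a m f + segint m b f.
Proof.
move=> am mb cf; rewrite -[LHS](subrK (segint a m f)) addrC; congr (_ + _).
rewrite /segint Rintegral_itvB ?bnd_simp //; last exact: seg_cont_integrable.
rewrite Rintegral_itv_obnd_cbnd //.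
by apply: integrableS (seg_cont_integrable cf) => //; apply: subset_itv; rewrite bnd_simp.
Qed.

Lemma cont_epsP (R : realType) (f : R -> R) (x : R) : {for x, continuous f} <->
  (forall e, 0 < e -> exists2 d, 0 < d & forall h, `|h| < d -> `|f (x + h) - f x| <= e).
Proof.
split.
  move=> /cvgrPdist_le H e e0; have /nbhs_ballP [d /= d0 Hd] := H e e0.
  exists d => // h hd; rewrite distrC; apply: Hd.
  by rewrite /ball /= opprD addrA subrr sub0r normrN.
move=> H; apply/cvgrPdist_le => e e0; have [d d0 Hd] := H e e0.
apply/nbhs_ballP; exists d => // t; rewrite /ball /= distrC => td.
by have := Hd _ td; rewrite [x + _]addrC subrK distrC.
Qed.

Lemma is_derive_epsP (R : realType) (f : R -> R) (x d : R) : is_derive x 1 f d <->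
  (forall e, 0 < e -> exists2 del, 0 < del & forall h, `|h| < del ->
    `|f (x + h) - f x - h * d| <= e * `|h|).
Proof.
have dq (h : R) : h != 0 ->
    `|h^-1 * (f (h * 1 + x) - f x) - d| = `|f (x + h) - f x - h * d| / `|h|.
  by move=> h0; rewrite -normfV -normrM mulr1 (addrC h); congr (`|_|); field.
split.
  move=> [/cvg_ex [l /= Hl] dE] e e0.
  have El : l = d by rewrite -dE /derive; apply/esym/cvg_lim.
  move: Hl; rewrite El => /cvgrPdist_le /(_ e e0) /nbhs_ballP [del /= del0 Hd].
  exists del => // h hd; have [->|h0] := eqVneq h 0.
    by rewrite addr0 subrr mul0r subrr normr0 mulr0.
  have := Hd h; rewrite /ball /= sub0r normrN => /(_ hd h0).
  by rewrite distrC [X in `|X|](_ : _ = h^-1 * (f (h * 1 + x) - f x) - d) // dq // ler_pdivrMr ?normr_gt0.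
move=> H.
have Hl : (fun h : R => h^-1 *: (f (h *: 1 + x) - f x)) @ (0 : R)^' --> d.
  apply/cvgrPdist_le => e e0; have [del del0 Hd] := H e e0.
  apply/nbhs_ballP; exists del => // h; rewrite /ball /= sub0r normrN => hd h0.
  rewrite distrC [X in `|X|](_ : _ = h^-1 * (f (h * 1 + x) - f x) - d) // dq // ler_pdivrMr ?normr_gt0 //.
  exact: Hd.
split; first by apply/cvg_ex; exists d.
exact/cvg_lim.
Qed.

(** * Goursat's theorem for a closed form on a rectangle *)

Definition frechet (R : realType) (f : R -> R -> R) (x y f1 f2 : R) : Prop :=
  forall e, 0 < e -> exists2 d, 0 < d & forall h k, `|h| < d -> `|k| < d ->
    `|f (x + h) (y + k) - f x y - h * f1 - k * f2| <= e * (`|h| + `|k|).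

Lemma frechet_continuous (R : realType) (f : R -> R -> R) (x y f1 f2 : R) :
  frechet f x y f1 f2 -> forall e, 0 < e -> exists2 d, 0 < d &
    forall h k, `|h| < d -> `|k| < d -> `|f (x + h) (y + k) - f x y| <= e.
Proof.
move=> ff e e0; have [d d0 Hd] := ff 1 ltr01.
pose M := 2 + `|f1| + `|f2|.
have M0 : 0 < M by rewrite /M; have := normr_ge0 f1; have := normr_ge0 f2; lra.
exists (Num.min d (e / M)); first by rewrite lt_min d0 divr_gt0.
move=> h k; rewrite !lt_min => /andP[hd he] /andP[kd ke].
have := Hd h k hd kd; rewrite mul1r => H.
have E : f (x + h) (y + k) - f x y
    = (f (x + h) (y + k) - f x y - h * f1 - k * f2) + (h * f1 + k * f2) by ring.
rewrite E (le_trans (ler_normD _ _)) //.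
have h1 : `|h * f1 + k * f2| <= `|h| * `|f1| + `|k| * `|f2|.
  by rewrite -!normrM ler_normD.
rewrite ltr_pdivlMr // in he; rewrite ltr_pdivlMr // in ke.
have := normr_ge0 f1; have := normr_ge0 f2; have := normr_ge0 h; have := normr_ge0 k.
rewrite /M in he ke; nra.
Qed.

Lemma frechet_slice1 (R : realType) (f : R -> R -> R) (x y f1 f2 : R) :
  frechet f x y f1 f2 -> {for x, continuous (fun t => f t y)}.
Proof.
move=> /frechet_continuous H; apply/cont_epsP => e e0; have [d d0 Hd] := H e e0.
by exists d => // h hd; have := Hd h 0 hd; rewrite addr0 normr0; apply.
Qed.

Lemma frechet_slice2 (R : realType) (f : R -> R -> R) (x y f1 f2 : R) :
  frechet f x y f1 f2 -> {for y, continuous (fun t => f x t)}.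
Proof.
move=> /frechet_continuous H; apply/cont_epsP => e e0; have [d d0 Hd] := H e e0.
by exists d => // h hd; have := Hd 0 h; rewrite addr0 normr0; apply.
Qed.

(** The integral of [p dx + q dy] along the boundary, counterclockwise, with opposite sides gathered
    under one integral. *)
Definition rect_int (R : realType) (p q : R -> R -> R) (a b c d : R) : R :=
  segint a b (fun x => p x c - p x d) + segint c d (fun y => q b y - q a y).

(* [p dx + q dy] is closed, without any continuity of the partial derivatives. *)
Definition closed_on (R : realType) (p q : R -> R -> R) (a b c d : R) : Prop :=
  forall x y, a <= x <= b -> c <= y <= d ->
    exists p1 p2 q2, frechet p x y p1 p2 /\ frechet q x y p2 q2.

Lemma closed_onS (R : realType) (p q : R -> R -> R) (a b c d a' b' c' d' : R) :
  a <= a' -> b' <= b -> c <= c' -> d' <= d ->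
  closed_on p q a b c d -> closed_on p q a' b' c' d'.
Proof.
move=> aa bb cc dd H x y /andP[ax xb] /andP[cy yd]; apply: H.
  by rewrite (le_trans aa) //= (le_trans xb).
by rewrite (le_trans cc) //= (le_trans yd).
Qed.

Section rectangle.
Context (R : realType) (p q : R -> R -> R).

Lemma closed_on_cont1 (a b c d y : R) : closed_on p q a b c d -> c <= y <= d ->
  seg_cont a b (fun x => p x y).
Proof.
move=> H cyd x axb; have [p1 [p2 [q2 [fp _]]]] := H x y axb cyd; exact: frechet_slice1 fp.
Qed.

Lemma closed_on_cont2 (a b c d x : R) : closed_on p q a b c d -> a <= x <= b ->
  seg_cont c d (fun y => q x y).
Proof.
move=> H axb y cyd; have [p1 [p2 [q2 [_ fq]]]] := H x y axb cyd; exact: frechet_slice2 fq.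
Qed.

Lemma rect_int_splitx (a m b c d : R) : a <= m -> m <= b -> c <= d ->
  closed_on p q a b c d ->
  rect_int p q a b c d = rect_int p q a m c d + rect_int p q m b c d.
Proof.
move=> am mb cd H; have ab := le_trans am mb.
have k1 y : c <= y <= d -> seg_cont a b (fun x => p x y) by exact: closed_on_cont1 H.
have k2 x : a <= x <= b -> seg_cont c d (fun y => q x y) by exact: closed_on_cont2 H.
rewrite /rect_int (segint_split am mb); last by apply: seg_contB; apply: k1; rewrite ?lexx ?cd.
rewrite !segintB; try by apply: k2; rewrite ?lexx ?am ?mb ?ab.
ring.
all: by apply: seg_contS (k1 _ _) => //; rewrite ?lexx ?cd.
Qed.

Lemma rect_int_splity (a b c n d : R) : a <= b -> c <= n -> n <= d ->
  closed_on p q a b c d ->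
  rect_int p q a b c d = rect_int p q a b c n + rect_int p q a b n d.
Proof.
move=> ab cn nd H; have cd := le_trans cn nd.
have k1 y : c <= y <= d -> seg_cont a b (fun x => p x y) by exact: closed_on_cont1 H.
have k2 x : a <= x <= b -> seg_cont c d (fun y => q x y) by exact: closed_on_cont2 H.
rewrite /rect_int (segint_split cn nd); last by apply: seg_contB; apply: k2; rewrite ?lexx ?ab.
rewrite !segintB; try by apply: k1; rewrite ?lexx ?cn ?nd ?cd.
ring.
all: by apply: seg_contS (k2 _ _) => //; rewrite ?lexx ?ab.
Qed.

Lemma max_half (x y z : R) : x = y + z -> `|x| <= 2 * `|y| \/ `|x| <= 2 * `|z|.
Proof.
move=> ->; have := ler_normD y z; case: (leP `|z| `|y|) => h; [left|right]; lra.
Qed.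

(** The half with the larger integral is kept. Halving in [x] and then in [y] has the effect of the
    usual division into four rectangles. *)
Lemma rect_halfx (a b c d : R) : a <= b -> c <= d -> closed_on p q a b c d ->
  exists a' b', [/\ a <= a', a' <= b', b' <= b, b' - a' = (b - a) / 2 &
    `|rect_int p q a b c d| <= 2 * `|rect_int p q a' b' c d|].
Proof.
move=> ab cd H; pose m := (a + b) / 2.
have am : a <= m by rewrite /m; lra.
have mb : m <= b by rewrite /m; lra.
case: (max_half (rect_int_splitx am mb cd H)) => h.
  by exists a, m; split => //; rewrite /m; lra.
by exists m, b; split => //; rewrite /m; lra.
Qed.

Lemma rect_halfy (a b c d : R) : a <= b -> c <= d -> closed_on p q a b c d ->
  exists c' d', [/\ c <= c', c' <= d', d' <= d, d' - c' = (d - c) / 2 &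
    `|rect_int p q a b c d| <= 2 * `|rect_int p q a b c' d'|].
Proof.
move=> ab cd H; pose m := (c + d) / 2.
have cm : c <= m by rewrite /m; lra.
have md : m <= d by rewrite /m; lra.
case: (max_half (rect_int_splity ab cm md H)) => h.
  by exists c, m; split => //; rewrite /m; lra.
by exists m, d; split => //; rewrite /m; lra.
Qed.

(** Replace [p] and [q] by their linear approximations at [(x, y)]: the [p2] contributions of the
    two pairs of sides cancel, which is where closedness enters, and the integrand errs by at most
    [e * (w + t)] on each side. *)
Lemma rect_int_local (x y p1 p2 q2 : R) :
  frechet p x y p1 p2 -> frechet q x y p2 q2 ->
  forall e, 0 < e -> exists2 del, 0 < del & forall a b c d,
    a <= x <= b -> c <= y <= d -> b - a < del -> d - c < del ->
    closed_on p q a b c d ->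
    `|rect_int p q a b c d| <= 2 * e * ((b - a) + (d - c)) ^+ 2.
Proof.
move=> fp fq e e0; have [d1 d10 H1] := fp e e0; have [d2 d20 H2] := fq e e0.
exists (Num.min d1 d2); first by rewrite lt_min d10.
move=> a b c d /andP[ax xb] /andP[cy yd]; rewrite !lt_min => /andP[w1 w2] /andP[h1 h2] H.
have ab := le_trans ax xb; have cd := le_trans cy yd.
have k1 y' : c <= y' <= d -> seg_cont a b (fun x => p x y') by exact: closed_on_cont1 H.
have k2 x' : a <= x' <= b -> seg_cont c d (fun y => q x' y) by exact: closed_on_cont2 H.
set w := b - a in w1 w2 *; set t := d - c in h1 h2 *.
have nx x' : a <= x' <= b -> `|x' - x| <= w.
  by move=> /andP[u v]; rewrite ler_norml /w; apply/andP; split; lra.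
have ny y' : c <= y' <= d -> `|y' - y| <= t.
  by move=> /andP[u v]; rewrite ler_norml /t; apply/andP; split; lra.
have w0 : 0 <= w by rewrite /w subr_ge0.
have t0 : 0 <= t by rewrite /t subr_ge0.
have rp x' y' : a <= x' <= b -> c <= y' <= d ->
    `|p x' y' - p x y - (x' - x) * p1 - (y' - y) * p2| <= e * (w + t).
  move=> hx hy; have := H1 (x' - x) (y' - y).
  rewrite [x + _]addrC [y + _]addrC !subrK => h; apply: (le_trans (h _ _)).
  - exact: le_lt_trans (nx _ hx) w1.
  - exact: le_lt_trans (ny _ hy) h1.
  - by rewrite ler_wpM2l ?(ltW e0) // lerD ?nx ?ny.
have rq x' y' : a <= x' <= b -> c <= y' <= d ->
    `|q x' y' - q x y - (x' - x) * p2 - (y' - y) * q2| <= e * (w + t).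
  move=> hx hy; have := H2 (x' - x) (y' - y).
  rewrite [x + _]addrC [y + _]addrC !subrK => h; apply: (le_trans (h _ _)).
  - exact: le_lt_trans (nx _ hx) w2.
  - exact: le_lt_trans (ny _ hy) h2.
  - by rewrite ler_wpM2l ?(ltW e0) // lerD ?nx ?ny.
have ca : c <= c <= d by rewrite lexx.
have cb : c <= d <= d by rewrite lexx andbT.
have aa : a <= a <= b by rewrite lexx.
have bb : a <= b <= b by rewrite lexx andbT.
have i1 : `|segint a b (fun x => p x c - p x d) - (- (t * p2)) * w| <= 2 * (e * (w + t)) * w.
  rewrite -(segint_cst _ ab) -segintB; [|by apply: seg_contB; exact: k1|exact: seg_cont_cst].
  apply: segint_norm_le => //.
    by apply: seg_contB; [apply: seg_contB; exact: k1|exact: seg_cont_cst].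
  move=> x' hx; rewrite (_ : _ - _ = (p x' c - p x y - (x' - x) * p1 - (c - y) * p2)
     - (p x' d - p x y - (x' - x) * p1 - (d - y) * p2)); last by rewrite /t; ring.
  by rewrite (le_trans (ler_normB _ _)) // (le_trans (lerD (rp _ _ hx ca) (rp _ _ hx cb))) //; lra.
have i2 : `|segint c d (fun y => q b y - q a y) - (w * p2) * t| <= 2 * (e * (w + t)) * t.
  rewrite -(segint_cst _ cd) -segintB; [|by apply: seg_contB; exact: k2|exact: seg_cont_cst].
  apply: segint_norm_le => //.
    by apply: seg_contB; [apply: seg_contB; exact: k2|exact: seg_cont_cst].
  move=> y' hy; rewrite (_ : _ - _ = (q b y' - q x y - (b - x) * p2 - (y' - y) * q2)
     - (q a y' - q x y - (a - x) * p2 - (y' - y) * q2)); last by rewrite /w; ring.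
  by rewrite (le_trans (ler_normB _ _)) // (le_trans (lerD (rq _ _ bb hy) (rq _ _ aa hy))) //; lra.
rewrite /rect_int; set A := segint _ _ _ in i1 *; set B := segint _ _ _ in i2 *.
rewrite (_ : A + B = (A - (- (t * p2)) * w) + (B - (w * p2) * t)); last by ring.
rewrite (le_trans (ler_normD _ _)) // (le_trans (lerD i1 i2)) //.
by rewrite le_eqVlt; apply/orP; left; apply/eqP; ring.
Qed.

Let quarter (r r' : R * R * (R * R)) : Prop :=
  [/\ [/\ r.1.1 <= r'.1.1, r'.1.1 <= r'.1.2 & r'.1.2 <= r.1.2],
      [/\ r.2.1 <= r'.2.1, r'.2.1 <= r'.2.2 & r'.2.2 <= r.2.2],
      r'.1.2 - r'.1.1 = (r.1.2 - r.1.1) / 2, r'.2.2 - r'.2.1 = (r.2.2 - r.2.1) / 2 &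
      `|rect_int p q r.1.1 r.1.2 r.2.1 r.2.2|
        <= 4 * `|rect_int p q r'.1.1 r'.1.2 r'.2.1 r'.2.2|].

Let halving_lim (l u : nat -> R) :
  (forall n, [/\ l n <= l n.+1, l n <= u n & u n.+1 <= u n]) ->
  exists x, forall n, l n <= x <= u n.
Proof.
move=> H.
have ndl : nondecreasing_seq l by apply/nondecreasing_seqP => n; have [] := H n.
have niu : nonincreasing_seq u by apply/nonincreasing_seqP => n; have [] := H n.
have lu k n : l k <= u n.
  case: (leqP k n) => kn; first by rewrite (le_trans (ndl _ _ kn)) //; have [] := H n.
  by rewrite (le_trans _ (niu _ _ (ltnW kn))) //; have [] := H k.
have cl : cvgn l by apply: nondecreasing_is_cvgn => //; exists (u 0%N) => _ [k _ <-].
exists (limn l) => n; rewrite nondecreasing_cvgn_le //=.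
by apply: limr_le => //; apply: nearW.
Qed.

Theorem goursat (a b c d : R) : a <= b -> c <= d -> closed_on p q a b c d ->
  rect_int p q a b c d = 0.
Proof.
move=> ab cd H.
pose inv (r : R * R * (R * R)) :=
  [/\ a <= r.1.1, r.1.1 <= r.1.2, r.1.2 <= b, c <= r.2.1 & r.2.1 <= r.2.2 /\ r.2.2 <= d].
(* [choice] wants a successor for every rectangle; one that violates the invariant is sent to
   itself. *)
have step r : exists r', inv r -> quarter r r'.
  case: r => [[a1 b1] [c1 d1]].
  have [[/= h1 h2 h3 h4 [h5 h6]]|ni] := pselect (inv (a1, b1, (c1, d1))); last first.
    by exists (a1, b1, (c1, d1)) => /ni.
  have H1 := closed_onS h1 h3 h4 h6 H.
  have [a2 [b2 [e1 e2 e3 e4 e5]]] := rect_halfx h2 h5 H1.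
  have H2 := closed_onS e1 e3 (lexx c1) (lexx d1) H1.
  have [c2 [d2 [g1 g2 g3 g4 g5]]] := rect_halfy e2 h5 H2.
  exists (a2, b2, (c2, d2)) => _; split => //=.
  by rewrite (le_trans e5) //; lra.
have [nxt Hn] := choice step.
pose r n := iter n nxt (a, b, (c, d)).
have rinv n : inv (r n).
  elim: n => [|n IH]; first by split.
  have [[k1 k2 k3] [k4 k5 k6] _ _ _] := Hn _ IH; have [h1 h2 h3 h4 [h5 h6]] := IH.
  rewrite /r iterS -/(r n); split => //.
  - exact: le_trans h1 k1.
  - exact: le_trans k3 h3.
  - exact: le_trans h4 k4.
  - by split=> //; exact: le_trans k6 h6.
have rq n : quarter (r n) (r n.+1) by exact: Hn (rinv n).
have [x Hx] : exists x, forall n, (r n).1.1 <= x <= (r n).1.2.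
  apply: halving_lim => n; have [[k1 k2 k3] _ _ _ _] := rq n.
  by have [_ h2 _ _ _] := rinv n; split.
have [y Hy] : exists y, forall n, (r n).2.1 <= y <= (r n).2.2.
  apply: halving_lim => n; have [_ [k1 k2 k3] _ _ _] := rq n.
  by have [_ _ _ _ [h2 _]] := rinv n; split.
have W n : (r n).1.2 - (r n).1.1 = (b - a) / 2 ^+ n.
  elim: n => [|n IH]; first by rewrite expr0 divr1.
  have [_ _ -> _ _] := rq n; rewrite IH exprS; field; exact: expf_neq0.
have T n : (r n).2.2 - (r n).2.1 = (d - c) / 2 ^+ n.
  elim: n => [|n IH]; first by rewrite expr0 divr1.
  have [_ _ _ -> _] := rq n; rewrite IH exprS; field; exact: expf_neq0.
set J := rect_int p q a b c d.
have K n : `|J| <= 4 ^+ n * `|rect_int p q (r n).1.1 (r n).1.2 (r n).2.1 (r n).2.2|.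
  elim: n => [|n IH]; first by rewrite expr0 mul1r.
  apply: (le_trans IH); rewrite exprSr -mulrA ler_wpM2l ?exprn_ge0 //.
  by have [_ _ _ _] := rq n.
have [p1 [p2 [q2 [fp fq]]]] := H x y (Hx 0%N) (Hy 0%N).
(* The factor [4 ^+ n] cancels against the square of the side lengths, which are divided by
   [2 ^+ n]; the resulting bound is free of [n]. *)
have F e : 0 < e -> `|J| <= 2 * e * ((b - a) + (d - c)) ^+ 2.
  move=> e0; have [del del0 L] := rect_int_local fp fq e0.
  have [n Hn'] : exists n : nat, ((b - a) + (d - c)) / del < n%:R.
    by exists (Num.trunc (((b - a) + (d - c)) / del)).+1; apply: truncnS_gt.
  have n2 : (b - a) + (d - c) < del * 2 ^+ n.
    rewrite -ltr_pdivrMl // mulrC (lt_le_trans Hn') // -natrX ler_nat.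
    exact/ltnW/ltn_expl.
  have p2n : 0 < 2 ^+ n :> R by rewrite exprn_gt0.
  have wd : (r n).1.2 - (r n).1.1 < del by rewrite W ltr_pdivrMr //; lra.
  have td : (r n).2.2 - (r n).2.1 < del by rewrite T ltr_pdivrMr //; lra.
  have [h1 h2 h3 h4 [h5 h6]] := rinv n.
  have := L _ _ _ _ (Hx n) (Hy n) wd td (closed_onS h1 h3 h4 h6 H).
  rewrite W T => L'; apply: (le_trans (K n)).
  apply: (@le_trans _ _ (4 ^+ n * (2 * e * ((b - a) / 2 ^+ n + (d - c) / 2 ^+ n) ^+ 2))).
    by rewrite ler_wpM2l // exprn_ge0.
  rewrite -mulrDl expr_div_n -exprM mulnC exprM (_ : 2 ^+ 2 = 4 :> R); last by ring.
  rewrite le_eqVlt; apply/orP; left; apply/eqP; field.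
  exact: expf_neq0.
apply/eqP; rewrite -normr_eq0 eq_le normr_ge0 andbT; apply/negPn/negP; rewrite -ltNge => J0.
set S := ((b - a) + (d - c)) ^+ 2 in F.
have S0 : 0 <= S by exact: sqr_ge0.
have S1 : 0 < 4 * (S + 1) by lra.
(* With this tolerance the bound reads [|J| <= |J| S / (2 (S + 1))], which is less than [|J|]. *)
have := F (`|J| / (4 * (S + 1))) (divr_gt0 J0 S1).
rewrite -mulrA mulrAC mulrA ler_pdivlMr //.
nra.
Qed.
End rectangle.

(** * Calculus of complex functions of two real variables *)

Definition frechetC (R : realType) (F : R -> R -> R[i]) (x y : R) (F1 F2 : R[i]) : Prop :=
  forall e, 0 < e -> exists2 d, 0 < d & forall h k, `|h| < d -> `|k| < d ->
    cmod (F (x + h) (y + k) - F x y - ofR h * F1 - ofR k * F2) <= e * (`|h| + `|k|).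

Lemma Re_increment (R : realType) (u v w z : R[i]) (h k : R) :
  complex.Re (u - v - ofR h * w - ofR k * z)
  = complex.Re u - complex.Re v - h * complex.Re w - k * complex.Re z.
Proof. by case: u v w z => [a b] [a' b'] [c d] [c' d'] /=; rewrite !mul0r !subr0. Qed.

Lemma Im_increment (R : realType) (u v w z : R[i]) (h k : R) :
  complex.Im (u - v - ofR h * w - ofR k * z)
  = complex.Im u - complex.Im v - h * complex.Im w - k * complex.Im z.
Proof. by case: u v w z => [a b] [a' b'] [c d] [c' d'] /=; rewrite !mul0r !addr0. Qed.

Lemma frechetC_Re (R : realType) (F : R -> R -> R[i]) (x y : R) (F1 F2 : R[i]) :
  frechetC F x y F1 F2 ->
  frechet (fun x y => complex.Re (F x y)) x y (complex.Re F1) (complex.Re F2).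
Proof.
move=> H e e0; have [d d0 Hd] := H e e0; exists d => // h k hd kd.
apply: le_trans (Hd h k hd kd); apply: le_trans (cmod_Re _).
by rewrite Re_increment.
Qed.

Lemma frechetC_Im (R : realType) (F : R -> R -> R[i]) (x y : R) (F1 F2 : R[i]) :
  frechetC F x y F1 F2 ->
  frechet (fun x y => complex.Im (F x y)) x y (complex.Im F1) (complex.Im F2).
Proof.
move=> H e e0; have [d d0 Hd] := H e e0; exists d => // h k hd kd.
apply: le_trans (Hd h k hd kd); apply: le_trans (cmod_Im _).
by rewrite Im_increment.
Qed.

Lemma frechetC_ext (R : realType) (F G : R -> R -> R[i]) (x y : R) (F1 F2 : R[i]) :
  (forall x y, F x y = G x y) -> frechetC F x y F1 F2 -> frechetC G x y F1 F2.
Proof.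
move=> FG H e e0; have [d d0 Hd] := H e e0; exists d => // h k hd kd.
by rewrite -!FG Hd.
Qed.

Lemma frechetC_cst (R : realType) (c : R[i]) (x y : R) : frechetC (fun _ _ => c) x y 0 0.
Proof.
move=> e e0; exists 1 => // h k _ _; rewrite subrr !mulr0 !subr0 cmod0.
by rewrite mulr_ge0 ?addr_ge0 // ltW.
Qed.

Lemma frechetC_fst (R : realType) (x y : R) : frechetC (fun t _ => ofR t) x y 1 0.
Proof.
move=> e e0; exists 1 => // h k _ _; rewrite mulr1 mulr0 subr0.
rewrite (_ : _ - _ = 0) ?cmod0 ?mulr_ge0 ?addr_ge0 ?(ltW e0) //.
by rewrite (rmorphD (@ofR R)) /=; ring.
Qed.

Lemma frechetC_snd (R : realType) (a b x : R) (g : R -> R[i]) (y : R) :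
  is_derive y 1 (fun t => complex.Re (g t)) a ->
  is_derive y 1 (fun t => complex.Im (g t)) b ->
  frechetC (fun _ t => g t) x y 0 (Complex a b).
Proof.
move=> /is_derive_epsP H1 /is_derive_epsP H2 e e0.
have e2 : 0 < e / 2 by rewrite divr_gt0.
have [d1 d10 K1] := H1 _ e2; have [d2 d20 K2] := H2 _ e2.
exists (Num.min d1 d2); first by rewrite lt_min d10.
move=> h k _; rewrite lt_min => /andP[k1 k2]; rewrite mulr0 subr0.
apply: (le_trans (cmod_ReIm _)).
have := lerD (K1 k k1) (K2 k k2); case: (g (y + k)) => u v; case: (g y) => u' v' /=.
rewrite !mul0r subr0 addr0 => h'; apply: (le_trans h').
have := normr_ge0 h; nra.
Qed.

Lemma frechetC_D (R : realType) (F G : R -> R -> R[i]) (x y : R) (F1 F2 G1 G2 : R[i]) :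
  frechetC F x y F1 F2 -> frechetC G x y G1 G2 ->
  frechetC (fun x y => F x y + G x y) x y (F1 + G1) (F2 + G2).
Proof.
move=> HF HG e e0; have e2 : 0 < e / 2 by rewrite divr_gt0.
have [d1 d10 K1] := HF _ e2; have [d2 d20 K2] := HG _ e2.
exists (Num.min d1 d2); first by rewrite lt_min d10.
move=> h k; rewrite !lt_min => /andP[h1 h2] /andP[k1 k2].
rewrite (_ : _ - _ = (F (x + h) (y + k) - F x y - ofR h * F1 - ofR k * F2)
  + (G (x + h) (y + k) - G x y - ofR h * G1 - ofR k * G2)); last by ring.
rewrite (le_trans (cmodD _ _)) // (le_trans (lerD (K1 h k h1 k1) (K2 h k h2 k2))) //.
by rewrite -mulrDl -splitr.
Qed.

Lemma frechetC_Z (R : realType) (c : R[i]) (F : R -> R -> R[i]) (x y : R) (F1 F2 : R[i]) :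
  frechetC F x y F1 F2 -> frechetC (fun x y => c * F x y) x y (c * F1) (c * F2).
Proof.
move=> HF e e0; have c1 : 0 < cmod c + 1 by rewrite ltr_wpDl ?cmod_ge0.
have [d d0 K] := HF _ (divr_gt0 e0 c1).
exists d => // h k hd kd.
rewrite (_ : _ - _ = c * (F (x + h) (y + k) - F x y - ofR h * F1 - ofR k * F2)); last by ring.
rewrite cmodM; apply: (@le_trans _ _ ((cmod c + 1) * (e / (cmod c + 1) * (`|h| + `|k|)))).
  by rewrite ler_pM ?cmod_ge0 ?K // lerDl.
by rewrite le_eqVlt; apply/orP; left; apply/eqP; field; rewrite gt_eqF.
Qed.

Lemma frechetC_lip (R : realType) (F : R -> R -> R[i]) (x y : R) (F1 F2 : R[i]) :
  frechetC F x y F1 F2 -> exists M, 0 < M /\ exists2 d, 0 < d & forall h k,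
    `|h| < d -> `|k| < d -> cmod (F (x + h) (y + k) - F x y) <= M * (`|h| + `|k|).
Proof.
move=> H; have [d d0 K] := H 1 ltr01; exists (1 + cmod F1 + cmod F2); split.
  by rewrite -addrA ltr_wpDr // addr_ge0 // cmod_ge0.
exists d => // h k hd kd; have := K h k hd kd.
set A := _ - _ - _; move=> h1.
rewrite (_ : _ - _ = A + (ofR h * F1 + ofR k * F2)); last by rewrite /A; ring.
rewrite (le_trans (cmodD _ _)) //.
have h2 : cmod (ofR h * F1 + ofR k * F2) <= `|h| * cmod F1 + `|k| * cmod F2.
  by rewrite (le_trans (cmodD _ _)) // !cmodM !cmod_ofR.
have := cmod_ge0 F1; have := cmod_ge0 F2; have := normr_ge0 h; have := normr_ge0 k; nra.
Qed.

(** One half of [e] pays for the outer remainder at the increment [eta], the other half for [d]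
    times the inner remainder; the [+ 1] in [cmod d + 1] avoids a division by zero. *)
Lemma frechetC_comp (R : realType) (f : R[i] -> R[i]) (d : R[i]) (F : R -> R -> R[i])
    (x y : R) (F1 F2 : R[i]) :
  frechetC F x y F1 F2 -> cderiv f (F x y) d ->
  frechetC (fun x y => f (F x y)) x y (d * F1) (d * F2).
Proof.
move=> HF Hf e e0.
have [M [M0 [d1 d10 L]]] := frechetC_lip HF.
have [d2 d20 K2] := Hf (e / (2 * M)) (divr_gt0 e0 (mulr_gt0 (ltr0Sn _ 1) M0)).
have c1 : 0 < 2 * (cmod d + 1) by rewrite mulr_gt0 // ltr_wpDl ?cmod_ge0.
have [d3 d30 K3] := HF (e / (2 * (cmod d + 1))) (divr_gt0 e0 c1).
exists (Num.min d1 (Num.min d3 (d2 / (2 * M)))).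
  by rewrite !lt_min d10 d30 divr_gt0 // mulr_gt0.
move=> h k; rewrite !lt_min => /and3P[h1 h3 h2] /and3P[k1 k3 k2].
set eta := F (x + h) (y + k) - F x y.
have eM : cmod eta <= M * (`|h| + `|k|) by exact: L.
have ed : cmod eta < d2.
  rewrite (le_lt_trans eM) //.
  rewrite !ltr_pdivlMr ?mulr_gt0 // in h2 k2; lra.
have := K2 eta ed; rewrite {1}/eta [F x y + _]addrC subrK => h4.
have h5 := K3 h k h3 k3; rewrite -/eta in h5.
rewrite (_ : _ - _ = (f (F (x + h) (y + k)) - f (F x y) - eta * d)
   + d * (eta - ofR h * F1 - ofR k * F2)); last by ring.
rewrite (le_trans (cmodD _ _)) // cmodM.
have hk0 : 0 <= `|h| + `|k| by rewrite addr_ge0.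
have a1 : e / (2 * M) * cmod eta <= e / 2 * (`|h| + `|k|).
  rewrite (_ : e / 2 * _ = e / (2 * M) * (M * (`|h| + `|k|))); last by field; rewrite gt_eqF.
  by rewrite ler_wpM2l // divr_ge0 ?mulr_ge0 ?ltW.
have a2 : cmod d * cmod (eta - ofR h * F1 - ofR k * F2) <= e / 2 * (`|h| + `|k|).
  rewrite (_ : e / 2 * _ = (cmod d + 1) * (e / (2 * (cmod d + 1)) * (`|h| + `|k|))).
    by rewrite ler_pM ?cmod_ge0 // lerDl.
  by field; rewrite gt_eqF // ltr_wpDl ?cmod_ge0.
lra.
Qed.

Lemma cderiv_sqr (R : realType) (z : R[i]) : cderiv (fun z => z * z) z (2 * z).
Proof.
move=> e e0; exists e => // h he.
rewrite (_ : _ - _ = h * h); last by ring.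
by rewrite cmodM ler_wpM2r ?cmod_ge0 // ltW.
Qed.

Lemma cderiv_inv (R : realType) (z : R[i]) : z != 0 -> cderiv (fun z => z^-1) z (- (z ^+ 2)^-1).
Proof.
move=> z0 e e0; have c0 : 0 < cmod z by rewrite cmod_gt0.
exists (Num.min (cmod z / 2) (e * cmod z ^+ 3 / 2)).
  by rewrite lt_min !divr_gt0 // mulr_gt0 // exprn_gt0.
move=> h; rewrite lt_min => /andP[h1 h2].
have zh : cmod z / 2 <= cmod (z + h).
  have := cmodB_le z (- h); rewrite cmodN opprK; lra.
have zh0 : z + h != 0 by rewrite -cmod_gt0 (lt_le_trans _ zh) // divr_gt0.
rewrite (_ : _ - _ = h * (h / (z ^+ 2 * (z + h)))); last by field; rewrite z0 zh0.
rewrite cmodM mulrC ler_wpM2r ?cmod_ge0 // cmodM cmodV cmodM cmodX.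
rewrite ler_pdivrMr ?mulr_gt0 ?exprn_gt0 ?cmod_gt0 //.
have : e * (cmod z ^+ 2 * (cmod z / 2)) <= e * (cmod z ^+ 2 * cmod (z + h)).
  by rewrite ler_wpM2l ?(ltW e0) // ler_wpM2l // exprn_ge0 // cmod_ge0.
rewrite !exprS expr0 in h2 *; lra.
Qed.

(** Polarization, [u v = ((u + v)^2 - (u - v)^2) / 4], reduces the product rule to linearity and the
    chain rule for squaring. *)
Lemma frechetC_M (R : realType) (F G : R -> R -> R[i]) (x y : R) (F1 F2 G1 G2 : R[i]) :
  frechetC F x y F1 F2 -> frechetC G x y G1 G2 ->
  frechetC (fun x y => F x y * G x y) x y (F1 * G x y + F x y * G1) (F2 * G x y + F x y * G2).
Proof.
move=> HF HG.
have HS := frechetC_comp (frechetC_D HF HG) (cderiv_sqr _).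
have HD := frechetC_comp (frechetC_D HF (frechetC_Z (-1) HG)) (cderiv_sqr _).
have H := frechetC_Z (4^-1) (frechetC_D HS (frechetC_Z (-1) HD)).
have E (u v : R[i]) : 4^-1 * ((u + v) * (u + v) + -1 * ((u + -1 * v) * (u + -1 * v))) = u * v.
  by field.
have := frechetC_ext (fun _ _ => E _ _) H.
set A := (X in frechetC _ _ _ X _); set B := (X in frechetC _ _ _ _ X).
have -> : A = F1 * G x y + F x y * G1 by rewrite /A; field.
by have -> : B = F2 * G x y + F x y * G2 by rewrite /B; field.
Qed.

Definition expi (R : realType) (t : R) : R[i] := Complex (cos t) (sin t).

Lemma cmod_expi (R : realType) (t : R) : cmod (expi t) = 1.
Proof. by apply/eqP; rewrite -(eqrXn2 (_ : 0 < 2)%N) ?cmod_ge0 // cmod2E /= cos2Dsin2 expr1n. Qed.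

Lemma frechetC_expi (R : realType) (x y : R) :
  frechetC (fun _ t => expi t) x y 0 ('i%C * expi y).
Proof.
have -> : 'i%C * expi y = Complex (- sin y) (cos y) :> R[i] by rewrite /expi; simpc.
by apply: frechetC_snd.
Qed.

Definition cint (R : realType) (F : R -> R[i]) : R[i] :=
  Complex (segint 0 (2 * pi) (fun t => complex.Re (F t)))
          (segint 0 (2 * pi) (fun t => complex.Im (F t))).

(** The dummy first variable makes the two-variable rules available; the class is closed under the
    operations below and ensures integrability of both parts. *)
Definition angle_diff (R : realType) (F : R -> R[i]) : Prop :=
  forall t, 0 <= t <= 2 * pi -> exists F1 F2, frechetC (fun _ => F) 0 t F1 F2.

Section angle.
Context (R : realType).
Implicit Types F G : R -> R[i].

Lemma twopi_ge0 : 0 <= 2 * pi :> R.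
Proof. by rewrite mulr_ge0 // pi_ge0. Qed.

Lemma angle_diff_Re F : angle_diff F -> seg_cont 0 (2 * pi) (fun t => complex.Re (F t)).
Proof. by move=> H t /H [F1 [F2 /frechetC_Re]]; exact: frechet_slice2. Qed.

Lemma angle_diff_Im F : angle_diff F -> seg_cont 0 (2 * pi) (fun t => complex.Im (F t)).
Proof. by move=> H t /H [F1 [F2 /frechetC_Im]]; exact: frechet_slice2. Qed.

Lemma angle_diff_cst (c : R[i]) : angle_diff (fun=> c).
Proof. by move=> t _; exists 0, 0; exact: frechetC_cst. Qed.

Lemma angle_diffD F G : angle_diff F -> angle_diff G -> angle_diff (fun t => F t + G t).
Proof.
move=> HF HG t ht; have [F1 [F2 hF]] := HF t ht; have [G1 [G2 hG]] := HG t ht.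
by exists (F1 + G1), (F2 + G2); exact: (frechetC_D hF hG).
Qed.

Lemma angle_diffM F G : angle_diff F -> angle_diff G -> angle_diff (fun t => F t * G t).
Proof.
move=> HF HG t ht; have [F1 [F2 hF]] := HF t ht; have [G1 [G2 hG]] := HG t ht.
by eexists; eexists; exact: (frechetC_M hF hG).
Qed.

Lemma angle_diff_comp (f : R[i] -> R[i]) F : angle_diff F ->
  (forall t, 0 <= t <= 2 * pi -> exists d, cderiv f (F t) d) -> angle_diff (fun t => f (F t)).
Proof.
move=> HF Hf t ht; have [F1 [F2 hF]] := HF t ht; have [d hd] := Hf t ht.
by eexists; eexists; exact: (frechetC_comp hF hd).
Qed.

Lemma angle_diffV F : angle_diff F -> (forall t, 0 <= t <= 2 * pi -> F t != 0) ->
  angle_diff (fun t => (F t)^-1).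
Proof.
move=> HF F0; apply: angle_diff_comp => // t ht; eexists; apply: cderiv_inv; exact: F0.
Qed.

Lemma cintD F G : angle_diff F -> angle_diff G ->
  cint (fun t => F t + G t) = cint F + cint G.
Proof.
move=> hF hG; apply/eqP; rewrite eq_complex /=; apply/andP; split; apply/eqP.
  rewrite -segintD; [|exact: angle_diff_Re|exact: angle_diff_Re].
  by apply: eq_segint => t _; rewrite raddfD.
rewrite -segintD; [|exact: angle_diff_Im|exact: angle_diff_Im].
by apply: eq_segint => t _; rewrite raddfD.
Qed.

Lemma cintZ c F : angle_diff F -> cint (fun t => c * F t) = c * cint F.
Proof.
move=> hF; have h1 := angle_diff_Re hF; have h2 := angle_diff_Im hF.
have hc k : seg_cont 0 (2 * pi) (fun=> k : R) by exact: seg_cont_cst.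
apply/eqP; rewrite eq_complex /=; case: c => a b /=; apply/andP; split; apply/eqP.
  rewrite -!segintZ // -segintB; [|exact: seg_contM|exact: seg_contM].
  by apply: eq_segint => t _; case: (F t).
rewrite -!segintZ // -segintD; [|exact: seg_contM|exact: seg_contM].
by apply: eq_segint => t _; case: (F t).
Qed.

Lemma eq_cint F G : (forall t, 0 <= t <= 2 * pi -> F t = G t) -> cint F = cint G.
Proof. by move=> H; congr Complex; apply: eq_segint => t /H ->. Qed.

(** The outer factor 2 comes from estimating the real and the imaginary part separately. *)
Lemma cint_le F (M : R) : angle_diff F -> (forall t, 0 <= t <= 2 * pi -> cmod (F t) <= M) ->
  cmod (cint F) <= 2 * (M * (2 * pi)).
Proof.
move=> hF HM; apply: (le_trans (cmod_ReIm _)) => /=.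
have S (g : R -> R) : seg_cont 0 (2 * pi) g -> (forall t, 0 <= t <= 2 * pi -> `|g t| <= M) ->
    `|segint 0 (2 * pi) g| <= M * (2 * pi).
  by move=> cg Hg; have := segint_norm_le twopi_ge0 cg Hg; rewrite subr0.
have h1 := S _ (angle_diff_Re hF) (fun t ht => le_trans (cmod_Re _) (HM t ht)).
have h2 := S _ (angle_diff_Im hF) (fun t ht => le_trans (cmod_Im _) (HM t ht)).
by rewrite (le_trans (lerD h1 h2)) //; lra.
Qed.

Lemma angle_diff_expi : angle_diff (@expi R).
Proof. by move=> t _; exists 0, ('i%C * expi t); exact: frechetC_expi. Qed.

Lemma expi2pi : expi (2 * pi) = expi 0 :> R[i].
Proof. by rewrite /expi mulr_natl cos2pi sin2pi cos0 sin0. Qed.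

(* Goursat's theorem on a homotopy [tau <= t <= 1] of closed curves. *)
Lemma homotopy_cint (P Q : R -> R -> R[i]) (tau : R) : tau <= 1 ->
  (forall t a, tau <= t <= 1 -> 0 <= a <= 2 * pi ->
    exists P1 D Q2, frechetC P t a P1 D /\ frechetC Q t a D Q2) ->
  (forall t, tau <= t <= 1 -> P t 0 = P t (2 * pi)) ->
  cint (Q 1) = cint (Q tau).
Proof.
move=> t1 H HP.
have E (g : R[i] -> R) :
    closed_on (fun x y => g (P x y)) (fun x y => g (Q x y)) tau 1 0 (2 * pi) ->
    segint 0 (2 * pi) (fun a => g (Q 1 a)) = segint 0 (2 * pi) (fun a => g (Q tau a)).
  move=> cg; have := goursat t1 twopi_ge0 cg; rewrite /rect_int.
  (* The sides [a = 0] and [a = 2 pi] of the parameter rectangle cancel, since the curves are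
     closed. *)
  rewrite (@eq_segint _ tau 1 _ (fun=> 0)); last by move=> t ht; rewrite HP // subrr.
  rewrite segint_cst // mul0r add0r segintB.
  - by move=> /eqP; rewrite subr_eq0 => /eqP.
  - by apply: (closed_on_cont2 cg); rewrite lexx t1.
  - by apply: (closed_on_cont2 cg); rewrite lexx.
congr Complex; apply: E => t a ht ha; have [P1 [D [Q2 [fP fQ]]]] := H t a ht ha.
  by exists (complex.Re P1), (complex.Re D), (complex.Re Q2); split; exact: frechetC_Re.
by exists (complex.Im P1), (complex.Im D), (complex.Im Q2); split; exact: frechetC_Im.
Qed.
End angle.

(** * Cauchy's formula on a circle *)

Section cauchy.
Context (R : realType) (f : R[i] -> R[i]) (z0 : R[i]) (rho : R).
Hypothesis rho0 : 0 < rho.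
Hypothesis Hf : forall z, cmod (z - z0) <= rho -> exists d, cderiv f z d.

Let w (a : R) : R[i] := z0 + ofR rho * expi a.
Let w' (a : R) : R[i] := ofR rho * ('i%C * expi a).

Let frechet_w x a : frechetC (fun _ b => w b) x a 0 (w' a).
Proof.
have := frechetC_D (frechetC_cst z0 x a) (frechetC_Z (ofR rho) (frechetC_expi x a)).
by rewrite mulr0 !add0r.
Qed.

Let frechet_w' x a : frechetC (fun _ b => w' b) x a 0 ('i%C * w' a).
Proof.
have := frechetC_Z (ofR rho) (frechetC_Z 'i%C (frechetC_expi x a)).
by rewrite !mulr0 [X in frechetC _ _ _ _ X](_ : _ = 'i%C * w' a) // /w' mulrCA.
Qed.

Let w_2pi : w 0 = w (2 * pi). Proof. by rewrite /w expi2pi. Qed.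

Let cmod_w a : cmod (w a - z0) = rho.
Proof. by rewrite /w addrC addrA addNr add0r cmodM cmod_expi mulr1 cmod_ofR gtr0_norm. Qed.

Let cmod_wz z a : rho - cmod (z - z0) <= cmod (w a - z).
Proof.
rewrite -(cmod_w a) (_ : w a - z = (w a - z0) - (z - z0)); last by ring.
exact: cmodB_le.
Qed.

Let wz_neq0 z a : cmod (z - z0) < rho -> w a - z != 0.
Proof. by move=> hz; rewrite -cmod_gt0 (lt_le_trans _ (cmod_wz z a)) // subr_gt0. Qed.

Let angle_w : angle_diff w. Proof. by move=> t _; exists 0, (w' t). Qed.
Let angle_w' : angle_diff w'. Proof. by move=> t _; exists 0, ('i%C * w' t). Qed.

Let angle_wz z : angle_diff (fun a => w a - z).
Proof. by apply: angle_diffD; [exact: angle_w|exact: angle_diff_cst]. Qed.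

(** [eta] moves from [w a - z0] at [t = 0] to [w a - z] at [t = 1] without vanishing, and
    [d eta / eta] is the closed form [P dt + Q da] of the homotopy. At [t = 0] the integrand is the
    constant [i]. *)
Lemma winding z : cmod (z - z0) < rho ->
  cint (fun a => w' a * (w a - z)^-1) = 'i%C * ofR (2 * pi).
Proof.
move=> hz; pose eta (t a : R) := w a + - z0 + ofR t * (z0 - z).
have eta0 t a : 0 <= t <= 1 -> eta t a != 0.
  move=> /andP[t0 t1]; rewrite -cmod_gt0.
  have := cmodB_le (w a - z0) (ofR t * (z - z0)); rewrite cmod_w cmodM cmod_ofR ger0_norm //.
  rewrite (_ : _ - _ - _ = eta t a); last by rewrite /eta; ring.
  apply: lt_le_trans; rewrite subr_gt0 (le_lt_trans _ hz) // ler_piMl ?cmod_ge0 //.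
have := @homotopy_cint R (fun t a => (z0 - z) * (eta t a)^-1) (fun t a => w' a * (eta t a)^-1) 0.
move=> /(_ ler01) K.
rewrite (@eq_cint _ _ (fun a => w' a * (eta 1 a)^-1)); last first.
  by move=> a _; congr (_ * _^-1); rewrite /eta (rmorph1 (@ofR R)); ring.
rewrite K.
- rewrite (@eq_cint _ _ (fun=> 'i%C)); last first.
    move=> a _; have := eta0 0 a; rewrite lexx ler01 => /(_ isT).
    rewrite /eta (rmorph0 (@ofR R)) mul0r addr0 => h.
    by rewrite /w' mulrCA (_ : ofR rho * expi a = w a + - z0) ?mulfK // /w; ring.
  rewrite /cint /= !segint_cst ?twopi_ge0 // mul0r mul1r subr0 /ofR.
  by simpc.
- move=> t a ht ha.
  have fe : frechetC eta t a (z0 - z) (w' a).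
    have := frechetC_D (frechetC_D (frechet_w t a) (frechetC_cst (- z0) t a))
      (frechetC_M (frechetC_fst t a) (frechetC_cst (z0 - z) t a)).
    by rewrite !mulr0 !addr0 mul0r addr0 mul1r add0r.
  have fi := frechetC_comp fe (cderiv_inv (eta0 t a ht)).
  exists ((z0 - z) * (- (eta t a ^+ 2)^-1 * (z0 - z))),
    ((z0 - z) * (- (eta t a ^+ 2)^-1 * w' a)).
  eexists; split; first exact: (frechetC_Z _ fi).
  have := frechetC_M (frechet_w' t a) fi.
  rewrite mul0r add0r (_ : w' a * _ = (z0 - z) * (- (eta t a ^+ 2)^-1 * w' a)); last by ring.
  exact.
- by move=> t _; rewrite /eta w_2pi.
Qed.

(** The circle is contracted to [z] along [zeta]; the form [(f zeta - f z) d zeta / (zeta - z)]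
    pulls back to [P dt + Q da]. Since [P] contains [1 / t], the contraction stops at some
    [tau > 0], where continuity of [f] at [z] makes the integral small. *)
Let cint_slope z : cmod (z - z0) < rho ->
  cint (fun a => (f (w a) - f z) * (w' a * (w a - z)^-1)) = 0.
Proof.
move=> hz; pose zeta (t a : R) := z + ofR t * (w a + - z).
set m := rho - cmod (z - z0); have m0 : 0 < m by rewrite /m subr_gt0.
have zeta_in t a : 0 <= t <= 1 -> cmod (zeta t a - z0) <= rho.
  move=> /andP[t0 t1].
  rewrite (_ : _ - _ = ofR (1 - t) * (z - z0) + ofR t * (w a - z0)); last first.
    by rewrite (rmorphB (@ofR R)) (rmorph1 (@ofR R)) /zeta; ring.
  rewrite (le_trans (cmodD _ _)) // !cmodM cmod_w !cmod_ofR !ger0_norm ?subr_ge0 //.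
  have : (1 - t) * cmod (z - z0) <= (1 - t) * rho by rewrite ler_wpM2l ?subr_ge0 // ltW.
  lra.
pose P (t a : R) := (f (zeta t a) + - f z) * (ofR t)^-1.
pose Q (t a : R) := (f (zeta t a) + - f z) * (w' a * (w a + - z)^-1).
have EQ tau : 0 < tau -> tau <= 1 -> cint (Q 1) = cint (Q tau).
  move=> t0 t1; apply: (@homotopy_cint R P Q tau t1) => [t a /andP[h1 h2] ha|t _]; last first.
    by rewrite /P /zeta w_2pi.
  have tp : 0 < t := lt_le_trans t0 h1.
  have tn : ofR t != 0 by apply/eqP => /ofR_inj E; rewrite E ltxx in tp.
  have wz := wz_neq0 a hz.
  have fwz := frechetC_D (frechet_w t a) (frechetC_cst (- z) t a).
  have fz := frechetC_D (frechetC_cst z t a) (frechetC_M (frechetC_fst t a) fwz).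
  have [d hd] : exists d, cderiv f (zeta t a) d.
    by apply: Hf; apply: zeta_in; rewrite h2 ltW.
  have ff := frechetC_D (frechetC_comp fz hd) (frechetC_cst (- f z) t a).
  have fP := frechetC_M ff (frechetC_comp (frechetC_fst t a) (cderiv_inv tn)).
  have fQ := frechetC_M ff (frechetC_M (frechet_w' t a) (frechetC_comp fwz (cderiv_inv wz))).
  eexists; exists (d * w' a); eexists; split.
    move: fP; set A := (X in frechetC _ _ _ _ X).
    have -> : A = d * w' a by rewrite /A; field.
    exact.
  move: fQ; set A := (X in frechetC _ _ _ X _).
  have -> : A = d * w' a by rewrite /A; field.
  exact.
have wwz a : cmod (w' a * (w a + - z)^-1) <= rho / m.
  rewrite cmodM /w' cmodM cmodM cmod_expi cmod_ofR (gtr0_norm rho0) cmodV.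
  rewrite (_ : cmod 'i%C = 1) ?mulr1; last by rewrite /cmod /= expr0n add0r expr1n sqrtr1.
  by rewrite ler_wpM2l ?(ltW rho0) // lef_pV2 ?posrE ?cmod_gt0 ?wz_neq0 // cmod_wz.
have adQ : forall tau, 0 <= tau <= 1 -> angle_diff (Q tau).
  move=> tau ht; apply: angle_diffM; last first.
    by apply: angle_diffM => //; apply: angle_diffV => // a _; exact: wz_neq0.
  apply: angle_diffD; last exact: angle_diff_cst.
  apply: angle_diff_comp => [|a _]; last by apply: Hf; exact: zeta_in.
  apply: angle_diffD; first exact: angle_diff_cst.
  by apply: angle_diffM; [exact: angle_diff_cst|exact: angle_wz].
rewrite (@eq_cint _ _ (Q 1)); last first.
  by move=> a _; rewrite /Q /zeta (rmorph1 (@ofR R)) mul1r [z + _]addrC subrK.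
apply/eqP; rewrite -cmod_eq0 eq_le cmod_ge0 andbT; apply/ler_addgt0Pr => e e0; rewrite add0r.
have pi0 := pi_gt0 R.
(* [|Q tau|] is at most [e / K * (rho / m)] and [cint_le] multiplies this by [4 pi]; the outcome is
   exactly [e]. *)
pose K : R := rho / m * (4 * pi).
have K0 : 0 < K by rewrite /K !mulr_gt0 // invr_gt0.
have [d hd] : exists d, cderiv f z d by apply: Hf; exact: ltW.
have [del del0 Hd] : exists2 del, 0 < del & forall h, cmod h < del -> cmod (f (z + h) - f z) <= e / K.
  have [del del0 Hd] := hd 1 ltr01.
  have eK : 0 < e / K by rewrite divr_gt0.
  have d1 : 0 < 1 + cmod d by rewrite ltr_wpDr // cmod_ge0.
  exists (Num.min del (e / K / (1 + cmod d))); first by rewrite lt_min del0 divr_gt0.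
  move=> h; rewrite lt_min ltr_pdivlMr // => /andP[h1 h2].
  rewrite (_ : _ - _ = (f (z + h) - f z - h * d) + h * d); last by ring.
  rewrite (le_trans (cmodD _ _)) // (le_trans _ (ltW h2)) // mulrDr mulr1 lerD ?cmodM //.
  by have := Hd h h1; rewrite mul1r.
(* As [|w a - z| <= 2 rho], the contracted curve stays within [del / 2] of [z]. *)
pose tau : R := Num.min 1 (del / (4 * rho)).
have tau0 : 0 < tau by rewrite lt_min ltr01 divr_gt0 // mulr_gt0.
have tau1 : tau <= 1 by rewrite ge_min lexx.
rewrite (EQ tau tau0 tau1).
have := @cint_le R (Q tau) (e / K * (rho / m)) (adQ tau _).
rewrite (ltW tau0) tau1 => /(_ isT) H.
have EKg (u v : R) : u != 0 -> v != 0 -> 2 * (e / (u * (4 * v)) * u * (2 * v)) = e.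
  by move=> u0 v0; field; rewrite u0 v0.
have EK : 2 * (e / K * (rho / m) * (2 * pi)) = e.
  by apply: EKg; rewrite gt_eqF // divr_gt0.
rewrite -[leRHS]EK; apply: H => a _; rewrite /Q cmodM ler_pM ?cmod_ge0 //; apply: Hd.
rewrite cmodM cmod_ofR (gtr0_norm tau0).
have wz2 : cmod (w a + - z) <= 2 * rho.
  rewrite (_ : _ + _ = (w a - z0) + (z0 - z)); last by ring.
  by rewrite (le_trans (cmodD _ _)) // cmod_w (cmodC z0); lra.
have : tau <= del / (4 * rho) by rewrite ge_min lexx orbT.
rewrite ler_pdivlMr ?mulr_gt0 // => h; have := cmod_ge0 (w a + - z).
have : tau * cmod (w a + - z) <= tau * (2 * rho) by rewrite ler_wpM2l // ltW.
lra.
Qed.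

Theorem cauchy_formula z : cmod (z - z0) < rho ->
  cint (fun a => f (w a) * (w' a * (w a - z)^-1)) = 'i%C * ofR (2 * pi) * f z.
Proof.
move=> hz; rewrite -(@winding z) // mulrC -cintZ; last first.
  by apply: angle_diffM => //; apply: angle_diffV => // a _; exact: wz_neq0.
rewrite -[RHS]add0r -(cint_slope hz) -cintD.
- by apply: eq_cint => a _; ring.
- apply: angle_diffM; last by apply: angle_diffM => //; apply: angle_diffV => // a _; exact: wz_neq0.
  apply: angle_diffD; last exact: angle_diff_cst.
  by apply: angle_diff_comp => // a _; apply: Hf; rewrite cmod_w.
- apply: angle_diffM; first exact: angle_diff_cst.
  by apply: angle_diffM => //; apply: angle_diffV => // a _; exact: wz_neq0.
Qed.
End cauchy.

Lemma cmod_nat (R : realType) (n : nat) : cmod (n%:R : R[i]) = n%:R.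
Proof. by rewrite -(rmorph_nat (@ofR R)) cmod_ofR ger0_norm. Qed.

Lemma seg_cont_bounded (R : realType) (a b : R) (g : R -> R) : a <= b -> seg_cont a b g ->
  exists M, forall x, a <= x <= b -> `|g x| <= M.
Proof.
move=> ab cg.
have [|c _ Hc] := @EVT_max R (fun x => `|g x|) a b ab.
  apply: continuous_in_subspaceT => x; rewrite inE /= in_itv /= => xab.
  by apply: cvg_norm; exact: cg.
by exists `|g c| => x xab; apply: Hc; rewrite in_itv.
Qed.

Lemma angle_diff_bounded (R : realType) (F : R -> R[i]) : angle_diff F ->
  exists M, forall t, 0 <= t <= 2 * pi -> cmod (F t) <= M.
Proof.
move=> hF; have [M1 H1] := seg_cont_bounded (twopi_ge0 R) (angle_diff_Re hF).
have [M2 H2] := seg_cont_bounded (twopi_ge0 R) (angle_diff_Im hF).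
exists (M1 + M2) => t ht; rewrite (le_trans (cmod_ReIm _)) // lerD ?H1 ?H2 //.
Qed.

(** Differentiation under the integral sign, made elementary by a remainder that is quadratic in [h]
    uniformly in the angle. *)
Lemma cderiv_cint (R : realType) (Phi : R -> R[i]) (k k' : R[i] -> R -> R[i]) (z : R[i])
    (C r : R) : 0 < r ->
  angle_diff Phi -> angle_diff (k' z) ->
  (forall h, cmod h < r -> angle_diff (k (z + h))) ->
  (forall h a, 0 <= a <= 2 * pi -> cmod h < r ->
    cmod (k (z + h) a - k z a - h * k' z a) <= C * cmod h ^+ 2) ->
  cderiv (fun z => cint (fun a => Phi a * k z a)) z (cint (fun a => Phi a * k' z a)).
Proof.
move=> r0 aP ak' ak H e e0; have [M HM] := angle_diff_bounded aP.
pose K : R := 4 * pi * (`|M| * `|C|) + 1.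
have K0 : 0 < K by rewrite ltr_wpDl // !mulr_ge0 // pi_ge0.
exists (Num.min r (e / K)); first by rewrite lt_min r0 divr_gt0.
move=> h; rewrite lt_min ltr_pdivlMr // => /andP[hr he].
have ak0 : angle_diff (k z) by rewrite -[z]addr0; apply: ak; rewrite cmod0.
have ad1 := angle_diffM aP (ak h hr); have ad2 := angle_diffM aP ak0.
have ad3 := angle_diffM aP ak'.
have cst c : angle_diff (fun=> c) := @angle_diff_cst R c.
rewrite (_ : _ - _ = cint (fun a => Phi a * (k (z + h) a - k z a - h * k' z a))); last first.
  rewrite [RHS](@eq_cint _ _ (fun a => Phi a * k (z + h) a +
     (-1 * (Phi a * k z a) + - h * (Phi a * k' z a)))); last by move=> a _; ring.
  rewrite cintD //; last by apply: angle_diffD; exact: angle_diffM.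
  rewrite cintD; [|exact: angle_diffM|exact: angle_diffM].
  by rewrite !cintZ // mulN1r mulNr addrA.
have ad : angle_diff (fun a => Phi a * (k (z + h) a - k z a - h * k' z a)).
  apply: angle_diffM => //.
  have -> : (fun a => k (z + h) a - k z a - h * k' z a)
      = (fun a => k (z + h) a + (-1 * k z a + - h * k' z a)).
    by apply/funext => a; ring.
  by apply: angle_diffD; [exact: ak|apply: angle_diffD; exact: angle_diffM].
apply: (le_trans (cint_le (M := `|M| * (`|C| * cmod h ^+ 2)) ad _)).
  move=> t ht; rewrite cmodM ler_pM ?cmod_ge0 ?(le_trans (HM t ht) (ler_norm _)) //.
  by rewrite (le_trans (H h t ht hr)) // ler_wpM2r ?ler_norm // sqr_ge0.
rewrite (_ : 2 * _ = cmod h * (4 * pi * (`|M| * `|C|)) * cmod h); last by ring.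
rewrite ler_wpM2r ?cmod_ge0 // (le_trans _ (ltW he)) // /K [leRHS]mulrDr mulr1 lerDl cmod_ge0 //.
Qed.

(** Cauchy's formula makes [f] a multiple of [K 1], and the kernels of [K 1] and [K 2] are
    differentiated under the integral. The second derivative is what the curvature of a frame asks
    for, as it differentiates [f' / f]. *)
Lemma holomorphic_C2 (R : realType) (f : R[i] -> R[i]) (z0 : R[i]) (rho : R) : 0 < rho ->
  (forall z, cmod (z - z0) <= rho -> exists d, cderiv f z d) ->
  exists g, (forall z, cmod (z - z0) < rho -> cderiv f z (g z)) /\ exists d, cderiv g z0 d.
Proof.
move=> rho0 Hf.
pose w a : R[i] := z0 + ofR rho * expi a.
pose w' a : R[i] := ofR rho * ('i%C * expi a).
pose Phi a : R[i] := f (w a) * w' a.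
have cmod_w a : cmod (w a - z0) = rho.
  by rewrite /w addrC addrA addNr add0r cmodM cmod_expi mulr1 cmod_ofR gtr0_norm.
have aw : angle_diff w.
  by apply: angle_diffD; [exact: angle_diff_cst|apply: angle_diffM;
    [exact: angle_diff_cst|exact: angle_diff_expi]].
have aP : angle_diff Phi.
  apply: angle_diffM.
    by apply: angle_diff_comp => // a _; apply: Hf; rewrite cmod_w.
  apply: angle_diffM; first exact: angle_diff_cst.
  by apply: angle_diffM; [exact: angle_diff_cst|exact: angle_diff_expi].
have wz z a : rho - cmod (z - z0) <= cmod (w a - z).
  rewrite -(cmod_w a) (_ : w a - z = (w a - z0) - (z - z0)); last by ring.
  exact: cmodB_le.
have wz0 z a : cmod (z - z0) < rho -> w a - z != 0.
  by move=> hz; rewrite -cmod_gt0 (lt_le_trans _ (wz z a)) // subr_gt0.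
have aV n z : cmod (z - z0) < rho -> angle_diff (fun a => (w a - z)^-1 ^+ n).
  move=> hz; elim: n => [|n IH].
    by under eq_fun do rewrite expr0; exact: angle_diff_cst.
  under eq_fun do rewrite exprS.
  apply: angle_diffM => //; apply: angle_diffV => [|a _]; last exact: wz0.
  by apply: angle_diffD => //; exact: angle_diff_cst.
pose K n z := cint (fun a => Phi a * (w a - z)^-1 ^+ n).
(* Increments shorter than half the distance [m] to the circle keep [z + h] inside and [w a - z - h]
   at distance [m / 2] from zero. *)
have dom z h a (m := rho - cmod (z - z0)) : cmod (z - z0) < rho -> cmod h < m / 2 ->
    [/\ 0 < m, cmod (z + h - z0) < rho, m / 2 <= cmod (w a - z - h),
      m <= cmod (w a - z) & cmod (w a - z) <= 2 * rho].
  move=> hz hh; have m0 : 0 < m by rewrite /m subr_gt0.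
  have h1 : cmod (z + h - z0) < rho.
    rewrite addrAC (le_lt_trans (cmodD _ _)) //; rewrite /m in hh m0; lra.
  split=> //.
  - by have := cmodB_le (w a - z) h; have := wz z a; rewrite -/m; lra.
  - exact: wz.
  - rewrite (_ : w a - z = (w a - z0) + (z0 - z)); last by ring.
    by rewrite (le_trans (cmodD _ _)) // cmod_w (cmodC z0); lra.
have K1 z : cmod (z - z0) < rho -> cderiv (K 1%N) z (K 2%N z).
  move=> hz; set m := rho - cmod (z - z0); have m0 : 0 < m by rewrite subr_gt0.
  apply: (@cderiv_cint R Phi (fun z a => (w a - z)^-1 ^+ 1) (fun z a => (w a - z)^-1 ^+ 2) z
    (2 / m ^+ 3) (m / 2)) => //.
  - by rewrite divr_gt0.
  - exact: aV.
  - by move=> h hh; apply: aV; have [] := dom z h 0 hz hh.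
  move=> h a _ hh; have [_ h1 h2 h3 _] := dom z h a hz hh.
  have n1 : w a - z - h != 0 by rewrite -cmod_gt0 (lt_le_trans _ h2) // divr_gt0.
  have n2 : w a - z != 0 by exact: wz0.
  rewrite (_ : w a - (z + h) = w a - z - h); last by ring.
  move: n1 n2 h2 h3; set D := w a - z => n1 n2 h2 h3.
  (* [1/(D - h) - 1/D - h/D^2 = h^2 / (D^2 (D - h))]; with [|D| >= m] and [|D - h| >= m / 2] this
     explains [2 / m ^+ 3]. *)
  rewrite (_ : _ - _ = h ^+ 2 * (D ^+ 2 * (D - h))^-1); last by field; rewrite n1 n2.
  rewrite cmodM cmodX mulrC ler_wpM2r ?sqr_ge0 // cmodV cmodM cmodX.
  rewrite -[leRHS]invrK lef_pV2 ?posrE ?mulr_gt0 ?exprn_gt0 ?cmod_gt0 ?invr_gt0 ?divr_gt0 ?exprn_gt0 //.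
  rewrite (_ : _^-1 = m ^+ 2 * (m / 2)); last by field; rewrite gt_eqF.
  by rewrite ler_pM ?exprn_ge0 ?divr_ge0 ?(ltW m0) // ler_pXn2r ?nnegrE ?cmod_ge0 // ltW.
have K2 z : cmod (z - z0) < rho -> cderiv (K 2%N) z (cint (fun a => Phi a * (2 * (w a - z)^-1 ^+ 3))).
  move=> hz; set m := rho - cmod (z - z0); have m0 : 0 < m by rewrite subr_gt0.
  apply: (@cderiv_cint R Phi (fun z a => (w a - z)^-1 ^+ 2) (fun z a => 2 * (w a - z)^-1 ^+ 3) z
    ((6 * rho + m) / (m ^+ 3 * (m / 2) ^+ 2)) (m / 2)) => //.
  - by rewrite divr_gt0.
  - by apply: angle_diffM; [exact: angle_diff_cst|exact: aV].
  - by move=> h hh; apply: aV; have [] := dom z h 0 hz hh.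
  move=> h a _ hh; have [_ h1 h2 h3 h4] := dom z h a hz hh.
  have n1 : w a - z - h != 0 by rewrite -cmod_gt0 (lt_le_trans _ h2) // divr_gt0.
  have n2 : w a - z != 0 by exact: wz0.
  rewrite (_ : w a - (z + h) = w a - z - h); last by ring.
  move: n1 n2 h2 h3 h4; set D := w a - z => n1 n2 h2 h3 h4.
  (* [1/(D - h)^2 - 1/D^2 - 2 h/D^3 = h^2 (3 D - 2 h) / (D^3 (D - h)^2)]; the numerator is at most
     [6 rho + m] because [|D| <= 2 rho] and [|h| < m / 2]. *)
  rewrite (_ : _ - _ = h ^+ 2 * ((3 * D - 2 * h) * (D ^+ 3 * (D - h) ^+ 2)^-1)); last first.
    by field; rewrite n1 n2.
  rewrite cmodM cmodX mulrC ler_wpM2r ?sqr_ge0 // cmodM cmodV cmodM !cmodX.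
  apply: ler_pM; rewrite ?cmod_ge0 ?invr_ge0 ?mulr_ge0 ?exprn_ge0 ?cmod_ge0 //.
    have := cmodD (3 * D) (- (2 * h)); rewrite cmodN !cmodM.
    rewrite !cmod_nat; lra.
  rewrite lef_pV2 ?posrE ?mulr_gt0 ?exprn_gt0 ?cmod_gt0 ?divr_gt0 //.
  by rewrite ler_pM ?exprn_ge0 ?divr_ge0 ?(ltW m0) // ler_pXn2r ?nnegrE ?cmod_ge0 ?divr_ge0 // ltW.
have k0 : 'i%C * ofR (2 * pi) != 0 :> R[i].
  by rewrite -cmod_gt0 cmodM cmod_ofR /cmod /= expr0n add0r expr1n sqrtr1 mul1r normr_gt0 mulf_neq0 // gt_eqF // pi_gt0.
set c := 'i%C * ofR (2 * pi) in k0.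
have fE z : cmod (z - z0) < rho -> f z = c^-1 * K 1%N z.
  move=> hz; have := cauchy_formula rho0 Hf hz; rewrite -/c => E.
  rewrite /K -[LHS](mulKf k0) -E; congr (_ * _); apply: eq_cint => a _.
  by rewrite expr1 /Phi mulrA.
have cZ (g : R[i] -> R[i]) z d : cderiv g z d -> cderiv (fun z => c^-1 * g z) z (c^-1 * d).
  move=> Hg e e0; have cp : 0 < cmod c by rewrite cmod_gt0.
  have [del del0 Hd] := Hg (e * cmod c) (mulr_gt0 e0 cp).
  exists del => // h hd; rewrite (_ : _ - _ = c^-1 * (g (z + h) - g z - h * d)); last by ring.
  by rewrite cmodM cmodV mulrC ler_pdivrMr // mulrAC Hd.
exists (fun z => c^-1 * K 2%N z); split; last first.
  by eexists; apply: cZ; apply: K2; rewrite subrr cmod0.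
move=> z hz e e0; have [del del0 Hd] := cZ _ _ _ (K1 z hz) e e0.
exists (Num.min del (rho - cmod (z - z0))); first by rewrite lt_min del0 subr_gt0.
move=> h; rewrite lt_min => /andP[h1 h2]; rewrite !fE ?Hd //.
rewrite addrAC (le_lt_trans (cmodD _ _)) //; lra.
Qed.

(** * The characteristic line bundle *)

Lemma l2basis_sqsum (R : realType) (n N : nat) : sqsum N (@l2basis R n) <= 1.
Proof.
rewrite /sqsum; have [nN|Nn] := ltnP n N.
  rewrite (bigD1 (Ordinal nN)) //= /l2basis eqxx cmod1 expr1n big1 ?addr0 // => i ni.
  by rewrite (_ : (nat_of_ord i == n) = false) ?cmod0 ?expr0n //; apply/negbTE; apply: contra ni => /eqP h; apply/eqP/val_inj.
rewrite big1 ?ler01 // => i _; rewrite /l2basis ltn_eqF ?cmod0 ?expr0n //.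
exact: leq_trans (ltn_ord i) Nn.
Qed.

Lemma l2_basis (R : realType) (n : nat) : l2 (@l2basis R n).
Proof. by apply/l2P; exists 1 => N; exact: l2basis_sqsum. Qed.

Lemma l2inner_basis (R : realType) (n : nat) (v : nat -> R[i]) : l2 v ->
  l2inner (l2basis R n) v = cconj (v n).
Proof.
move=> lv; apply: l2inner_unique => //; first exact: l2_basis.
apply/cvg_cmodP/cvgrPdist_lt => e e0; exists n.+1 => // N /= nN.
rewrite /prodsum (bigD1 (Ordinal nN)) //= /l2basis eqxx mul1r big1 ?addr0 => [|i ni].
  by rewrite subrr cmod0 subrr normr0.
by rewrite (_ : (nat_of_ord i == n) = false) ?mul0r //; apply/negbTE; apply: contra ni => /eqP h; apply/eqP/val_inj.
Qed.

Lemma l2_jacobi_basis (R : realType) (s : nat -> R) (n : nat) : l2 (jacobi_basis s n).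
Proof.
apply: l2D; first by apply: l2D; apply: l2Z; exact: l2_basis.
by case: n => [|n]; [exact: l20|apply: l2Z; exact: l2_basis].
Qed.

Lemma l2inner_jacobi_basis (R : realType) (s : nat -> R) (n : nat) (v : nat -> R[i]) : l2 v ->
  l2inner (jacobi_basis s n) v = cconj (ofR (jacobi_a s n) * v n.+1 + ofR (jacobi_b s n) * v n
    + (if n is m.+1 then ofR (jacobi_a s m) * v m else 0)).
Proof.
move=> lv; have lb k := @l2_basis R k.
have lz c k : l2 (c *: l2basis R k) by apply: l2Z.
rewrite /jacobi_basis !l2innerDl //; first last.
- by case: n => [|n]; [exact: l20|].
- exact: l2D.
rewrite !l2innerZl // !l2inner_basis // !cconjD !cconjM !cconj_ofR; congr (_ + _).
case: n => [|n]; last by rewrite l2innerZl // l2inner_basis // cconjM cconj_ofR.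
by rewrite -(scale0r (l2basis R 0)) l2innerZl // mul0r /cconj conjc0.
Qed.

Lemma l2_sum (R : realType) (N : nat) (x : nat -> nat -> R[i]) :
  (forall n, l2 (x n)) -> l2 (\sum_(n < N) x n).
Proof.
move=> lx; elim: N => [|N IH]; first by rewrite big_ord0; exact: l20.
by rewrite big_ord_recr /=; exact: l2D.
Qed.

Lemma l2inner_sum (R : realType) (N : nat) (x : nat -> nat -> R[i]) (v : nat -> R[i]) :
  (forall n, l2 (x n)) -> l2 v ->
  l2inner (\sum_(n < N) x n) v = \sum_(n < N) l2inner (x n) v.
Proof.
move=> lx lv; elim: N => [|N IH].
  by rewrite !big_ord0 -(scale0r (x 0%N)) l2innerZl // mul0r.
by rewrite !big_ord_recr /= l2innerDl // ?IH //; exact: l2_sum.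
Qed.

Lemma finite_basis_sum (R : realType) (x : nat -> R[i]) (N : nat) :
  (forall n, (N <= n)%N -> x n = 0) -> x = \sum_(n < N) x n *: l2basis R n.
Proof.
move=> x0; apply/funext => m; rewrite fct_sumE.
have E n : (x n *: l2basis R n) m = x n * (m == n)%:R by [].
have [mN|Nm] := ltnP m N.
  rewrite (bigD1 (Ordinal mN)) //= E eqxx mulr1 big1 ?addr0 // => i im.
  by rewrite E (_ : (m == i) = false) ?mulr0 //; apply/negbTE; apply: contra im => /eqP h; apply/eqP/val_inj.
rewrite x0 // big1 // => i _; rewrite E gtn_eqF ?mulr0 //.
exact: leq_trans (ltn_ord i) Nm.
Qed.

Lemma jacobi_finite_l2 (R : realType) (s : nat -> R) (x y : nat -> R[i]) :
  jacobi_finite s x y -> l2 x /\ l2 y.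
Proof.
move=> [N [x0 ->]]; split.
  rewrite (finite_basis_sum x0); apply: (@l2_sum R N (fun n => x n *: l2basis R n)) => n.
  by apply: l2Z; exact: l2_basis.
by apply: (@l2_sum R N (fun n => x n *: jacobi_basis s n)) => n; apply: l2Z; exact: l2_jacobi_basis.
Qed.

Lemma jacobi_operator_basis (R : realType) (s : nat -> R) (n : nat) :
  jacobi_operator s (l2basis R n) (jacobi_basis s n).
Proof.
have fin : jacobi_finite s (l2basis R n) (jacobi_basis s n).
  exists n.+1; split=> [m nm|]; first by rewrite /l2basis gtn_eqF.
  rewrite big_ord_recr /= /l2basis eqxx scale1r big1 ?add0r // => i _.
  by rewrite ltn_eqF // scale0r.
have [lx ly] := jacobi_finite_l2 fin.
split=> //; exists (fun=> l2basis R n), (fun=> jacobi_basis s n).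
by split=> //; rewrite subrr l2norm0; exact: cvg_cst.
Qed.

Section fiber.
Context (R : realType) (s : nat -> R).
Hypothesis s0 : s 0%N = 1.
Hypothesis s_pd : positive_definite s.

Lemma orthopoly_vec0 lam : orthopoly_vec s lam 0%N = 1.
Proof. by rewrite /orthopoly_vec -/(orthopolyC s 0) orthopolyC0 // hornerC. Qed.

Lemma orthopoly_vec_recurrence lam n :
  ofR (jacobi_a s n) * orthopoly_vec s lam n.+1 + ofR (jacobi_b s n) * orthopoly_vec s lam n
    + (if n is m.+1 then ofR (jacobi_a s m) * orthopoly_vec s lam m else 0)
  = lam * orthopoly_vec s lam n.
Proof.
have := congr1 (horner^~ lam) (orthopolyC_recurrence n s_pd).
rewrite /= hornerM hornerX => ->.
by rewrite !hornerD !hornerZ; case: n => [|n]; rewrite ?horner0 ?hornerZ.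
Qed.

(** Tested on basis vectors, the adjoint relation becomes the three-term recurrence for [v], and
    [jacobi_a s n != 0] then determines [v] from [v 0]. The induction carries two consecutive
    entries. *)
Lemma fiberE_multiple lam v : fiberE s lam v -> v = v 0%N *: orthopoly_vec s lam.
Proof.
move=> [lv llv H].
have rec n : ofR (jacobi_a s n) * v n.+1 + ofR (jacobi_b s n) * v n
    + (if n is m.+1 then ofR (jacobi_a s m) * v m else 0) = lam * v n.
  have := H _ _ (jacobi_operator_basis s n).
  by rewrite l2inner_jacobi_basis // l2inner_basis // => /(congr1 (@cconj R)); rewrite !cconjK.
suff K : forall n, v n = v 0%N * orthopoly_vec s lam n /\ v n.+1 = v 0%N * orthopoly_vec s lam n.+1.
  by apply/funext => n; have [{1}-> _] := K n.
have step n : v n = v 0%N * orthopoly_vec s lam n ->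
    (if n is m.+1 then v m = v 0%N * orthopoly_vec s lam m else True) ->
    v n.+1 = v 0%N * orthopoly_vec s lam n.+1.
  have aux (a b c d : R[i]) : a + b + c = d -> a = d - b - c by move=> <-; ring.
  move=> h1 h2; apply: (mulfI (jacobi_a_neq0 n s_pd)).
  have e1 := rec n; have e2 := orthopoly_vec_recurrence lam n.
  rewrite mulrCA.
  have -> : ofR (jacobi_a s n) * orthopoly_vec s lam n.+1 = lam * orthopoly_vec s lam n
      - ofR (jacobi_b s n) * orthopoly_vec s lam n
      - (if n is m.+1 then ofR (jacobi_a s m) * orthopoly_vec s lam m else 0).
    exact: aux e2.
  have -> : ofR (jacobi_a s n) * v n.+1 = lam * v n - ofR (jacobi_b s n) * v n
      - (if n is m.+1 then ofR (jacobi_a s m) * v m else 0).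
    exact: aux e1.
  rewrite h1; case: n h1 h2 {e1 e2} => [|n] h1 h2; last rewrite h2; ring.
elim=> [|n [IH1 IH2]].
  have h : v 0%N = v 0%N * orthopoly_vec s lam 0 by rewrite orthopoly_vec0 mulr1.
  by split=> //; exact: step.
by split=> //; exact: step.
Qed.

(** On finite sequences the adjoint relation is the recurrence of the polynomials; it passes to the
    closure by continuity of the inner product. *)
Lemma orthopoly_vec_fiberE lam : l2 (orthopoly_vec s lam) ->
  fiberE s lam (orthopoly_vec s lam).
Proof.
move=> lp; set p := orthopoly_vec s lam; have llp : l2 (lam *: p) := l2Z lp.
split=> // x y [lx ly [xk [yk [Hk xkx yky]]]].
have fin k : l2inner (yk k) p = l2inner (xk k) (lam *: p).
  have [N [x0 ->]] := Hk k; set x' := xk k in x0 *.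
  rewrite {2}(finite_basis_sum x0) (@l2inner_sum R N (fun n => x' n *: l2basis R n)) //.
  rewrite (@l2inner_sum R N (fun n => x' n *: jacobi_basis s n)) //.
  - apply: eq_bigr => n _.
    rewrite !l2innerZl //; [|exact: l2_basis|exact: l2_jacobi_basis].
    rewrite l2inner_jacobi_basis // l2inner_basis //; congr (_ * cconj _).
    exact: orthopoly_vec_recurrence.
  - by move=> n; apply: l2Z; exact: l2_jacobi_basis.
  - by move=> n; apply: l2Z; exact: l2_basis.
have lxk k : l2 (xk k) by have [] := jacobi_finite_l2 (Hk k).
have lyk k : l2 (yk k) by have [] := jacobi_finite_l2 (Hk k).
apply/eqP; rewrite -subr_eq0 -cmod_eq0 eq_le cmod_ge0 andbT.
have lim : (fun k => l2norm (yk k - y) * l2norm p + l2norm (xk k - x) * l2norm (lam *: p))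
    @ \oo --> (0 : R).
  have E : 0 * l2norm p + 0 * l2norm (lam *: p) = 0 by rewrite !mul0r addr0.
  rewrite -[X in _ --> X]E.
  exact: (cvgD (cvgM yky (cvg_cst (l2norm p))) (cvgM xkx (cvg_cst (l2norm (lam *: p))))).
rewrite -(cvg_lim _ lim) //; apply: limr_ge; first by apply/cvg_ex; exists 0.
(* [fin] is exact on the approximating sequences, so the defect is expressed through [xk k - x] and
   [yk k - y] alone. *)
apply: nearW => k; rewrite (_ : _ - _ = l2inner (xk k - x) (lam *: p) - l2inner (yk k - y) p).
  rewrite (le_trans (cmodD _ _)) // cmodN addrC.
  by apply: lerD; apply: l2inner_le => //; exact: l2B.
rewrite !l2innerBl // fin; ring.
Qed.
End fiber.

(** * Wirtinger calculus *)

(* Real differentiability, [A] and [B] being the derivatives along [dz] and [dzbar]. *)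
Definition rdiff (R : realType) (F : R[i] -> R[i]) (z A B : R[i]) : Prop :=
  forall e, 0 < e -> exists2 d, 0 < d & forall h, cmod h < d ->
    cmod (F (z + h) - F z - h * A - cconj h * B) <= e * cmod h.

Section rdiff.
Context (R : realType).
Implicit Types (F G : R[i] -> R[i]) (z A B : R[i]).

Lemma rdiff_near F G z A B (r : R) : 0 < r ->
  (forall h, cmod h < r -> F (z + h) = G (z + h)) -> rdiff F z A B -> rdiff G z A B.
Proof.
move=> r0 FG H e e0; have [d d0 Hd] := H e e0; exists (Num.min r d); first by rewrite lt_min r0.
move=> h; rewrite lt_min => /andP[hr hd]; rewrite -FG // -[z in G z]addr0 -FG ?cmod0 // addr0.
exact: Hd.
Qed.

Lemma rdiff_ext F G z A B : (forall w, F w = G w) -> rdiff F z A B -> rdiff G z A B.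
Proof. by move=> FG; apply: (@rdiff_near _ _ _ _ _ 1) => // h _. Qed.

Lemma cderiv_rdiff F z d : cderiv F z d -> rdiff F z d 0.
Proof.
move=> H e e0; have [del del0 Hd] := H e e0; exists del => // h hd.
by rewrite mulr0 subr0 Hd.
Qed.

Lemma rdiff_cst c z : rdiff (fun=> c) z 0 0.
Proof.
move=> e e0; exists 1 => // h _; rewrite subrr !mulr0 !subr0 cmod0.
by rewrite mulr_ge0 ?cmod_ge0 // ltW.
Qed.

Lemma rdiffD F G z A B A' B' : rdiff F z A B -> rdiff G z A' B' ->
  rdiff (fun w => F w + G w) z (A + A') (B + B').
Proof.
move=> HF HG e e0; have e2 : 0 < e / 2 by rewrite divr_gt0.
have [d1 d10 K1] := HF _ e2; have [d2 d20 K2] := HG _ e2.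
exists (Num.min d1 d2); first by rewrite lt_min d10.
move=> h; rewrite !lt_min => /andP[h1 h2].
rewrite (_ : _ - _ = (F (z + h) - F z - h * A - cconj h * B)
  + (G (z + h) - G z - h * A' - cconj h * B')); last by ring.
rewrite (le_trans (cmodD _ _)) // (le_trans (lerD (K1 h h1) (K2 h h2))) //.
by rewrite -mulrDl -splitr.
Qed.

Lemma rdiffZ c F z A B : rdiff F z A B -> rdiff (fun w => c * F w) z (c * A) (c * B).
Proof.
move=> HF e e0; have c1 : 0 < cmod c + 1 by rewrite ltr_wpDl ?cmod_ge0.
have [d d0 K] := HF _ (divr_gt0 e0 c1).
exists d => // h hd.
rewrite (_ : _ - _ = c * (F (z + h) - F z - h * A - cconj h * B)); last by ring.
rewrite cmodM; apply: (@le_trans _ _ ((cmod c + 1) * (e / (cmod c + 1) * cmod h))).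
  by rewrite ler_pM ?cmod_ge0 ?K // lerDl.
by rewrite le_eqVlt; apply/orP; left; apply/eqP; field; rewrite gt_eqF.
Qed.

Lemma rdiff_conj F z A B : rdiff F z A B -> rdiff (fun w => cconj (F w)) z (cconj B) (cconj A).
Proof.
move=> HF e e0; have [d d0 K] := HF _ e0; exists d => // h hd.
have := K h hd; rewrite -cmodJ !cconjB !cconjM cconjK => h1.
by rewrite (_ : _ - _ = cconj (F (z + h)) - cconj (F z) - cconj h * cconj A - h * cconj B) //; ring.
Qed.

Lemma rdiff_lip F z A B : rdiff F z A B -> exists M, 0 < M /\ exists2 d, 0 < d & forall h,
    cmod h < d -> cmod (F (z + h) - F z) <= M * cmod h.
Proof.
move=> H; have [d d0 K] := H 1 ltr01; exists (1 + cmod A + cmod B); split.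
  by rewrite -addrA ltr_wpDr // addr_ge0 // cmod_ge0.
exists d => // h hd; have := K h hd.
set X := _ - _ - _; move=> h1.
rewrite (_ : _ - _ = X + (h * A + cconj h * B)); last by rewrite /X; ring.
rewrite (le_trans (cmodD _ _)) //.
have h2 : cmod (h * A + cconj h * B) <= cmod h * cmod A + cmod h * cmod B.
  by rewrite (le_trans (cmodD _ _)) // !cmodM cmodJ.
lra.
Qed.

(* [f] need only be differentiable along the values of [F]: it may be a function of a real
   variable when [F] is real valued. *)
Lemma rdiff_comp_along (f : R[i] -> R[i]) (d : R[i]) F z A B : rdiff F z A B ->
  (forall e, 0 < e -> exists2 del, 0 < del & forall w, cmod (F w - F z) < del ->
    cmod (f (F w) - f (F z) - (F w - F z) * d) <= e * cmod (F w - F z)) ->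
  rdiff (fun w => f (F w)) z (d * A) (d * B).
Proof.
move=> HF Hf e e0.
have [M [M0 [d1 d10 L]]] := rdiff_lip HF.
have [d2 d20 K2] := Hf (e / (2 * M)) (divr_gt0 e0 (mulr_gt0 (ltr0Sn _ 1) M0)).
have c1 : 0 < 2 * (cmod d + 1) by rewrite mulr_gt0 // ltr_wpDl ?cmod_ge0.
have [d3 d30 K3] := HF (e / (2 * (cmod d + 1))) (divr_gt0 e0 c1).
exists (Num.min d1 (Num.min d3 (d2 / M))).
  by rewrite !lt_min d10 d30 divr_gt0.
move=> h; rewrite !lt_min => /and3P[h1 h3 h2].
set eta := F (z + h) - F z.
have eM : cmod eta <= M * cmod h by exact: L.
have ed : cmod eta < d2.
  by rewrite (le_lt_trans eM) // mulrC -ltr_pdivlMr.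
have h4 := K2 (z + h) ed; rewrite -/eta in h4.
have h5 := K3 h h3; rewrite -/eta in h5.
rewrite (_ : _ - _ = (f (F (z + h)) - f (F z) - eta * d)
   + d * (eta - h * A - cconj h * B)); last by ring.
rewrite (le_trans (cmodD _ _)) // cmodM.
have a1 : e / (2 * M) * cmod eta <= e / 2 * cmod h.
  rewrite (_ : e / 2 * _ = e / (2 * M) * (M * cmod h)); last by field; rewrite gt_eqF.
  by rewrite ler_wpM2l // divr_ge0 ?mulr_ge0 ?ltW.
have a2 : cmod d * cmod (eta - h * A - cconj h * B) <= e / 2 * cmod h.
  rewrite (_ : e / 2 * _ = (cmod d + 1) * (e / (2 * (cmod d + 1)) * cmod h)).
    by rewrite ler_pM ?cmod_ge0 // lerDl.
  by field; rewrite gt_eqF // ltr_wpDl ?cmod_ge0.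
lra.
Qed.

Lemma rdiff_comp (f : R[i] -> R[i]) (d : R[i]) F z A B : rdiff F z A B ->
  cderiv f (F z) d -> rdiff (fun w => f (F w)) z (d * A) (d * B).
Proof.
move=> HF Hf; apply: rdiff_comp_along => // e e0.
have [del del0 Hd] := Hf e e0; exists del => // w hw.
by have := Hd _ hw; rewrite [F z + _]addrC subrK.
Qed.

(** The outer map is [phi] of the real part: not complex differentiable, but [rdiff_comp_along]
    tests it only on the real increments of [g]. *)
Lemma rdiff_comp_real (g : R[i] -> R) (phi : R -> R) (d : R) z A B :
  rdiff (fun w => ofR (g w)) z A B -> is_derive (g z) 1 phi d ->
  rdiff (fun w => ofR (phi (g w))) z (ofR d * A) (ofR d * B).
Proof.
move=> HF /is_derive_epsP Hphi.
apply: (@rdiff_comp_along (fun u => ofR (phi (complex.Re u))) (ofR d) _ z A B HF) => e e0.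
have [del del0 Hd] := Hphi e e0; exists del => // w.
rewrite -[ofR (g w) - ofR (g z)](rmorphB (@ofR R)) => hw; rewrite cmod_ofR in hw.
have := Hd _ hw; rewrite [g z + _]addrC subrK -!cmod_ofR.
have E (a b c k : R) : ofR (a - b - c * k) = ofR a - ofR b - ofR c * ofR k.
  by rewrite /ofR; simpc.
by rewrite E.
Qed.

(** Polarization, as in [frechetC_M]. *)
Lemma rdiffM F G z A B A' B' : rdiff F z A B -> rdiff G z A' B' ->
  rdiff (fun w => F w * G w) z (A * G z + F z * A') (B * G z + F z * B').
Proof.
move=> HF HG.
have HS := rdiff_comp (rdiffD HF HG) (cderiv_sqr _).
have HD := rdiff_comp (rdiffD HF (rdiffZ (-1) HG)) (cderiv_sqr _).
have H := rdiffZ (4^-1) (rdiffD HS (rdiffZ (-1) HD)).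
have E (u v : R[i]) : 4^-1 * ((u + v) * (u + v) + -1 * ((u + -1 * v) * (u + -1 * v))) = u * v.
  by field.
have := rdiff_ext (fun _ => E _ _) H.
set X := (X in rdiff _ _ X _); set Y := (X in rdiff _ _ _ X).
have -> : X = A * G z + F z * A' by rewrite /X; field.
by have -> : Y = B * G z + F z * B' by rewrite /Y; field.
Qed.

Lemma rdiffV F z A B : F z != 0 -> rdiff F z A B ->
  rdiff (fun w => (F w)^-1) z (- (F z ^+ 2)^-1 * A) (- (F z ^+ 2)^-1 * B).
Proof. by move=> F0 HF; apply: rdiff_comp HF (cderiv_inv F0). Qed.

(** A real increment is its own conjugate, whence [A + B]; an imaginary one changes sign under
    conjugation, whence ['i%C * (A - B)] in [rdiff_slice_y]. *)
Lemma rdiff_slice_x F x y A B : rdiff F (Complex x y) A B ->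
  is_derive x 1 (fun t => complex.Re (F (Complex t y))) (complex.Re (A + B)) /\
  is_derive x 1 (fun t => complex.Im (F (Complex t y))) (complex.Im (A + B)).
Proof.
move=> H.
have K e : 0 < e -> exists2 del, 0 < del & forall h : R, `|h| < del ->
    cmod (F (Complex (x + h) y) - F (Complex x y) - ofR h * (A + B) - ofR 0 * 0) <= e * `|h|.
  move=> e0; have [del del0 Hd] := H e e0; exists del => // h hd.
  have := Hd (ofR h); rewrite cmod_ofR => /(_ hd).
  rewrite cconj_ofR (_ : Complex x y + ofR h = Complex (x + h) y); last by rewrite /ofR; simpc.
  by rewrite mulr0 subr0 mulrDr opprD addrA.
split; apply/is_derive_epsP => e e0; have [del del0 Hd] := K e e0; exists del => // h hd.
  apply: le_trans (Hd h hd); apply: le_trans (cmod_Re _); by rewrite Re_increment mul0r subr0.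
apply: le_trans (Hd h hd); apply: le_trans (cmod_Im _); by rewrite Im_increment mul0r subr0.
Qed.

Lemma rdiff_slice_y F x y A B : rdiff F (Complex x y) A B ->
  is_derive y 1 (fun t => complex.Re (F (Complex x t))) (complex.Re ('i%C * (A - B))) /\
  is_derive y 1 (fun t => complex.Im (F (Complex x t))) (complex.Im ('i%C * (A - B))).
Proof.
move=> H.
have K e : 0 < e -> exists2 del, 0 < del & forall h : R, `|h| < del ->
    cmod (F (Complex x (y + h)) - F (Complex x y) - ofR h * ('i%C * (A - B)) - ofR 0 * 0)
      <= e * `|h|.
  move=> e0; have [del del0 Hd] := H e e0; exists del => // h hd.
  have hE : Complex 0 h = ofR h * 'i%C by rewrite /ofR; simpc.
  have h1 : cmod (Complex 0 h) = `|h| by rewrite /cmod /= expr0n add0r sqrtr_sqr.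
  have := Hd (Complex 0 h); rewrite h1 => /(_ hd).
  rewrite (_ : cconj (Complex 0 h) = - (ofR h * 'i%C)); last by rewrite /cconj /ofR; simpc.
  rewrite (_ : Complex x y + Complex 0 h = Complex x (y + h)); last by simpc.
  rewrite hE => h2; rewrite (_ : _ - ofR 0 * 0 = F (Complex x (y + h)) - F (Complex x y)
    - ofR h * 'i%C * A - - (ofR h * 'i%C) * B) //.
  ring.
split; apply/is_derive_epsP => e e0; have [del del0 Hd] := K e e0; exists del => // h hd.
  apply: le_trans (Hd h hd); apply: le_trans (cmod_Re _); by rewrite Re_increment mul0r subr0.
apply: le_trans (Hd h hd); apply: le_trans (cmod_Im _); by rewrite Im_increment mul0r subr0.
Qed.

Lemma complex_eta (u : R[i]) : Complex (complex.Re u) (complex.Im u) = u.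
Proof. by case: u. Qed.

Lemma rdiff_wirtinger F z A B : rdiff F z A B -> wirtinger F z = A /\ wirtinger_bar F z = B.
Proof.
case: z => x y H.
have [[_ r1] [_ i1]] := rdiff_slice_x H; have [[_ r2] [_ i2]] := rdiff_slice_y H.
have px : partial_x F (Complex x y) = A + B.
  by rewrite /partial_x /= !derive1E r1 i1 complex_eta.
have py : partial_y F (Complex x y) = 'i%C * (A - B).
  by rewrite /partial_y /= !derive1E r2 i2 complex_eta.
have ii : 'i%C * 'i%C = -1 :> R[i] by rewrite -expr2 sqr_i.
rewrite /wirtinger /wirtinger_bar px py mulrA ii; by split; field.
Qed.

(** Differentiability of [F] is transferred to [G], which makes both sides genuine derivatives and
    not default values. *)
Lemma wirtinger_near F G z (r : R) : 0 < r ->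
  (forall h, cmod h < r -> F (z + h) = G (z + h)) -> (exists A B, rdiff F z A B) ->
  wirtinger F z = wirtinger G z /\ wirtinger_bar F z = wirtinger_bar G z.
Proof.
move=> r0 FG [A [B HF]]; have [-> ->] := rdiff_wirtinger HF.
by have [-> ->] := rdiff_wirtinger (rdiff_near r0 FG HF).
Qed.

Lemma rdiff_continuous F z A B : rdiff F z A B -> forall e, 0 < e ->
  exists2 d, 0 < d & forall h, cmod h < d -> cmod (F (z + h) - F z) <= e.
Proof.
move=> /rdiff_lip [M [M0 [d d0 H]]] e e0; exists (Num.min d (e / M)).
  by rewrite lt_min d0 divr_gt0.
move=> h; rewrite lt_min ltr_pdivlMr // => /andP[h1 h2].
by rewrite (le_trans (H h h1)) // mulrC ltW.
Qed.
End rdiff.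

Lemma l2quad_norm (R : realType) (F : R[i] -> nat -> R[i]) (D : nat -> R[i]) (z : R[i]) :
  l2quad F D z -> exists2 C, 0 <= C & forall h, cmod h <= 1 ->
    l2norm (F (z + h) - F z - h *: D) <= C * cmod h ^+ 2.
Proof.
move=> [C HC]; exists (Num.sqrt `|C|); first exact: sqrtr_ge0.
move=> h h1; rewrite -(ler_pXn2r (_ : 0 < 2)%N) ?nnegrE ?l2norm_ge0 ?mulr_ge0 ?sqrtr_ge0 ?exprn_ge0 ?cmod_ge0 //.
apply: l2norm_le => N; apply: (le_trans (HC h h1 N)).
rewrite exprMn sqr_sqrtr ?normr_ge0 // -exprM.
by rewrite ler_wpM2r ?exprn_ge0 ?cmod_ge0 // ler_norm.
Qed.

(** The inner product is conjugate linear in its second argument, so [p'] appears along [dz] and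
    [q'] along [dzbar]. The remainder consists of the two quadratic remainders paired with [q z] and
    [p z], plus the inner product of the two increments. *)
Lemma rdiff_l2inner (R : realType) (p q : R[i] -> nat -> R[i]) (p' q' : nat -> R[i]) (z : R[i]) :
  (forall w, l2 (p w)) -> (forall w, l2 (q w)) -> l2 p' -> l2 q' ->
  l2quad p p' z -> l2quad q q' z ->
  rdiff (fun w => l2inner (p w) (q w)) z (l2inner p' (q z)) (l2inner (p z) q').
Proof.
move=> lp lq lp' lq' Hp Hq e e0.
have [Cp Cp0 Kp] := l2quad_norm Hp; have [Cq Cq0 Kq] := l2quad_norm Hq.
pose M := Cp * l2norm (q z) + Cq * l2norm (p z) + (Cp + l2norm p') * (Cq + l2norm q') + 1.
have M0 : 0 < M.
  by rewrite /M ltr_wpDl // !addr_ge0 ?mulr_ge0 ?addr_ge0 ?l2norm_ge0.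
exists (Num.min 1 (e / M)); first by rewrite lt_min ltr01 divr_gt0.
move=> h; rewrite lt_min ltr_pdivlMr // => /andP[/ltW h1 h2].
pose dp := p (z + h) - p z; pose dq := q (z + h) - q z.
have ldp : l2 dp by exact: l2B. have ldq : l2 dq by exact: l2B.
have lhp : l2 (h *: p') by exact: l2Z. have lhq : l2 (h *: q') by exact: l2Z.
have lrp : l2 (dp - h *: p') by exact: l2B. have lrq : l2 (dq - h *: q') by exact: l2B.
have E : l2inner (p (z + h)) (q (z + h)) - l2inner (p z) (q z) - h * l2inner p' (q z)
    - cconj h * l2inner (p z) q'
    = l2inner (dp - h *: p') (q z) + l2inner (p z) (dq - h *: q') + l2inner dp dq.
  rewrite l2innerBl // l2innerBr // l2innerZl // l2innerZr // /dp /dq.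
  rewrite !l2innerBl ?l2innerBr //; ring.
have ndp : l2norm dp <= (Cp + l2norm p') * cmod h.
  rewrite -(subrK (h *: p') dp) (le_trans (l2normD _ _)) // l2normZ // mulrDl.
  apply: lerD; last by rewrite mulrC.
  by rewrite (le_trans (Kp h h1)) // ler_wpM2l // expr2 ler_piMr ?cmod_ge0.
have ndq : l2norm dq <= (Cq + l2norm q') * cmod h.
  rewrite -(subrK (h *: q') dq) (le_trans (l2normD _ _)) // l2normZ // mulrDl.
  apply: lerD; last by rewrite mulrC.
  by rewrite (le_trans (Kq h h1)) // ler_wpM2l // expr2 ler_piMr ?cmod_ge0.
have b1 : cmod (l2inner (dp - h *: p') (q z)) <= Cp * l2norm (q z) * cmod h ^+ 2.
  rewrite (le_trans (l2inner_le _ _)) // mulrAC ler_wpM2r ?l2norm_ge0 //; exact: Kp.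
have b2 : cmod (l2inner (p z) (dq - h *: q')) <= Cq * l2norm (p z) * cmod h ^+ 2.
  rewrite (le_trans (l2inner_le _ _)) // mulrC mulrAC ler_wpM2r ?l2norm_ge0 //; exact: Kq.
have b3 : cmod (l2inner dp dq) <= (Cp + l2norm p') * (Cq + l2norm q') * cmod h ^+ 2.
  rewrite (le_trans (l2inner_le _ _)) // expr2 mulrACA.
  by rewrite ler_pM ?l2norm_ge0.
rewrite E (le_trans (cmodD _ _)) // (le_trans (lerD (cmodD _ _) (lexx _))) //.
apply: (le_trans (lerD (lerD b1 b2) b3)).
apply: (@le_trans _ _ (cmod h * M * cmod h)); last by rewrite ler_wpM2r ?cmod_ge0 // ltW.
rewrite -!mulrDl expr2 mulrA ler_wpM2r ?cmod_ge0 // mulrC ler_wpM2l ?cmod_ge0 //.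
by rewrite /M lerDl.
Qed.

Lemma orthopoly_vec_conj (R : realType) (s : nat -> R) (z : R[i]) (n : nat) :
  orthopoly_vec s (cconj z) n = cconj (orthopoly_vec s z n).
Proof.
rewrite /orthopoly_vec /cconj -horner_map /= -map_poly_comp /=.
by congr (_.[_]); apply: eq_map_poly => x /=; rewrite oppr0.
Qed.

Lemma orthopoly_norm_conj (R : realType) (s : nat -> R) (z : R[i]) :
  orthopoly_norm s (cconj z) = orthopoly_norm s z.
Proof.
rewrite /orthopoly_norm /l2norm; congr (Num.sqrt (limn (series _))).
by apply/funext => n; rewrite orthopoly_vec_conj cmodJ.
Qed.

Lemma fiberE_Z (R : realType) (s : nat -> R) (lam c : R[i]) (v : nat -> R[i]) :
  fiberE s lam v -> fiberE s lam (c *: v).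
Proof.
move=> [lv llv H]; have E : lam *: (c *: v) = c *: (lam *: v) by rewrite !scalerA mulrC.
rewrite /fiberE E; split; [exact: l2Z|exact: l2Z|move=> x y Hxy].
by have [lx ly _] := Hxy; rewrite l2innerZr // [RHS]l2innerZr // (H _ _ Hxy).
Qed.

Lemma cderiv_conj (R : realType) (f : R[i] -> R[i]) (z d : R[i]) :
  cderiv f (cconj z) d -> cderiv (fun w => cconj (f (cconj w))) z (cconj d).
Proof.
move=> H e e0; have [del del0 Hd] := H e e0; exists del => // h hd.
have := Hd (cconj h); rewrite cmodJ => /(_ hd).
by rewrite -cmodJ !cconjB cconjM cconjK cconjD.
Qed.

(** * Frames of F, their norms and the curvature *)

Section line_bundle.
Context (R : realType) (s : nat -> R).
Hypothesis s0 : s 0%N = 1.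
Hypothesis s_pd : positive_definite s.
Let p := orthopoly_vec s.
Let p' := orthopoly_dvec s.
Let p'' := orthopoly_ddvec s.
Hypothesis regular : forall z,
  [/\ l2 (p z), l2 (p' z), l2 (p'' z), l2quad p (p' z) z & l2quad p' (p'' z) z].

Let lp z : l2 (p z). Proof. by have [] := regular z. Qed.
Let lp' z : l2 (p' z). Proof. by have [] := regular z. Qed.
Let lp'' z : l2 (p'' z). Proof. by have [] := regular z. Qed.
Let dp z : l2quad p (p' z) z. Proof. by have [] := regular z. Qed.
Let dp' z : l2quad p' (p'' z) z. Proof. by have [] := regular z. Qed.

Lemma orthopoly_norm_ge1 z : 1 <= orthopoly_norm s z.
Proof.
by apply: le_trans (cmod_le_l2norm 0%N (@lp z)); rewrite /p orthopoly_vec0 // cmod1.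
Qed.

Lemma orthopoly_norm_gt0 z : 0 < orthopoly_norm s z.
Proof. by rewrite (lt_le_trans ltr01) // orthopoly_norm_ge1. Qed.

Lemma orthopoly_section : holomorphic_sectionE s setT p.
Proof.
move=> z _; split; first exact: orthopoly_vec_fiberE.
exists (p' z); split => //.
have [C C0 HC] := l2quad_norm (dp z).
apply/cvgrPdist_lt => e e0; apply/near0_cmodP.
exists (Num.min 1 (e / (C + 1))); first by rewrite lt_min ltr01 divr_gt0 // ltr_wpDl.
move=> h h0; rewrite lt_min ltr_pdivlMr; last by rewrite ltr_wpDl.
move=> /andP[/ltW h1 h2]; rewrite sub0r normrN ger0_norm ?l2norm_ge0 //.
have -> : h^-1 *: (p (z + h) - p z) - p' z = h^-1 *: (p (z + h) - p z - h *: p' z).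
  by rewrite [RHS]scalerBr scalerA mulVf // scale1r.
rewrite l2normZ; last by apply: l2B; [exact: l2B|exact: l2Z].
have c0 : 0 < cmod h by rewrite cmod_gt0.
apply: (@le_lt_trans _ _ (C * cmod h)).
  have := HC h h1; rewrite cmodV => hh.
  by rewrite mulrC ler_pdivrMr // -mulrA -expr2.
by rewrite (le_lt_trans _ h2) // mulrDr mulr1 mulrC lerDl cmod_ge0.
Qed.

(** A coordinate is bounded by the l^2 norm and so inherits complex differentiability from the
    section. *)
Lemma section_coef_cderiv (W : set R[i]) (v : R[i] -> nat -> R[i]) z :
  open (W : set R[i]^o) -> holomorphic_sectionE s W v -> W z ->
  exists d, cderiv (fun w => v w 0%N) z d.
Proof.
move=> /open_cmodP oW Hv Wz; have [[lv _ _] [v' [lv' lim]]] := Hv z Wz.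
exists (v' 0%N) => e e0; have [r r0 Wr] := oW z Wz.
move/cvgrPdist_lt: lim => /(_ e e0) /near0_cmodP [d d0 Hd].
exists (Num.min r d); first by rewrite lt_min r0.
move=> h; rewrite lt_min => /andP[hr hd].
have [->|h0] := eqVneq h 0; first by rewrite addr0 subrr mul0r subr0 !cmod0 mulr0.
have := Hd h h0 hd; rewrite sub0r normrN ger0_norm ?l2norm_ge0 // => /ltW H.
have [[lvh _ _] _] := Hv _ (Wr h hr).
have c0 : 0 < cmod h by rewrite cmod_gt0.
have -> : v (z + h) 0%N - v z 0%N - h * v' 0%N
    = h * (h^-1 * (v (z + h) 0%N - v z 0%N) - v' 0%N) by field.
rewrite cmodM mulrC ler_wpM2r ?cmod_ge0 //.
apply: le_trans H; apply: (@cmod_le_l2norm _ (h^-1 *: (v (z + h) - v z) - v') 0%N).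
by apply: l2B => //; apply: l2Z; exact: l2B.
Qed.

Section frame.
Context (U : set R[i]) (sigma : R[i] -> (nat -> R[i]) -> R[i]).
Hypothesis sigma_frame : holomorphic_frameF s U sigma.
Let f z := sigma z (p (cconj z)).

(** [fiberF] speaks of [c *: v + w] only; equal vectors and the scalar [c - 1] extract
    homogeneity. *)
Let sigma_multiple z c : U z -> sigma z (c *: p (cconj z)) = cconj c * f z.
Proof.
move=> Uz; have [_ [lin _] _] := sigma_frame.
have Ep : fiberE s (cconj z) (p (cconj z)) by exact: orthopoly_vec_fiberE.
have := lin z Uz (c - 1) _ _ Ep Ep.
rewrite -[X in _ + X]scale1r -scalerDl subrK => ->.
by rewrite cconjB (_ : cconj 1 = 1) /f; [ring|rewrite /cconj conjc1].
Qed.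

Lemma frame_cderiv z : U z -> exists d, cderiv f z d.
Proof.
move=> Uz; have [_ [_ hol] _] := sigma_frame; apply/holomorphic_atP.
by apply: (hol setT p openT orthopoly_section z Uz).
Qed.

Lemma frame_neq0 z : U z -> f z != 0.
Proof.
move=> Uz; have [_ _ /(_ z Uz) [v [Ev]]] := sigma_frame.
rewrite (fiberE_multiple s0 s_pd Ev) sigma_multiple //.
by rewrite mulf_eq0 negb_or => /andP[].
Qed.

(** The fiber is a line, so the supremum is attained at [p (cconj z)] divided by its norm, and that
    norm is the one at [z] since the polynomials have real coefficients. *)
Lemma frame_dual_norm z : U z ->
  dual_norm s z (sigma z) = cmod (f z) / orthopoly_norm s z.
Proof.
move=> Uz; rewrite /dual_norm; set S := [set x | _].
have P0 := orthopoly_norm_gt0 z.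
have nE : l2norm (p (cconj z)) = orthopoly_norm s z by rewrite -[RHS]orthopoly_norm_conj.
have ubS : ubound S (cmod (f z) / orthopoly_norm s z).
  move=> _ [v [Ev nv ->]].
  rewrite (fiberE_multiple s0 s_pd Ev) in nv *.
  rewrite l2normZ // -/p nE in nv.
  rewrite sigma_multiple // cmodM cmodJ mulrC ler_wpM2l ?cmod_ge0 //.
  by rewrite -[leRHS]mul1r ler_pdivlMr.
have SM : S (cmod (f z) / orthopoly_norm s z).
  exists (ofR (orthopoly_norm s z)^-1 *: p (cconj z)); split.
  - by apply: fiberE_Z; exact: orthopoly_vec_fiberE.
  - by rewrite l2normZ // nE cmod_ofR gtr0_norm ?invr_gt0 // mulVf // gt_eqF.
  - by rewrite sigma_multiple // cmodM cmodJ cmod_ofR gtr0_norm ?invr_gt0 // mulrC.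
apply/eqP; rewrite eq_le ge_sup //=; last by exists (cmod (f z) / orthopoly_norm s z).
by apply: ub_le_sup => //; exists (cmod (f z) / orthopoly_norm s z).
Qed.
End frame.

(** The conjugate makes the first coordinate conjugate linear on the fiber and also compensates the
    conjugate argument of [v], so the pairing is holomorphic. On [p] its value is 1. *)
Lemma global_frame : holomorphic_frameF s setT (fun _ v => cconj (v 0%N)).
Proof.
split; first exact: openT.
  split=> [z _ c v w _ _|W v oW Hv z _ Wz].
    by rewrite (_ : (c *: v + w) 0%N = c * v 0%N + w 0%N) // cconjD cconjM.
  have [d Hd] := section_coef_cderiv oW Hv Wz.
  by apply/holomorphic_atP; exists (cconj d); exact: (@cderiv_conj _ (fun w => v w 0%N)).
move=> z _; exists (p (cconj z)); split; first exact: orthopoly_vec_fiberE.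
by rewrite /p orthopoly_vec0 // /cconj conjc1 oner_eq0.
Qed.

(** With [log_slope_conj]: the derivatives of [ln |p|^2] along [dz] and [dzbar]. [curvature] is the
    mixed second derivative, and [log_slope_dz] the pure one along [dz]. *)
Definition log_slope z := l2inner (p' z) (p z) / l2inner (p z) (p z).
Definition log_slope_conj z := l2inner (p z) (p' z) / l2inner (p z) (p z).
Definition curvature z := l2inner (p' z) (p' z) / l2inner (p z) (p z)
  - l2inner (p' z) (p z) * l2inner (p z) (p' z) / l2inner (p z) (p z) ^+ 2.

Let normE z : l2inner (p z) (p z) = ofR (orthopoly_norm s z ^+ 2).
Proof. exact: l2innerxx. Qed.

Let norm_neq0 z : l2inner (p z) (p z) != 0.
Proof.
rewrite normE -cmod_eq0 cmod_ofR normr_eq0 expf_eq0 /= gt_eqF //.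
exact: orthopoly_norm_gt0.
Qed.

Lemma log_norm_rdiff z :
  rdiff (fun w => ofR (ln (orthopoly_norm s w ^+ 2))) z (log_slope z) (log_slope_conj z).
Proof.
have H : rdiff (fun w => ofR (orthopoly_norm s w ^+ 2)) z (l2inner (p' z) (p z))
    (l2inner (p z) (p' z)).
  by apply: rdiff_ext (rdiff_l2inner (@lp) (@lp) (@lp' z) (@lp' z) (dp z) (dp z)) => w; rewrite normE.
have n0 : 0 < orthopoly_norm s z ^+ 2 by rewrite exprn_gt0 ?orthopoly_norm_gt0.
have := rdiff_comp_real H (is_derive1_ln n0).
rewrite /log_slope /log_slope_conj normE [X in rdiff _ _ X _]mulrC [X in rdiff _ _ _ X]mulrC.
by rewrite (_ : ofR (_ ^-1) = (ofR (orthopoly_norm s z ^+ 2))^-1) // /ofR fmorphV.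
Qed.

Definition log_slope_dz z := l2inner (p'' z) (p z) / l2inner (p z) (p z)
  - l2inner (p' z) (p z) ^+ 2 / l2inner (p z) (p z) ^+ 2.

Lemma log_slope_rdiff z : rdiff log_slope z (log_slope_dz z) (curvature z).
Proof.
have H1 := rdiff_l2inner (@lp') (@lp) (@lp'' z) (@lp' z) (dp' z) (dp z).
have H2 := rdiffV (norm_neq0 z) (rdiff_l2inner (@lp) (@lp) (@lp' z) (@lp' z) (dp z) (dp z)).
have := rdiffM H1 H2; set A := (X in rdiff _ _ X _); set B := (X in rdiff _ _ _ X) => H.
rewrite (_ : curvature z = B); last by rewrite /curvature /B; field; exact: norm_neq0.
rewrite (_ : log_slope_dz z = A) // /log_slope_dz /A.
by field; exact: norm_neq0.
Qed.

Lemma log_slope_conj_rdiff z : exists B, rdiff log_slope_conj z (curvature z) B.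
Proof.
have H1 := rdiff_l2inner (@lp) (@lp') (@lp' z) (@lp'' z) (dp z) (dp' z).
have H2 := rdiffV (norm_neq0 z) (rdiff_l2inner (@lp) (@lp) (@lp' z) (@lp' z) (dp z) (dp z)).
have := rdiffM H1 H2; set A := (X in rdiff _ _ X _); set B := (X in rdiff _ _ _ X) => H.
exists B; rewrite (_ : curvature z = A) // /curvature /A.
by field; exact: norm_neq0.
Qed.

(** [ln |sigma|^2 = ln |f|^2 - ln |p|^2] has [dz] derivative [f' / f - log_slope]. The quotient
    [f' / f] is holomorphic, so its [dzbar] derivative vanishes, and the sign in [delbar1] cancels
    the minus. *)
Lemma chern_curvatureE U sigma z : holomorphic_frameF s U sigma -> U z ->
  chern_curvature s sigma z = curvature z.
Proof.
move=> fr Uz; have [/open_cmodP oU _ _] := fr.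
have [r r0 Ur] := oU z Uz.
pose f w := sigma w (p (cconj w)).
have f0 w : U w -> f w != 0 by exact: (frame_neq0 fr).
have logE w : U w -> ofR (ln (cmod (f w) ^+ 2)) + -1 * ofR (ln (orthopoly_norm s w ^+ 2))
    = log_norm2 s sigma w.
  move=> Uw; rewrite /log_norm2 (frame_dual_norm fr) // exprMn exprVn.
  rewrite [in RHS]lnM ?posrE ?invr_gt0 ?exprn_gt0 ?cmod_gt0 ?f0 ?orthopoly_norm_gt0 //.
  rewrite lnV ?posrE ?exprn_gt0 ?orthopoly_norm_gt0 //.
  by rewrite mulN1r -(rmorphN (@ofR R)) -(rmorphD (@ofR R)).
have slope w d : U w -> cderiv f w d -> wirtinger (log_norm2 s sigma) w = d / f w - log_slope w.
  move=> Uw Hd; have [rw rw0 Uwr] := oU w Uw.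
  have Hfc : rdiff (fun w => ofR (cmod (f w) ^+ 2)) w (d * cconj (f w)) (f w * cconj d).
    have := rdiffM (cderiv_rdiff Hd) (rdiff_conj (cderiv_rdiff Hd)).
    rewrite (_ : cconj 0 = 0) /cconj ?conjc0 // -/(cconj _) mulr0 addr0 mul0r add0r => H.
    by apply: rdiff_ext H => u; rewrite mul_cconj.
  have n0 : 0 < cmod (f w) ^+ 2 by rewrite exprn_gt0 // cmod_gt0 f0.
  have H := rdiffD (rdiff_comp_real Hfc (is_derive1_ln n0)) (rdiffZ (-1) (log_norm_rdiff w)).
  have [<- _] := wirtinger_near rw0 (fun h hr => logE _ (Uwr h hr)) (ex_intro _ _ (ex_intro _ _ H)).
  have [-> _] := rdiff_wirtinger H.
  rewrite mulN1r; congr (_ - _).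
  have -> : ofR (cmod (f w) ^+ 2)^-1 = (f w * cconj (f w))^-1 by rewrite mul_cconj /ofR fmorphV.
  by field; rewrite f0 //= -cmod_eq0 cmodJ cmod_eq0 f0.
(* The radius is halved because [holomorphic_C2] asks for differentiability on a closed disk. *)
have r2 : 0 < r / 2 by rewrite divr_gt0.
have der w : cmod (w - z) <= r / 2 -> exists d, cderiv f w d.
  move=> hw; apply: (frame_cderiv fr).
  rewrite -[w](subrK z) addrC; apply: Ur; rewrite (le_lt_trans hw) //.
  by rewrite ltr_pdivrMr // mulr_natr mulr2n ltrDl.
have [g [Hg [g1 Hg1]]] := holomorphic_C2 r2 der.
have HL := log_slope_rdiff z.
have cf : cderiv f z (g z) by apply: Hg; rewrite subrr cmod0.
have H := rdiffD (rdiffM (cderiv_rdiff Hg1) (rdiffV (f0 z Uz) (cderiv_rdiff cf))) (rdiffZ (-1) HL).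
rewrite /chern_curvature /delbar1 /del0 /=.
have nearE h : cmod h < r / 2 -> g (z + h) / f (z + h) + -1 * log_slope (z + h)
    = wirtinger (log_norm2 s sigma) (z + h).
  move=> hr; rewrite (slope _ (g (z + h))) ?mulN1r //.
    by apply: Ur; rewrite (lt_le_trans hr) // ler_pdivrMr // mulr_natr mulr2n lerDl ltW.
  by apply: Hg; rewrite [z + h]addrC addrK.
have [_ <-] := wirtinger_near r2 nearE (ex_intro _ _ (ex_intro _ _ H)).
have [_ ->] := rdiff_wirtinger H.
by rewrite mul0r !mulr0 !add0r mulN1r opprK.
Qed.

Definition chern_form z := 'i%C / ofR (2 * pi) * curvature z.

Lemma is_first_chern_form_curvature : is_first_chern_form s chern_form.
Proof.
split=> [z|U sigma fr z Uz]; first by exists setT, (fun _ v => cconj (v 0%N)); split=> //; exact: global_frame.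
by rewrite (chern_curvatureE fr Uz).
Qed.

(** The choice operator returns some form that meets the specification; the specification on the
    global frame identifies it at every point. *)
Lemma first_chern_formE : first_chern_form s = chern_form.
Proof.
rewrite /first_chern_form; case: xgetP => [w -> [_ H]|/(_ chern_form)]; last first.
  by move=> /(_ is_first_chern_form_curvature).
apply/funext => z; rewrite (H _ _ global_frame z) // /chern_form.
by rewrite (chern_curvatureE global_frame).
Qed.

(** [ln |p|] is half of [ln |p|^2], and the two components of [d^c] contribute equally under [d]:
    the constant is [2 * 2 * (1/2) * i / (4 pi) = i / (2 pi)]. *)
Lemma ddc_log_norm z : 2 * ddc (fun z => ofR (ln (orthopoly_norm s z))) z = chern_form z.
Proof.
have lnE w : 2^-1 * ofR (ln (orthopoly_norm s w ^+ 2)) = ofR (ln (orthopoly_norm s w)).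
  have E (a : R[i]) : 2^-1 * (a + a) = a by field.
  by rewrite lnXn ?orthopoly_norm_gt0 // (mulr2n (ln _)) (rmorphD (@ofR R)) E.
have H w : rdiff (fun w => ofR (ln (orthopoly_norm s w))) w (2^-1 * log_slope w)
    (2^-1 * log_slope_conj w).
  by apply: rdiff_ext (rdiffZ 2^-1 (log_norm_rdiff w)).
rewrite /ddc /ext_d1 /dc0 /del1 /delbar1 /del0 /delbar0 /=.
set c := 'i%C / ofR (4 * pi).
have [B HB] := log_slope_conj_rdiff z; have HA := log_slope_rdiff z.
have K1 := rdiffZ c (rdiffD (rdiffZ 2^-1 HB) (rdiff_cst 0 z)).
have K2 := rdiffZ c (rdiffD (rdiff_cst 0 z) (rdiffZ (-1) (rdiffZ 2^-1 HA))).
have E1 : (fun w => c * (wirtinger_bar (fun z => ofR (ln (orthopoly_norm s z))) w - 0))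
    = (fun w => c * (2^-1 * log_slope_conj w + 0)).
  by apply/funext => w; have [_ ->] := rdiff_wirtinger (H w); rewrite subr0 addr0.
have E2 : (fun w => c * (0 - wirtinger (fun z => ofR (ln (orthopoly_norm s z))) w))
    = (fun w => c * (0 + -1 * (2^-1 * log_slope w))).
  by apply/funext => w; have [-> _] := rdiff_wirtinger (H w); rewrite mulN1r.
rewrite E1 E2; have [-> _] := rdiff_wirtinger K1; have [_ ->] := rdiff_wirtinger K2.
rewrite /chern_form /c (_ : ofR (4 * pi) = 2 * ofR (2 * pi)); last first.
  by rewrite -[4]/((2 * 2)%:R) natrM -mulrA (rmorphM (@ofR R)) /ofR rmorph_nat.
have p0 : ofR (2 * pi) != 0 :> R[i].
  by rewrite -cmod_eq0 cmod_ofR normr_eq0 mulf_neq0 // gt_eqF // pi_gt0.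
move: (ofR (2 * pi)) p0 => q q0; field; by rewrite q0.
Qed.
End line_bundle.

(** * Green and Jensen *)

Definition cont2 (R : realType) (f : R -> R -> R) : Prop :=
  forall x y e, 0 < e -> exists2 d, 0 < d & forall h k, `|h| < d -> `|k| < d ->
    `|f (x + h) (y + k) - f x y| <= e.

(** * Fubini's theorem for continuous functions on the plane *)

Section product_integrals.
Context (R : realType).
Implicit Types f g : R -> R -> R.
Local Notation mu := (@lebesgue_measure R).
Local Notation RR := (measurableTypeR R * measurableTypeR R)%type.

Lemma cont2_swap f : cont2 f -> cont2 (fun x y => f y x).
Proof.
by move=> cf x y e e0; have [d d0 H] := cf y x e e0; exists d => // h k hd kd; exact: H.
Qed.

Lemma cont2_slice f x : cont2 f -> forall y, {for y, continuous (f x)}.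
Proof.
move=> cf y; apply/cont_epsP => e e0; have [d d0 H] := cf x y e e0; exists d => // k kd.
by have := H 0 k; rewrite addr0 normr0; apply.
Qed.

(** Rounding [x] down to a grid of step [1 / (n + 1)] gives functions whose preimages are countable
    unions of measurable rectangles, indexed by the rational grid values; they converge pointwise to
    [f]. *)
Lemma cont2_measurable f : cont2 f -> measurable_fun setT (fun p : RR => f p.1 p.2).
Proof.
move=> cf; pose r n (x : R) : R := (Num.floor (n.+1%:R * x))%:~R / n.+1%:R.
have n0 n : 0 < n.+1%:R :> R by rewrite ltr0n.
have rx n x : r n x <= x < r n x + n.+1%:R^-1.
  have /andP[h1 h2] := floor_itv (n.+1%:R * x).
  rewrite /r ler_pdivrMr // [x * _]mulrC h1 /= -[X in _ + X]mul1r -mulrDl ltr_pdivlMr //.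
  by rewrite mulrC; apply: lt_le_trans h2 _; rewrite intrD.
have r_mono n x y : x <= y -> r n x <= r n y.
  by move=> xy; rewrite /r ler_pM2r ?invr_gt0 // ler_int; apply: le_floor; rewrite ler_pM2l.
apply/measurable_EFinP.
apply: (@emeasurable_fun_cvg _ _ _ _ (fun n (p : RR) => (f (r n p.1) p.2)%:E)).
  move=> n; apply/measurable_EFinP => _ B mB; rewrite setTI.
  have -> : (fun p : RR => f (r n p.1) p.2) @^-1` B
      = \bigcup_(q : rat) ((r n @^-1` [set ratr q]) `*` ((f (ratr q)) @^-1` B)).
    apply/seteqP; split=> [[x y] /= Bxy|[x y] [q _ /= [<-]]] //.
    exists ((Num.floor (n.+1%:R * x))%:~R / n.+1%:R) => //=.
    have -> : ratr ((Num.floor (n.+1%:R * x))%:~R / n.+1%:R) = r n x.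
      by rewrite fmorph_div /= ratr_int ratr_nat.
    by [].
  apply: bigcupT_measurable_rat => q; apply: measurableX.
    apply: is_interval_measurable => x y /= rxq ryq z /andP[xz zy].
    by apply/eqP; rewrite eq_le -{1}ryq -rxq !r_mono.
  have : measurable_fun setT (f (ratr q)).
    by apply: continuous_measurable_fun => y; exact: cont2_slice.
  by move=> /(_ measurableT _ mB); rewrite setTI.
move=> [x y] _ /=; apply: cvg_EFin; first by apply: nearW.
apply/cvgrPdist_le => e e0; have [d d0 H] := cf x y e e0.
near=> n; rewrite /= distrC.
have := H (r n x - x) 0; rewrite [x + _]addrC subrK addr0 normr0; apply=> //.
have /andP[h1 h2] := rx n x.
rewrite distrC ger0_norm ?subr_ge0 // ltrBlDl (lt_trans h2) // ltrD2l.
near: n; exact: near_infty_natSinv_lt (PosNum d0).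
Unshelve. all: by end_near.
Qed.

Lemma cont2_bounded f (r : R) : cont2 f ->
  exists M, forall x y, `|x| <= r -> `|y| <= r -> `|f x y| <= M.
Proof.
move=> cf; pose F (p : R * R) := f p.1 p.2.
have cF : continuous F.
  move=> [x y]; apply/cvgrPdist_le => e e0; have [d d0 H] := cf x y e e0.
  exists (ball x d, ball y d); first by split; exact: nbhsx_ballx.
  move=> [u v] [/= xu yv]; rewrite /F /= distrC.
  have := H (u - x) (v - y); rewrite ![_ + (_ - _)]addrC !subrK; apply.
    by rewrite distrC.
  by rewrite distrC.
pose K : set (R * R) := `[- r, r] `*` `[- r, r].
have cK : compact K by apply: compact_setX; exact: segment_compact.
have /compact_bounded [M [_ HM]] : compact (F @` K).
  by apply: continuous_compact => //; exact: continuous_subspaceT.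
exists (M + 1) => x y; rewrite !ler_norml => xr yr.
have hM : M < M + 1 by rewrite ltrDl.
have := HM _ hM (F (x, y)); rewrite /= ler_norml; apply.
by exists (x, y) => //; split; rewrite /= in_itv.
Qed.

Section box.
Context (D : set RR) (r : R).
Hypothesis mD : measurable D.
Hypothesis D_box : forall p, D p -> `|p.1 : R| <= r /\ `|p.2 : R| <= r.

Let muD : ((mu \x mu)%E D < +oo)%E.
Proof.
pose K : set RR := `[- r, r] `*` `[- r, r].
have mK : measurable K by apply: measurableX.
apply: (@le_lt_trans _ _ ((mu \x mu)%E K)).
  apply: le_measure; rewrite ?inE //.
  by move=> p /D_box [h1 h2]; split; rewrite /= in_itv /= -ler_norml.
pose I : set (measurableTypeR R) := [set` `[- r, r]].
have muI : (mu I < +oo)%E.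
  by rewrite lebesgue_measure_itv /=; case: ifP => _; rewrite ?ltry // -EFinD ltry.
rewrite product_measure1E //; apply: lte_mul_pinfty => //.
by rewrite ge0_fin_numE.
Qed.

Lemma cont2_integrable f : cont2 f ->
  (mu \x mu)%E.-integrable D (EFin \o (fun p : RR => f p.1 p.2)).
Proof.
move=> cf; apply: measurable_bounded_integrable => //.
  by apply: measurable_funTS; exact: cont2_measurable.
have [M HM] := cont2_bounded r cf.
exists M; split; first exact: num_real.
by move=> N MN p /= /D_box [h1 h2]; rewrite (le_trans (HM _ _ h1 h2)) // ltW.
Qed.

Lemma cont2_fubini12 f : cont2 f ->
  \int[(mu \x mu)%E]_(p in D) f p.1 p.2 = \int[mu]_x \int[mu]_(y in xsection D x) f x y.
Proof.
move=> cf; rewrite /Rintegral integral_mkcond -integral12_prod_meas1; last first.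
  by apply/(integrable_mkcond _ mD)/cont2_integrable.
congr fine; apply: eq_integral => x _; rewrite /fubini_F.
have -> : (\int[mu]_y ((fun p : RR => (f p.1 p.2)%:E) \_ D) (x, y))%E
    = (\int[mu]_(y in xsection D x) (f x y)%:E)%E.
  rewrite [RHS]integral_mkcond; apply: eq_integral => y _.
  by rewrite /patch mem_xsection.
rewrite fineK //; apply: integrable_fin_num; first exact: measurable_xsection.
apply: measurable_bounded_integrable.
- exact: measurable_xsection.
- apply: (@le_lt_trans _ _ (mu `[- r, r])).
    apply: le_measure; rewrite ?inE //; first exact: measurable_xsection.
    move=> y; rewrite /xsection /= inE => /D_box [_ h2].
    by rewrite in_itv /= -ler_norml.
  by rewrite lebesgue_measure_itv /=; case: ifP => _; rewrite ?ltry // -EFinD ltry.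
- by apply: measurable_funTS; apply: continuous_measurable_fun => y; exact: cont2_slice.
have [M HM] := cont2_bounded r cf.
exists M; split; first exact: num_real.
move=> N MN y /=; rewrite /xsection /= inE => /D_box [h1 h2].
by rewrite (le_trans (HM _ _ h1 h2)) // ltW.
Qed.

Lemma cont2_fubini21 f : cont2 f ->
  \int[(mu \x mu)%E]_(p in D) f p.1 p.2 = \int[mu]_y \int[mu]_(x in ysection D y) f x y.
Proof.
move=> cf; rewrite /Rintegral integral_mkcond -integral21_prod_meas1; last first.
  by apply/(integrable_mkcond _ mD)/cont2_integrable.
congr fine; apply: eq_integral => y _; rewrite /fubini_G.
have -> : (\int[mu]_x ((fun p : RR => (f p.1 p.2)%:E) \_ D) (x, y))%E
    = (\int[mu]_(x in ysection D y) (f x y)%:E)%E.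
  rewrite [RHS]integral_mkcond; apply: eq_integral => x _.
  by rewrite /patch mem_ysection.
rewrite fineK //; apply: integrable_fin_num; first exact: measurable_ysection.
apply: measurable_bounded_integrable.
- exact: measurable_ysection.
- apply: (@le_lt_trans _ _ (mu `[- r, r])).
    apply: le_measure; rewrite ?inE //; first exact: measurable_ysection.
    move=> x; rewrite /ysection /= inE => /D_box [h1 _].
    by rewrite in_itv /= -ler_norml.
  by rewrite lebesgue_measure_itv /=; case: ifP => _; rewrite ?ltry // -EFinD ltry.
- apply: measurable_funTS; apply: continuous_measurable_fun => x.
  exact: (@cont2_slice (fun y x => f x y) y (cont2_swap cf) x).
have [M HM] := cont2_bounded r cf.
exists M; split; first exact: num_real.
move=> N MN x /=; rewrite /ysection /= inE => /D_box [h1 h2].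
by rewrite (le_trans (HM _ _ h1 h2)) // ltW.
Qed.
End box.

Lemma Rintegral_support (A : set (measurableTypeR R)) (g : R -> R) :
  (forall x, ~ A x -> g x = 0) -> \int[mu]_x g x = \int[mu]_(x in A) g x.
Proof.
move=> g0; rewrite [RHS]Rintegral_mkcond; apply: eq_Rintegral => x _.
by rewrite /patch; case: ifPn => //; rewrite notin_setE => /g0.
Qed.

Lemma segint_open (a b : R) (g : R -> R) : seg_cont a b g ->
  \int[mu]_(x in `]a, b[) g x = segint a b g.
Proof.
move=> cg; have ig := seg_cont_integrable cg.
have io : mu.-integrable `]a, b[ (EFin \o g).
  by apply: integrableS ig => //; apply: subset_itv; rewrite bnd_simp.
have io2 : mu.-integrable `[a, b[ (EFin \o g).
  by apply: integrableS ig => //; apply: subset_itv; rewrite bnd_simp.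
by rewrite /segint -Rintegral_itv_bndo_bndc // Rintegral_itv_obnd_cbnd.
Qed.

(** The interval is open in [x] and closed in [y], as for the radius and the angle in the integral
    for T_F. *)
Lemma rect_fubini f (a b c d : R) : cont2 f ->
  \int[mu]_(x in `]a, b[) segint c d (f x) = segint c d (fun y => segint a b (fun x => f x y)).
Proof.
move=> cf; pose D : set RR := `]a, b[ `*` `[c, d].
have mD : measurable D by apply: measurableX.
pose r := Num.max (Num.max `|a| `|b|) (Num.max `|c| `|d|).
have D_box p : D p -> `|p.1 : R| <= r /\ `|p.2 : R| <= r.
  move=> [/=]; rewrite !in_itv /= => /andP[/ltW h1 /ltW h2] /andP[h3 h4].
  have B (u v w : R) : u <= w -> w <= v -> `|w| <= Num.max `|u| `|v|.
    move=> uw wv; rewrite le_max; have [w0|w0] := leP 0 w.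
      by apply/orP; right; rewrite (ger0_norm w0) ger0_norm // (le_trans w0).
    by apply/orP; left; rewrite !ltr0_norm ?lerN2 // (le_lt_trans uw).
  have := B _ _ _ h1 h2; have := B _ _ _ h3 h4; rewrite /r !le_max.
  by move=> -> ->; rewrite orbT.
have := cont2_fubini12 mD D_box cf; rewrite (cont2_fubini21 mD D_box cf) => E.
have -> : \int[mu]_(x in `]a, b[) segint c d (f x) = \int[mu]_x \int[mu]_(y in xsection D x) f x y.
  rewrite (@Rintegral_support `]a, b[).
    apply: eq_Rintegral => x; rewrite inE /= => xab; congr (Rintegral _ _ _).
    by apply/seteqP; split=> y; rewrite /xsection /= inE => //; case.
  move=> x /= xab; rewrite (_ : xsection D x = set0) ?Rintegral_set0 //.
  by apply/seteqP; split=> y //; rewrite /xsection /= inE => -[].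
rewrite -E [LHS](@Rintegral_support `[c, d]).
  apply: eq_Rintegral => y; rewrite inE /= => ycd.
  rewrite -[RHS]segint_open; last by move=> x _; exact: (@cont2_slice (fun y x => f x y) y (cont2_swap cf) x).
  congr (Rintegral _ _ _).
  by apply/seteqP; split=> x; rewrite /ysection /= inE => //; case.
move=> y /= ycd; rewrite (_ : ysection D y = set0) ?Rintegral_set0 //.
by apply/seteqP; split=> x //; rewrite /ysection /= inE => -[].
Qed.

Section disk.
Context (t : R).
Hypothesis t0 : 0 <= t.
Let D : set RR := [set p | (p.1 : R) ^+ 2 + (p.2 : R) ^+ 2 < t ^+ 2].

Lemma disk_measurable : measurable D.
Proof.
have m : measurable_fun setT (fun p : RR => (p.1 : R) ^+ 2 + (p.2 : R) ^+ 2).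
  apply: measurable_funD; apply: measurable_funX; [exact: measurable_fst|exact: measurable_snd].
have := m measurableT [set` `]-oo, t ^+ 2[] (measurable_itv _); rewrite setTI.
by congr (measurable _); apply/seteqP; split=> p /=; rewrite in_itv.
Qed.

Lemma disk_box p : D p -> `|p.1 : R| <= t /\ `|p.2 : R| <= t.
Proof.
rewrite /D /= => H; split; rewrite -(ler_pXn2r (_ : 0 < 2)%N) ?nnegrE // real_normK ?num_real //.
  by rewrite (le_trans _ (ltW H)) // lerDl sqr_ge0.
by rewrite (le_trans _ (ltW H)) // lerDr sqr_ge0.
Qed.

(** Where [t ^+ 2 - x ^+ 2 <= 0] the square root is 0, and the open interval is empty just as the
    slice is. *)
Let slice (x y : R) : (x ^+ 2 + y ^+ 2 < t ^+ 2)
  = (- Num.sqrt (t ^+ 2 - x ^+ 2) < y < Num.sqrt (t ^+ 2 - x ^+ 2)).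
Proof.
rewrite -ltr_norml -ltrBrDl; have [h|h] := leP (t ^+ 2 - x ^+ 2) 0.
  rewrite (ler0_sqrtr h) [RHS]ltNge normr_ge0 /=; apply/negbTE.
  by rewrite -leNgt (le_trans h) ?sqr_ge0.
rewrite -[RHS](ltr_pXn2r (_ : 0 < 2)%N) ?nnegrE ?sqrtr_ge0 //.
by rewrite real_normK ?num_real // sqr_sqrtr // ltW.
Qed.

Let far (x : R) : ~ (- t <= x <= t) -> Num.sqrt (t ^+ 2 - x ^+ 2) = 0.
Proof.
move=> /negP; rewrite -ler_norml -ltNge => h; apply: ler0_sqrtr.
by rewrite subr_le0 -[x ^+ 2]real_normK ?num_real // ler_pXn2r ?nnegrE // ltW.
Qed.

Lemma disk_fubini12 f : cont2 f -> \int[(mu \x mu)%E]_(p in D) f p.1 p.2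
  = segint (- t) t (fun x =>
      segint (- Num.sqrt (t ^+ 2 - x ^+ 2)) (Num.sqrt (t ^+ 2 - x ^+ 2)) (f x)).
Proof.
move=> cf; rewrite (cont2_fubini12 disk_measurable disk_box cf).
have E x : \int[mu]_(y in xsection D x) f x y
    = segint (- Num.sqrt (t ^+ 2 - x ^+ 2)) (Num.sqrt (t ^+ 2 - x ^+ 2)) (f x).
  rewrite -segint_open; last by move=> y _; exact: cont2_slice.
  congr (Rintegral _ _ _).
  by apply/seteqP; split=> y; rewrite /xsection /= inE /D /= slice in_itv.
rewrite (@Rintegral_support `[- t, t]).
  by apply: eq_Rintegral => x _; rewrite E.
by move=> x; rewrite /= in_itv /= => xt; rewrite E far // oppr0 /segint set_itv1 Rintegral_set1.
Qed.

Lemma disk_fubini21 f : cont2 f -> \int[(mu \x mu)%E]_(p in D) f p.1 p.2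
  = segint (- t) t (fun y =>
      segint (- Num.sqrt (t ^+ 2 - y ^+ 2)) (Num.sqrt (t ^+ 2 - y ^+ 2)) (fun x => f x y)).
Proof.
move=> cf; rewrite (cont2_fubini21 disk_measurable disk_box cf).
have E y : \int[mu]_(x in ysection D y) f x y
    = segint (- Num.sqrt (t ^+ 2 - y ^+ 2)) (Num.sqrt (t ^+ 2 - y ^+ 2)) (fun x => f x y).
  rewrite -segint_open; last by move=> x _; exact: (@cont2_slice (fun y x => f x y) y (cont2_swap cf) x).
  congr (Rintegral _ _ _).
  by apply/seteqP; split=> x; rewrite /ysection /= inE /D /= [x ^+ 2 + y ^+ 2]addrC slice in_itv.
rewrite (@Rintegral_support `[- t, t]).
  by apply: eq_Rintegral => y _; rewrite E.
by move=> y; rewrite /= in_itv /= => yt; rewrite E far // oppr0 /segint set_itv1 Rintegral_set1.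
Qed.
End disk.
End product_integrals.

(** * Primitives and changes of variable *)

Section primitives.
Context (R : realType).
Implicit Types f g h F G : R -> R.

Lemma segint_FTC F f (a b : R) : a <= b -> (forall x, a <= x <= b -> is_derive x 1 F (f x)) ->
  seg_cont a b f -> segint a b f = F b - F a.
Proof.
rewrite le_eqVlt => /predU1P[<-|ab] dF cf.
  by rewrite subrr /segint set_itv1 Rintegral_set1.
have itvE x : x \in `]a, b[ -> a <= x <= b.
  by rewrite in_itv /= => /andP[/ltW -> /ltW ->].
rewrite /segint /Rintegral (continuous_FTC2 (F := F) ab) //.
- apply: continuous_in_subspaceT => x; rewrite inE /= in_itv /= => xab; exact: cf.
- have cF x : a <= x <= b -> {for x, continuous F}.
    by move=> xab; apply: differentiable_continuous; apply/derivable1_diffP; have [] := dF x xab.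
  split=> [x /itvE xab| |].
  + by have [] := dF x xab.
  + by apply: cvg_at_right_filter; apply: cF; rewrite lexx ltW.
  + by apply: cvg_at_left_filter; apply: cF; rewrite lexx ltW.
- by move=> x /itvE xab; rewrite derive1E; have /@derive_val := dF x xab.
Qed.

(** The derivative is obtained strictly to the right of the base point, hence the base points
    [- t - 1] and [- (4 * pi)] below, which lie to the left of every argument that occurs. *)
Lemma primitive f (a : R) : continuous f ->
  exists F, forall x, a < x -> is_derive x 1 F (f x).
Proof.
move=> cf; exists (fun x => \int[lebesgue_measure]_(t in `[a, x]) f t) => x ax.
have int : (@lebesgue_measure R).-integrable `[a, x + 1] (EFin \o f).
  by apply: seg_cont_integrable => y _; exact: cf.
have xx : x < x + 1 by rewrite ltrDl.
have [d dE] := continuous_FTC1_closed xx int ax (cf x).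
by apply: (DeriveDef d); rewrite -derive1E dE.
Qed.

(** Both sides are increments of a primitive [F] of [f]; the right-hand integrand is the derivative
    of [- F (t * cos a)], the sign reflecting that the cosine decreases. *)
Lemma segint_cos_subst f (t : R) : 0 <= t -> continuous f ->
  segint (- t) t f = segint 0 pi (fun a => f (t * cos a) * (t * sin a)).
Proof.
move=> t0 cf; have [F HF] := @primitive f (- t - 1) cf.
have tt : - t <= t by rewrite ge0_cp.
have dF x : - t <= x <= t -> is_derive x 1 F (f x).
  by move=> /andP[tx _]; apply: HF; lra.
rewrite (segint_FTC tt dF) => [|x _]; last exact: cf.
have dG (a : R) : is_derive a 1 (fun a : R => - F (t * cos a)) (f (t * cos a) * (t * sin a)).
  have d1 : is_derive a 1 (fun a : R => t * cos a) (t * - sin a).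
    exact: (is_deriveZ t (is_derive_cos a)).
  have b1 : - t - 1 < t * cos a.
    have /andP[c1 _] : -1 <= cos a <= 1 by rewrite cos_geN1 cos_le1.
    have : t * -1 <= t * cos a by rewrite ler_wpM2l.
    lra.
  have H := is_deriveN (@is_derive1_comp R F (fun a : R => t * cos a) a _ _ (HF _ b1) d1).
  apply: (is_derive_eq H).
  by ring.
rewrite (segint_FTC (pi_ge0 R) (fun a _ => dG a)); last first.
- move=> a _; apply: continuousM.
    apply: (@continuous_comp _ _ _ (fun a => t * cos a) f); last exact: cf.
    by apply: continuousM; [exact: cst_continuous|exact: continuous_cos].
  by apply: continuousM; [exact: cst_continuous|exact: continuous_sin].
by rewrite cospi cos0 mulr1 mulrN1; ring.
Qed.

(** The left side is the integral over the full turn from [- pi / 2] to [3 pi / 2]; periodicity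
    moves it to [[- pi, pi]] and evenness folds it onto [[0, pi]]. *)
Lemma segint_rotate h : continuous h -> (forall x, h (- x) = h x) ->
  (forall x, h (x + 2 * pi) = h x) ->
  segint 0 pi (fun a => h (pi / 2 - a) + h (pi / 2 + a)) = 2 * segint 0 pi h.
Proof.
move=> ch even per; have [F HF] := @primitive h (- (4 * pi)) ch.
have p0 := @pi_gt0 R; have q : pi / 2 + pi / 2 = pi :> R by rewrite -splitr.
have chS (k : R) : continuous (fun x => h (k + x)).
  move=> x; apply: (@continuous_comp _ _ _ (fun x => k + x) h); last exact: ch.
  by apply: continuousD; [exact: cst_continuous|exact: cvg_id].
have chN (k : R) : continuous (fun x => h (k - x)).
  move=> x; apply: (@continuous_comp _ _ _ (fun x => k - x) h); last exact: ch.
  by apply: continuousB; [exact: cst_continuous|exact: cvg_id].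
have dS (k x : R) : - (4 * pi) < k + x -> is_derive x 1 (fun x => F (k + x)) (h (k + x)).
  move=> kx; have d1 : is_derive x 1 (fun x => k + x) 1.
    by have := is_deriveD (is_derive_cst k x 1) (is_derive_id x 1); rewrite add0r.
  by apply: (is_derive_eq (is_derive1_comp (HF _ kx) d1)); rewrite ?mulr1 ?mul1r.
have dN (k x : R) : - (4 * pi) < k - x -> is_derive x 1 (fun x => F (k - x)) (- h (k - x)).
  move=> kx; have d1 : is_derive x 1 (fun x => k - x) (-1).
    by have := is_deriveB (is_derive_cst k x 1) (is_derive_id x 1); rewrite sub0r.
  have := @is_derive1_comp R F (fun x : R => k - x) x _ _ (HF _ kx) d1.
  move=> H; by apply: (is_derive_eq H); rewrite ?mulrN1 ?mulN1r.
(* Periodicity ([E1]) and evenness ([E2]) are both used as the constancy of a combination of values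
   of [F]. *)
have zero (a b : R) (G : R -> R) : a <= b -> (forall x, a <= x <= b -> is_derive x 1 G 0) ->
    G b = G a.
  move=> ab dG; apply/eqP; rewrite -subr_eq0 -(segint_FTC (f := fun=> 0) ab dG).
    by rewrite segint_cst // mul0r.
  exact: seg_cont_cst.
have d1 x : 0 <= x <= pi ->
    is_derive x 1 (fun a => F (pi / 2 + a) - F (pi / 2 - a)) (h (pi / 2 - x) + h (pi / 2 + x)).
  move=> /andP[x0 xp]; have a1 : - (4 * pi) < pi / 2 + x by lra.
  have a2 : - (4 * pi) < pi / 2 - x by lra.
  by apply: (is_derive_eq (is_deriveB (dS _ _ a1) (dN _ _ a2))); rewrite opprK addrC.
have d2 x : 0 <= x <= pi -> is_derive x 1 F (h x).
  by move=> /andP[x0 _]; apply: HF; lra.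
rewrite (segint_FTC (ltW p0) d1) => [|x _]; last first.
  by apply: continuousD; [exact: chN|exact: chS].
rewrite (segint_FTC (ltW p0) d2) => [|x _]; last exact: ch.
have E1 : F (2 * pi + - (pi / 2)) - F (0 + - (pi / 2)) = F (2 * pi + - pi) - F (0 + - pi).
  apply: (zero _ _ (fun x => F (2 * pi + x) - F (0 + x))); first lra.
  move=> x /andP[x1 x2]; have a1 : - (4 * pi) < 2 * pi + x by lra.
  have a2 : - (4 * pi) < 0 + x by lra.
  apply: (is_derive_eq (is_deriveB (dS _ _ a1) (dS _ _ a2))).
  by rewrite add0r [2 * pi + x]addrC per subrr.
have E2 : F (0 + pi) + F (0 - pi) = F (0 + 0) + F (0 - 0).
  apply: (zero _ _ (fun x => F (0 + x) + F (0 - x))); first lra.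
  move=> x /andP[x1 x2]; have a1 : - (4 * pi) < 0 + x by lra.
  have a2 : - (4 * pi) < 0 - x by lra.
  apply: (is_derive_eq (is_deriveD (dS _ _ a1) (dN _ _ a2))).
  by rewrite add0r sub0r even subrr.
move: E1 E2; rewrite !add0r oppr0 !addr0 (_ : 2 * pi + - (pi / 2) = pi / 2 + pi); last by lra.
rewrite (_ : 2 * pi + - pi = pi); last by lra.
rewrite (_ : pi / 2 - pi = - (pi / 2)); last by lra.
move: (F _) (F _) (F _) (F _) (F _) => u v w y k; lra.
Qed.
End primitives.

(** * Green's formula on a disk *)

Section green.
Context (R : realType).
Local Notation mu := (@lebesgue_measure R).
Local Notation RR := (measurableTypeR R * measurableTypeR R)%type.

Lemma cont2_comp (f : R -> R -> R) (u v : R -> R) (x : R) : cont2 f ->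
  {for x, continuous u} -> {for x, continuous v} -> {for x, continuous (fun y => f (u y) (v y))}.
Proof.
move=> cf /cont_epsP cu /cont_epsP cv; apply/cont_epsP => e e0.
have [d d0 H] := cf (u x) (v x) e e0.
have d2 : 0 < d / 2 by rewrite divr_gt0.
have dd : d / 2 < d by rewrite ltr_pdivrMr // mulr_natr mulr2n ltrDl.
have [d1 d10 H1] := cu _ d2; have [d3 d30 H3] := cv _ d2.
exists (Num.min d1 d3); first by rewrite lt_min d10.
move=> h; rewrite lt_min => /andP[h1 h3].
have := H (u (x + h) - u x) (v (x + h) - v x).
rewrite ![_ + (_ - _)]addrC !subrK; apply.
  exact: le_lt_trans (H1 h h1) dd.
exact: le_lt_trans (H3 h h3) dd.
Qed.

Lemma cont2D (f g : R -> R -> R) : cont2 f -> cont2 g -> cont2 (fun x y => f x y + g x y).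
Proof.
move=> cf cg x y e e0; have e2 : 0 < e / 2 by rewrite divr_gt0.
have [d1 d10 H1] := cf x y _ e2; have [d2 d20 H2] := cg x y _ e2.
exists (Num.min d1 d2); first by rewrite lt_min d10.
move=> h k; rewrite !lt_min => /andP[h1 h2] /andP[k1 k2].
rewrite opprD addrACA (le_trans (ler_normD _ _)) // [e]splitr.
by rewrite lerD ?H1 ?H2.
Qed.

Context (P Q Px Qy : R -> R -> R).
Hypotheses (cP : cont2 P) (cQ : cont2 Q) (cPx : cont2 Px) (cQy : cont2 Qy).
Hypothesis dP : forall x y : R, is_derive x 1 (fun x : R => P x y) (Px x y).
Hypothesis dQ : forall x y : R, is_derive y 1 (Q x) (Qy x y).
Hypothesis P_even : forall x y, P x (- y) = P x y.
Hypothesis Q_odd : forall x y, Q x (- y) = - Q x y.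

Let sq (t x : R) : R := Num.sqrt (t ^+ 2 - x ^+ 2).

Let sq_cont t : continuous (sq t).
Proof.
move=> x; rewrite /sq.
apply: (@continuous_comp R R R (fun x : R => t ^+ 2 - x ^+ 2) Num.sqrt x); last exact: sqrt_continuous.
by apply: continuousB; [exact: cst_continuous|exact: exprn_continuous].
Qed.

Let sqN_cont t : continuous (fun x => - sq t x).
Proof. by move=> x; apply: continuousN; exact: sq_cont. Qed.

Let sq_cos t a : 0 <= t -> 0 <= a <= pi -> sq t (t * cos a) = t * sin a.
Proof.
move=> t0 ha; rewrite /sq exprMn -[X in X - _]mulr1 -mulrBr -sin2cos2 -exprMn.
by rewrite sqrtr_sqr ger0_norm // mulr_ge0 // sin_ge0_pi.
Qed.

(** Each term is integrated first in the variable of its derivative. With [x = t cos a] the [Q] term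
    lies at the angles [a] and [- a]; with [y = t cos a] the [P] term lies at [pi / 2 - a] and
    [pi / 2 + a], and [segint_rotate] brings it back. The symmetries in [y] leave twice the upper
    half circle. *)
Lemma green_disk t : 0 <= t ->
  \int[(mu \x mu)%E]_(p in [set p : RR | (p.1 : R) ^+ 2 + (p.2 : R) ^+ 2 < t ^+ 2])
     (Px p.1 p.2 + Qy p.1 p.2)
  = segint 0 pi (fun a => 2 * (t * (P (t * cos a) (t * sin a) * cos a
                                    + Q (t * cos a) (t * sin a) * sin a))).
Proof.
move=> t0.
have ctc : continuous (fun a : R => t * cos a).
  by move=> a; apply: continuousM; [exact: cst_continuous|exact: continuous_cos].
have cts : continuous (fun a : R => t * sin a).
  by move=> a; apply: continuousM; [exact: cst_continuous|exact: continuous_sin].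
rewrite RintegralD; last first.
- exact: (cont2_integrable (disk_measurable t) (disk_box t0) cQy).
- exact: (cont2_integrable (disk_measurable t) (disk_box t0) cPx).
- exact: disk_measurable.
rewrite (disk_fubini21 t0 cPx) (disk_fubini12 t0 cQy).
have sN x : - sq t x <= sq t x by rewrite ge0_cp // sqrtr_ge0.
have -> : segint (- t) t (fun y => segint (- sq t y) (sq t y) (fun x => Px x y))
    = segint (- t) t (fun y => P (sq t y) y - P (- sq t y) y).
  apply: eq_segint => y _; rewrite (segint_FTC (sN y) (fun x _ => dP x y)) //.
  by move=> x _; exact: (@cont2_slice _ (fun y x => Px x y) y (cont2_swap cPx)).
have -> : segint (- t) t (fun x => segint (- sq t x) (sq t x) (Qy x))
    = segint (- t) t (fun x => Q x (sq t x) - Q x (- sq t x)).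
  apply: eq_segint => x _; rewrite (segint_FTC (sN x) (fun y _ => dQ x y)) //.
  by move=> y _; exact: cont2_slice.
rewrite !segint_cos_subst //; first last.
- move=> y; apply: continuousB.
    by apply: (cont2_comp cP (u := sq t) (v := id)); [exact: sq_cont|exact: cvg_id].
  by apply: (cont2_comp cP (u := fun y => - sq t y) (v := id)); [exact: sqN_cont|exact: cvg_id].
- move=> y; apply: continuousB.
    by apply: (cont2_comp cQ (v := sq t) (u := id)); [exact: cvg_id|exact: sq_cont].
  by apply: (cont2_comp cQ (v := fun y => - sq t y) (u := id)); [exact: cvg_id|exact: sqN_cont].
pose h a := P (t * cos a) (t * sin a) * (t * cos a).
have ch : continuous h.
  by move=> a; apply: cvgM; [exact: (cont2_comp cP (ctc a) (cts a))|exact: ctc].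
have -> : segint 0 pi (fun a => (P (sq t (t * cos a)) (t * cos a)
      - P (- sq t (t * cos a)) (t * cos a)) * (t * sin a)) = 2 * segint 0 pi h.
  rewrite -segint_rotate //.
  - apply: eq_segint => a ha; rewrite sq_cos // /h.
    rewrite [pi / 2 + a]addrC cosDpihalf sinDpihalf.
    rewrite -[pi / 2 - a]opprB cosN sinN cosBpihalf sinBpihalf opprK mulrN; ring.
  - by move=> a; rewrite /h cosN sinN mulrN P_even.
  - by move=> a; rewrite /h mulr_natl cosD2pi sinD2pi.
rewrite -!segintZ; first last.
- by move=> a _; exact: ch.
rewrite -segintD; first last.
- move=> a _; apply: cvgM; last exact: cts.
  apply: cvgB.
    apply: (cont2_comp cQ (ctc a) (v := fun a => sq t (t * cos a))).
    by apply: (@continuous_comp R R R (fun a => t * cos a) (sq t)); [exact: ctc|exact: sq_cont].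
  apply: (cont2_comp cQ (ctc a) (v := fun a => - sq t (t * cos a))).
  by apply: (@continuous_comp R R R (fun a => t * cos a) (fun x => - sq t x)); [exact: ctc|exact: sqN_cont].
- by move=> a _; apply: cvgM; [exact: cst_continuous|exact: ch].
by apply: eq_segint => a ha; rewrite sq_cos // Q_odd /h; ring.
Qed.
End green.

Lemma cont2_fst (R : realType) : cont2 (fun x _ : R => x).
Proof.
by move=> x y e e0; exists e => // h k he _; rewrite addrAC subrr add0r ltW.
Qed.

Lemma cont2_snd (R : realType) (g : R -> R) : continuous g -> cont2 (fun _ y : R => g y).
Proof.
move=> cg x y e e0; have [d d0 H] := (cont_epsP g y).1 (cg y) e e0.
by exists d => // h k _ kd; exact: H.
Qed.

Lemma cont2M (R : realType) (f g : R -> R -> R) :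
  cont2 f -> cont2 g -> cont2 (fun x y => f x y * g x y).
Proof.
move=> cf cg x y e e0.
pose M := 1 + `|f x y| + `|g x y|.
have M0 : 0 < M by rewrite /M -addrA ltr_wpDr // addr_ge0.
pose eta := Num.min 1 (e / M).
have eta0 : 0 < eta by rewrite /eta lt_min ltr01 divr_gt0.
have eta1 : eta <= 1 by rewrite /eta ge_min lexx.
have etaM : eta * M <= e by rewrite -ler_pdivlMr // /eta ge_min lexx orbT.
have [d1 d10 H1] := cf x y _ eta0; have [d2 d20 H2] := cg x y _ eta0.
exists (Num.min d1 d2); first by rewrite lt_min d10.
move=> h k; rewrite !lt_min => /andP[h1 h2] /andP[k1 k2].
have K1 := H1 h k h1 k1; have K2 := H2 h k h2 k2.
set F := f (x + h) (y + k) in K1 *; set G := g (x + h) (y + k) in K2 *.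
rewrite (_ : _ - _ = (F - f x y) * (G - g x y) + f x y * (G - g x y) + g x y * (F - f x y)); last by ring.
apply: le_trans etaM; apply: (@le_trans _ _ (eta * 1 + `|f x y| * eta + `|g x y| * eta)).
  rewrite (le_trans (ler_normD _ _)) // lerD //.
    rewrite (le_trans (ler_normD _ _)) // !normrM lerD // ?ler_wpM2l //.
    by rewrite ler_pM // (le_trans K2).
  by rewrite normrM ler_wpM2l.
by rewrite /M mulr1 !mulrDr mulr1 ![eta * _]mulrC.
Qed.

Lemma cont2_comp2 (R : realType) (f u v : R -> R -> R) : cont2 f -> cont2 u -> cont2 v ->
  cont2 (fun x y => f (u x y) (v x y)).
Proof.
move=> cf cu cv x y e e0; have [d d0 H] := cf (u x y) (v x y) e e0.
have d2 : 0 < d / 2 by rewrite divr_gt0.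
have dd : d / 2 < d by rewrite ltr_pdivrMr // mulr_natr mulr2n ltrDl.
have [d1 d10 H1] := cu x y _ d2; have [d3 d30 H3] := cv x y _ d2.
exists (Num.min d1 d3); first by rewrite lt_min d10.
move=> h k; rewrite !lt_min => /andP[h1 h3] /andP[k1 k3].
have := H (u (x + h) (y + k) - u x y) (v (x + h) (y + k) - v x y).
rewrite ![_ + (_ - _)]addrC !subrK; apply.
  exact: le_lt_trans (H1 h k h1 k1) dd.
exact: le_lt_trans (H3 h k h3 k3) dd.
Qed.

Lemma rdiff_cont2 (R : realType) (F : R[i] -> R[i]) :
  (forall z, exists A B, rdiff F z A B) ->
  cont2 (fun x y => complex.Re (F (Complex x y))) /\ cont2 (fun x y => complex.Im (F (Complex x y))).
Proof.
move=> HF.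
have K (x y e : R) : 0 < e -> exists2 d, 0 < d & forall h k : R, `|h| < d -> `|k| < d ->
    cmod (F (Complex (x + h) (y + k)) - F (Complex x y)) <= e.
  move=> e0; have [A [B H]] := HF (Complex x y).
  have [d d0 Hd] := rdiff_continuous H e0.
  exists (d / 2) => [|h k hd kd]; first by rewrite divr_gt0.
  have -> : Complex (x + h) (y + k) = Complex x y + Complex h k by simpc.
  apply: Hd; apply: (le_lt_trans (cmod_ReIm _)); rewrite /=.
  by rewrite [d]splitr ltrD.
split=> x y e e0; have [d d0 Hd] := K x y e e0; exists d => // h k hd kd.
  by rewrite -raddfB (le_trans (cmod_Re _)) // Hd.
by rewrite -raddfB (le_trans (cmod_Im _)) // Hd.
Qed.

Lemma ofR_inv (R : realType) (x : R) : ofR x^-1 = (ofR x)^-1.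
Proof. by rewrite /ofR fmorphV. Qed.

(** * The mean value formula for T_F *)

Section mean_value.
Context (R : realType) (s : nat -> R).
Hypothesis s0 : s 0%N = 1.
Hypothesis s_pd : positive_definite s.
Let p := orthopoly_vec s.
Let p' := orthopoly_dvec s.
Let p'' := orthopoly_ddvec s.
Hypothesis regular : forall z,
  [/\ l2 (p z), l2 (p' z), l2 (p'' z), l2quad p (p' z) z & l2quad p' (p'' z) z].
Hypothesis ddvec_regular : forall z,
  l2 (orthopoly_dddvec s z) /\ l2quad p'' (orthopoly_dddvec s z) z.
Local Notation mu := (@lebesgue_measure R).
Local Notation RR := (measurableTypeR R * measurableTypeR R)%type.

Let lp z : l2 (p z). Proof. by have [] := regular z. Qed.
Let lp' z : l2 (p' z). Proof. by have [] := regular z. Qed.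
Let lp'' z : l2 (p'' z). Proof. by have [] := regular z. Qed.

Let norm_neq0 z : l2inner (p z) (p z) != 0.
Proof.
rewrite l2innerxx // -cmod_eq0 cmod_ofR normr_eq0 expf_eq0 /= gt_eqF //.
exact: orthopoly_norm_gt0.
Qed.

Let L := log_slope s.
Let u (x y : R) : R := ln (orthopoly_norm s (Complex x y)).
(** The derivative of [u] along [dz] is [L / 2], so its real partial derivatives are [Re L] and
    [- Im L]. *)
Let P (x y : R) : R := complex.Re (L (Complex x y)).
Let Q (x y : R) : R := - complex.Im (L (Complex x y)).
Let Px (x y : R) : R := complex.Re (log_slope_dz s (Complex x y) + curvature s (Complex x y)).
Let Qy (x y : R) : R := - complex.Im ('i%C * (log_slope_dz s (Complex x y) - curvature s (Complex x y))).

Let log_slope_conjE z : log_slope_conj s z = cconj (L z).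
Proof.
rewrite /log_slope_conj /L /log_slope -/p -/p' !l2innerxx // cconjM -ofR_inv cconj_ofR.
by rewrite (l2innerC (@lp' z) (@lp z)).
Qed.

Let u_rdiff z : rdiff (fun w => ofR (ln (orthopoly_norm s w))) z (2^-1 * L z) (2^-1 * cconj (L z)).
Proof.
rewrite -log_slope_conjE; apply: rdiff_ext (rdiffZ 2^-1 (log_norm_rdiff s0 regular z)) => w.
have E (a : R[i]) : 2^-1 * (a + a) = a by field.
by rewrite lnXn ?orthopoly_norm_gt0 // (mulr2n (ln _)) (rmorphD (@ofR R)) E.
Qed.

Let Re_half (a : R[i]) : complex.Re (2^-1 * a + 2^-1 * cconj a) = complex.Re a.
Proof.
have -> : 2^-1 = ofR 2^-1 :> R[i] by rewrite /ofR fmorphV rmorph_nat.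
by case: a => a b; rewrite /ofR /cconj; simpc => /=; field.
Qed.

Let Re_ihalf (a : R[i]) : complex.Re ('i%C * (2^-1 * a - 2^-1 * cconj a)) = - complex.Im a.
Proof.
have -> : 2^-1 = ofR 2^-1 :> R[i] by rewrite /ofR fmorphV rmorph_nat.
by case: a => a b; rewrite /ofR /cconj; simpc => /=; field.
Qed.

Let u_x (x y : R) : is_derive x 1 (fun x : R => u x y) (P x y).
Proof. by have [+ _] := rdiff_slice_x (u_rdiff (Complex x y)); rewrite Re_half. Qed.

Let u_y (x y : R) : is_derive y 1 (u x) (Q x y).
Proof. by have [+ _] := rdiff_slice_y (u_rdiff (Complex x y)); rewrite Re_ihalf. Qed.

Let P_x (x y : R) : is_derive x 1 (fun x : R => P x y) (Px x y).
Proof. by have [] := rdiff_slice_x (log_slope_rdiff s0 regular (Complex x y)). Qed.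

Let Q_y (x y : R) : is_derive y 1 (Q x) (Qy x y).
Proof.
have [_ H] := rdiff_slice_y (log_slope_rdiff s0 regular (Complex x y)).
exact: (is_deriveN H).
Qed.

Let u_even x y : u x (- y) = u x y.
Proof. by rewrite /u -[RHS]/(ln _) -(orthopoly_norm_conj s (Complex x y)). Qed.

Let P_even x y : P x (- y) = P x y.
Proof.
have [_ <-] := u_x x (- y); have [_ <-] := u_x x y.
by congr ('D_1 _ x); apply/funext => w; rewrite u_even.
Qed.

Let Q_odd x y : Q x (- y) = - Q x y.
Proof.
have dN : is_derive y 1 (fun w : R => - w) (-1) := is_deriveN (is_derive_id y 1).
have [_ H] := @is_derive1_comp R (u x) (fun w : R => - w) y _ _ (u_y x (- y)) dN.
have [_ H2] := u_y x y; rewrite -H2.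
rewrite (_ : u x = u x \o (fun w : R => - w)); first by rewrite H mulrN1 opprK.
by apply/funext => w /=; rewrite u_even.
Qed.

Let slope_rdiff z : exists A B, rdiff L z A B.
Proof. by eexists; eexists; exact: log_slope_rdiff. Qed.

Let norm_rdiff z : exists A B, rdiff (fun w => (l2inner (p w) (p w))^-1) z A B.
Proof.
have [_ _ _ dp _] := regular z.
have := rdiffV (norm_neq0 z) (rdiff_l2inner (@lp) (@lp) (@lp' z) (@lp' z) dp dp).
by move=> H; eexists; eexists; exact: H.
Qed.

(** The first numerator contains [p''], whose differentiability is expressed by [p''']. *)
Let dz_rdiff z : exists A B, rdiff (log_slope_dz s) z A B.
Proof.
have [_ _ _ dp dp'] := regular z; have [lp3 dp''] := ddvec_regular z.
have [A [B H]] := norm_rdiff z.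
have H1 := rdiff_l2inner (@lp'') (@lp) lp3 (@lp' z) dp'' dp.
have H2 := rdiff_l2inner (@lp') (@lp) (@lp'' z) (@lp' z) dp' dp.
have K := rdiffD (rdiffM H1 H) (rdiffZ (-1) (rdiffM (rdiffM H2 H2) (rdiffM H H))).
eexists; eexists; apply: rdiff_ext K => w; rewrite mulN1r /log_slope_dz.
by congr (_ - _); rewrite -exprVn !expr2.
Qed.

Let curvature_rdiff z : exists A B, rdiff (curvature s) z A B.
Proof.
have [_ _ _ dp dp'] := regular z.
have [A [B H]] := norm_rdiff z.
have H1 := rdiff_l2inner (@lp') (@lp') (@lp'' z) (@lp'' z) dp' dp'.
have H2 := rdiff_l2inner (@lp') (@lp) (@lp'' z) (@lp' z) dp' dp.
have H3 := rdiff_l2inner (@lp) (@lp') (@lp' z) (@lp'' z) dp dp'.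
have K := rdiffD (rdiffM H1 H) (rdiffZ (-1) (rdiffM (rdiffM H2 H3) (rdiffM H H))).
eexists; eexists; apply: rdiff_ext K => w; rewrite mulN1r /curvature.
by congr (_ - _); rewrite -exprVn !expr2.
Qed.

Let cP : cont2 P. Proof. by have [] := rdiff_cont2 slope_rdiff. Qed.

Let cQ : cont2 Q.
Proof.
have [_ c] := rdiff_cont2 slope_rdiff => x y e e0; have [d d0 H] := c x y e e0.
by exists d => // h k hd kd; rewrite /Q -opprD normrN H.
Qed.

Let cPx : cont2 Px.
Proof.
have [|c _] := @rdiff_cont2 R (fun z => log_slope_dz s z + curvature s z); last by [].
move=> z; have [A [B H]] := dz_rdiff z; have [A' [B' H']] := curvature_rdiff z.
by eexists; eexists; exact: rdiffD H H'.
Qed.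

Let cQy : cont2 Qy.
Proof.
have [|_ c] := @rdiff_cont2 R (fun z => 'i%C * (log_slope_dz s z - curvature s z)).
  move=> z; have [A [B H]] := dz_rdiff z; have [A' [B' H']] := curvature_rdiff z.
  eexists; eexists; apply: rdiff_ext (rdiffZ 'i%C (rdiffD H (rdiffZ (-1) H'))) => w.
  by rewrite mulN1r.
move=> x y e e0; have [d d0 H] := c x y e e0.
by exists d => // h k hd kd; rewrite /Qy -opprD normrN H.
Qed.

(** The two mixed inner products are conjugate, so their product is a squared modulus. *)
Lemma curvature_real z : complex.Im (curvature s z) = 0.
Proof.
have E : curvature s z = ofR (l2norm (p' z) ^+ 2 / l2norm (p z) ^+ 2
    - cmod (l2inner (p' z) (p z)) ^+ 2 / (l2norm (p z) ^+ 2) ^+ 2).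
  rewrite /curvature -/p -/p' !l2innerxx // [l2inner (p z) (p' z)]l2innerC // mul_cconj.
  have K (a b c : R) : ofR a / ofR b - ofR c / ofR b ^+ 2 = ofR (a / b - c / b ^+ 2).
    by rewrite -[ofR b ^+ 2](rmorphXn (@ofR R)) -!ofR_inv -!(rmorphM (@ofR R)) -(rmorphB (@ofR R)).
  by rewrite K.
by rewrite E.
Qed.

(** The pure second derivatives cancel. The factor is [4 * (1/2)]: the Laplacian is four times the
    mixed derivative, and [u] is half of [ln |p|^2]. *)
Let laplacian x y : Px x y + Qy x y = 2 * complex.Re (curvature s (Complex x y)).
Proof.
rewrite /Px /Qy; move: (log_slope_dz _ _) (curvature _ _) => [a b] [c d].
by simpc => /=; ring.
Qed.

(** The radial derivative of [u] at radius [t] and angle [a]. *)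
Let slope t a := P (t * cos a) (t * sin a) * cos a + Q (t * cos a) (t * sin a) * sin a.

Let slopeP (t a : R) : is_derive t 1 (fun t : R => u (t * cos a) (t * sin a)) (slope t a).
Proof.
apply/is_derive_epsP => e e0.
have [d d0 H] := u_rdiff (Complex (t * cos a) (t * sin a)) e0.
exists d => // h hd; have hE : cmod (ofR h * expi a) = `|h|.
  by rewrite cmodM cmod_ofR cmod_expi mulr1.
have := H (ofR h * expi a); rewrite hE => /(_ hd) => K.
have zE : Complex (t * cos a) (t * sin a) + ofR h * expi a
    = Complex ((t + h) * cos a) ((t + h) * sin a).
  by rewrite /expi /ofR; simpc; rewrite !mulrDl.
rewrite zE in K.
apply: le_trans K; apply: le_trans (cmod_Re _); rewrite le_eqVlt; apply/orP; left; apply/eqP.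
congr (`|_|); rewrite /slope /P /Q /u.
move: (ln _) (ln _) => v w.
have -> : 2^-1 = ofR 2^-1 :> R[i] by rewrite /ofR fmorphV rmorph_nat.
by move: (L _) => [b c]; rewrite /cconj /expi /ofR; simpc => /=; field.
Qed.

Let cslope : cont2 slope.
Proof.
have cc : cont2 (fun t a : R => t * cos a).
  by apply: (cont2M (@cont2_fst R)); apply: cont2_snd; exact: continuous_cos.
have cs : cont2 (fun t a : R => t * sin a).
  by apply: (cont2M (@cont2_fst R)); apply: cont2_snd; exact: continuous_sin.
apply: cont2D; apply: cont2M.
- exact: (cont2_comp2 cP cc cs).
- by apply: cont2_snd; exact: continuous_cos.
- exact: (cont2_comp2 cQ cc cs).
- by apply: cont2_snd; exact: continuous_sin.
Qed.

(** [- 2 i] times [i / (2 pi)] is [1 / pi], so the integrand is the Laplacian of [u] divided by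
    [2 pi], and Green's formula turns it into the flux of the gradient. *)
Lemma disk_integral_chern_form t : 0 <= t ->
  disk_integral t (chern_form s) = ofR (t * (pi^-1 * segint 0 pi (slope t))).
Proof.
move=> t0.
have E z : (- 2 * 'i%C) * chern_form s z
    = ofR ((2 * pi)^-1 * (2 * complex.Re (curvature s z))).
  have := curvature_real z; rewrite /chern_form.
  case: (curvature s z) => c d /= ->.
  have ii : 'i%C * 'i%C = -1 :> R[i] by rewrite -expr2 sqr_i.
  rewrite (_ : _ * _ = -2 * ('i%C * 'i%C) * (ofR (2 * pi))^-1 * ofR c); last first.
    by rewrite (_ : Complex c 0 = ofR c) //; ring.
  rewrite ii /ofR -fmorphV mulrNN mulr1 -(rmorph_nat (real_complex R)) -!rmorphM /=.
  by congr (real_complex R _); ring.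
rewrite /disk_integral /Cintegral; set D := [set q | _].
have mD : measurable D by exact: disk_measurable.
have -> : \int[(mu \x mu)%E]_(q in D) complex.Im (- 2 * 'i%C * chern_form s (Complex (q.1 : R) (q.2 : R))) = 0.
  rewrite (@eq_Rintegral _ _ _ _ _ (fun=> 0)) ?Rintegral_cst ?mul0r //.
  by move=> q _; rewrite E.
congr (Complex _ _).
rewrite (@eq_Rintegral _ _ _ _ _ (fun q : RR => (2 * pi)^-1 * (Px q.1 q.2 + Qy q.1 q.2))); last first.
  by move=> q _; rewrite E laplacian.
rewrite RintegralZl //; last first.
  exact: (cont2_integrable mD (disk_box t0) (cont2D cPx cQy)).
rewrite (green_disk cP cQ cPx cQy P_x Q_y P_even Q_odd t0).
have cs : seg_cont 0 pi (slope t) by move=> a _; exact: cont2_slice.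
rewrite segintZ; last first.
  by move=> a aa; apply: cvgM; [exact: cvg_cst|exact: cs].
rewrite segintZ // -/(slope t); move: (segint _ _ _) => I.
by have := pi_gt0 R; move: (pi : R) => q q0; field; rewrite gt_eqF.
Qed.

(** The factor [t] of the flux cancels the weight [1 / t]; after the exchange of integrals, the
    radial integral of [slope] is [u] on the circle of radius [r] minus [u] at the origin. *)
Lemma charTE r : 0 <= r -> charT s r
  = ofR (pi^-1 * segint 0 pi (fun a => u (r * cos a) (r * sin a)) - u 0 0).
Proof.
move=> r0; rewrite /charT /Cintegral (first_chern_formE s0 s_pd regular).
have p0 : pi != 0 :> R by rewrite gt_eqF // pi_gt0.
have E (t : R) : t \in (`]0, r[%classic : set R) ->
    ofR t^-1 * disk_integral t (chern_form s) = ofR (segint 0 pi (fun a => pi^-1 * slope t a)).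
  rewrite inE /= in_itv /= => /andP[t0 _].
  rewrite disk_integral_chern_form ?ltW // -(rmorphM (@ofR R)) /= mulKf ?gt_eqF //.
  by rewrite segintZ // => a _; exact: cont2_slice.
have -> : \int[mu]_(t in `]0, r[) complex.Im (ofR t^-1 * disk_integral t (chern_form s)) = 0.
  rewrite (@eq_Rintegral _ _ _ _ _ (fun=> 0)) ?Rintegral_cst ?mul0r //.
  by move=> t tr; rewrite E.
congr (Complex _ _).
transitivity (\int[mu]_(t in `]0, r[) segint 0 pi (fun a => pi^-1 * slope t a)).
  by apply: eq_Rintegral => t tr; rewrite E.
have cs : cont2 (fun t a => pi^-1 * slope t a).
  apply: cont2M => //; apply: (@cont2_snd R (fun=> pi^-1)); exact: cst_continuous.
rewrite rect_fubini //.
have -> : segint 0 pi (fun a => segint 0 r (fun t => pi^-1 * slope t a))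
    = segint 0 pi (fun a => pi^-1 * (u (r * cos a) (r * sin a) - u 0 0)).
  apply: eq_segint => a _.
  have cslice : seg_cont 0 r (fun t => slope t a).
    by move=> t _; exact: (@cont2_slice R (fun a t => slope t a) a (cont2_swap cslope) t).
  rewrite segintZ // (segint_FTC r0 (fun t _ => slopeP t a) cslice).
  by rewrite !mul0r.
have cu : seg_cont 0 pi (fun a => u (r * cos a) (r * sin a)).
  have cu2 : cont2 u.
    have [|c _] := @rdiff_cont2 R (fun w => ofR (ln (orthopoly_norm s w))); last by [].
    by move=> z; eexists; eexists; exact: u_rdiff.
  move=> a _; apply: (cont2_comp cu2 (u := fun a => r * cos a) (v := fun a => r * sin a)).
    by apply: cvgM; [exact: cvg_cst|exact: continuous_cos].
  by apply: cvgM; [exact: cvg_cst|exact: continuous_sin].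
rewrite segintZ; last by apply: seg_contB => //; exact: seg_cont_cst.
rewrite segintB ?segint_cst ?pi_ge0 // ?subr0; last exact: seg_cont_cst.
by rewrite mulrBr [u 0 0 * _]mulrC mulKf.
Qed.
End mean_value.

Theorem theorem8p2 (R : realType) (s : nat -> R)
    (s0 : s 0%N = 1) (s_pd : positive_definite s) (s_ind : indeterminate s) :
  [/\ forall lam : R[i], l2 (orthopoly_vec s lam),
      is_first_chern_form s (first_chern_form s),
      forall lam : R[i],
        first_chern_form s lam
        = 2 * ddc (fun z => ofR (ln (orthopoly_norm s z))) lam
    & forall r : R, 0 <= r ->
        charT s r
        = ofR (pi^-1 * (\int[@lebesgue_measure R]_(phi in `[0, pi])
                          ln (orthopoly_norm s (Complex (r * cos phi) (r * sin phi))))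
               - ln (orthopoly_norm s 0))].
Proof.
have [l [m [lm lp lc]]] := indeterminate_l2 s0 s_pd s_ind.
have regular := orthopoly_vec_regular s_pd lm lp lc.
have regular3 := orthopoly_ddvec_regular s_pd lm lp lc.
have cE := first_chern_formE s0 s_pd regular.
split.
- by move=> lam; have [] := regular lam.
- by rewrite cE; exact: is_first_chern_form_curvature.
- by move=> lam; rewrite cE ddc_log_norm.
- by move=> r r0; rewrite (charTE s0 s_pd regular regular3 r0).
Qed.
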